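(* Let $\mathcal{P}$ be a uniform plane in $(\mathbb{C}^* )^3$, and denote by $u_0,u_1,u_2,u_3$ the primitive integer directions of the four edges of $\operatorname{Trop}(\mathcal{P})$. Let $d\ge1$ be an integer and let $C$ be the fan tropical curve in $\operatorname{Trop}(\mathcal{P})$ with four rays of weight 1 in the primitive integer directions $$u_1+(d-1)u_2,\qquad (d-1)u_1+u_0,\qquad du_3+(d-1)u_0,\qquad u_2.$$ Then $C$ is approximable by a complex curve $\mathcal{C}\subset\mathcal{P}$ (i.e. there exists an algebraic curve $\mathcal{C}\subset\mathcal{P}$ with $\operatorname{Trop}(\mathcal{C})=C$) if and only if $d=1,2$ or $3$.
   Context: A plane in $(\mathbb{C}^* )^3$ is a surface not contained in a translate of a strict subtorus which, up to the action of $\mathrm{Aut}((\mathbb{C}^* )^3)=GL_3(\mathbb{Z})$, is given by an equation of degree 1. It is uniform if its compactification $\overline{\mathcal{P}}\simeq\mathbb{C}P^2$ as a projective plane has complement $\overline{\mathcal{P}}\setminus\mathcal{P}$ consisting of four lines no three of which are concurrent; up to coordinates (monomial changes and rescaling) $\mathcal{P}=\{z_1+z_2+z_3+1=0\}$. $\operatorname{Trop}(\mathcal{P})=\lim_{t\to\infty}\mathrm{Log}_t(\mathcal{P})$, $\mathrm{Log}_t(z_i)=(\log|z_i|/\log t)$, is the fan whose 2-dimensional cones are those spanned by pairs of the four vectors $u_0,\dots,u_3$ (with $u_0+u_1+u_2+u_3=0$ and any three forming a basis of $\mathbb{Z}^3$). A fan tropical curve in $\mathbb{R}^3$ is a 1-dimensional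 rational fan with positive integer weights $w_e$ on its edges satisfying $\sum_e w_ev_e=0$, $v_e$ the outgoing primitive integer direction of $e$. For an algebraic curve $\mathcal{C}\subset(\mathbb{C}^* )^3$, $\operatorname{Trop}(\mathcal{C})$ is $\lim_{t\to\infty}\mathrm{Log}_t(\mathcal{C})$ with weights: in a toric compactification where the closure $\overline{\mathcal{C}}$ meets no intersection of two toric divisors, $w_e$ is the sum of the intersection multiplicities of $\overline{\mathcal{C}}$ with the toric divisor corresponding to $e$. *)

(* Defs.v *)
From mathcomp Require Import all_boot all_order all_algebra.
From mathcomp Require Import boolp classical_sets reals topology normedtype exp.
From mathcomp Require Import complex.
(* The notations of mpoly and of mathcomp-analysis have incompatible levels. *)
From mathcomp Require Import -(notations) mpoly.

Set Implicit Arguments.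
Unset Strict Implicit.
Unset Printing Implicit Defensive.

Import Order.TTheory GRing.Theory Num.Theory.
Import numFieldNormedType.Exports.

Local Open Scope classical_set_scope.
Local Open Scope ring_scope.

(** ** Complex tori and planes *)

Definition torus (R : realType) (n : nat) : set {ffun 'I_n -> R[i]} :=
  [set z | forall i, z i != 0].

Definition monomial_map (R : realType) (m n : nat) (A : 'M[int]_(m, n))
    (z : {ffun 'I_n -> R[i]}) : {ffun 'I_m -> R[i]} :=
  [ffun i => \prod_j z j ^ A i j].

(* A strict subtorus of (C^* )^3 is the image of a homomorphism
   (C^* )^k -> (C^* )^3 with k < 3; [c] is the translation. *)
Definition in_strict_subtorus_translate (R : realType)
    (X : set {ffun 'I_3 -> R[i]}) : Prop :=
  exists k : nat, exists B : 'M[int]_(3, k), exists c : {ffun 'I_3 -> R[i]},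
    [/\ (k < 3)%N, torus c &
      X `<=` [set z | exists2 s, torus s &
                        z = [ffun i => c i * monomial_map B s i]]].

Definition has_linear_equation (R : realType) (P : set {ffun 'I_3 -> R[i]})
    (A : 'M[int]_3) (a : {ffun 'I_4 -> R[i]}) : Prop :=
  [/\ A \in unitmx,
      exists i, a (lift ord0 i) != 0 &
      P = [set z | torus z /\
             a 0 + \sum_(i < 3) a (lift ord0 i) * monomial_map A z i = 0]].

Definition plane (R : realType) (P : set {ffun 'I_3 -> R[i]}) : Prop :=
  (exists A a, has_linear_equation P A a) /\ ~ in_strict_subtorus_translate P.

(* Subsets of CP^3 are given by the nonzero homogeneous coordinate vectors of
   their points; [z] in the torus is the point [1 : z_1 : z_2 : z_3]. *)
Definition proj_plane (R : realType) (a : {ffun 'I_4 -> R[i]}) :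
    set {ffun 'I_4 -> R[i]} :=
  [set x : {ffun 'I_4 -> R[i]} | x != 0 /\ \sum_i a i * x i = 0].

Definition boundary_line (R : realType) (a : {ffun 'I_4 -> R[i]}) (i : 'I_4) :
    set {ffun 'I_4 -> R[i]} :=
  proj_plane a `&` [set x : {ffun 'I_4 -> R[i]} | x i = 0].

(* The complement of the plane in its closure is the union of the four sets
   [boundary_line a i]; each is a line as soon as it is not the whole closure. *)
Definition generic_boundary (R : realType) (a : {ffun 'I_4 -> R[i]}) : Prop :=
  [/\ forall i, boundary_line a i `<` proj_plane a,
      injective (boundary_line a) &
      forall i j k, i != j -> j != k -> i != k ->
        boundary_line a i `&` boundary_line a j `&` boundary_line a k = set0].

Definition uniform_plane (R : realType) (P : set {ffun 'I_3 -> R[i]}) : Prop :=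
  plane P /\ exists A a, has_linear_equation P A a /\ generic_boundary a.

(** ** Algebraic curves in the torus *)

(* Ordinary polynomials suffice: on the torus, Laurent polynomials differ from
   them by nowhere vanishing monomials. *)
Definition zariski_closed (R : realType) (X : set {ffun 'I_3 -> R[i]}) : Prop :=
  exists S : set (mpoly 3 R[i]),
    X = [set z | torus z /\ forall f, S f -> meval z f = 0].

Definition irreducible_closed (R : realType) (X : set {ffun 'I_3 -> R[i]}) :
    Prop :=
  [/\ zariski_closed X, X !=set0 &
      forall Y Z, zariski_closed Y -> zariski_closed Z ->
        X `<=` Y `|` Z -> X `<=` Y \/ X `<=` Z].

(* Irreducible of Krull dimension exactly 1. *)
Definition irreducible_curve (R : realType) (X : set {ffun 'I_3 -> R[i]}) :
    Prop :=
  [/\ irreducible_closed X,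
      exists Y, irreducible_closed Y /\ Y `<` X &
      ~ exists Y Z, [/\ irreducible_closed Y, irreducible_closed Z,
                        Z `<` Y & Y `<` X]].

Definition algebraic_curve (R : realType) (X : set {ffun 'I_3 -> R[i]}) :
    Prop :=
  exists n : nat, exists Y : 'I_n.+1 -> set {ffun 'I_3 -> R[i]},
    (forall i, irreducible_curve (Y i)) /\ X = \bigcup_i Y i.

(** ** Limits of amoebas *)

Definition Logt (R : realType) (t : R) (z : {ffun 'I_3 -> R[i]}) : 'cV[R]_3 :=
  \col_i (ln (ComplexField.Normc.normc (z i)) / ln t).

(* Kuratowski (= Hausdorff on compact sets) convergence of Log_t(X) to L as
   t tends to +oo: the lower and the upper limits both equal L. *)
Definition log_liminf (R : realType) (X : set {ffun 'I_3 -> R[i]}) :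
    set 'cV[R]_3 :=
  [set x | forall U, nbhs x U ->
     \forall t \near +oo, ((@Logt R t @` X) `&` U) !=set0].

Definition log_limsup (R : realType) (X : set {ffun 'I_3 -> R[i]}) :
    set 'cV[R]_3 :=
  [set x | forall U, nbhs x U ->
     forall T : R, exists2 t, T < t & ((@Logt R t @` X) `&` U) !=set0].

Definition log_limit (R : realType) (X : set {ffun 'I_3 -> R[i]})
    (L : set 'cV[R]_3) : Prop :=
  log_liminf X = L /\ log_limsup X = L.

(** ** Fans *)

Definition realv (R : realType) (v : 'cV[int]_3) : 'cV[R]_3 := map_mx intr v.

Definition primitive (v : 'cV[int]_3) : Prop :=
  v != 0 /\ forall (k : int) (w : 'cV[int]_3), v = k *: w -> k \is a GRing.unit.

Definition cone2 (R : realType) (v w : 'cV[int]_3) : set 'cV[R]_3 :=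
  [set x | exists a b : R,
     [/\ 0 <= a, 0 <= b & x = a *: realv R v + b *: realv R w]].

Definition ray (R : realType) (v : 'cV[int]_3) : set 'cV[R]_3 :=
  [set x | exists2 a : R, 0 <= a & x = a *: realv R v].

(* [T] is the fan with edges spanned by the primitive vectors [u i] and with
   2-dimensional cones spanned by all pairs of them. *)
Definition uniform_plane_fan (R : realType) (T : set 'cV[R]_3)
    (u : 'I_4 -> 'cV[int]_3) : Prop :=
  [/\ forall i, primitive (u i),
      \sum_i u i = 0,
      forall i : 'I_4, \matrix_(k < 3, j < 3) u (lift i j) k 0 \in unitmx &
      T = [set x | exists i j, i != j /\ cone2 (u i) (u j) x]].

(* A fan tropical curve is given by its list of edges (v_e, w_e). *)
Definition fan_tropical_curve (C : seq ('cV[int]_3 * nat)) : Prop :=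
  [/\ uniq (map fst C),
      forall e, e \in C -> primitive e.1 /\ (0 < e.2)%N &
      \sum_(e <- C) e.1 *+ e.2 = 0].

Definition fan_support (R : realType) (C : seq ('cV[int]_3 * nat)) :
    set 'cV[R]_3 :=
  [set x | x = 0 \/ exists2 e, e \in C & ray e.1 x].

(** ** Intersection multiplicities with toric divisors *)

Definition vanishing_ideal (R : realType) (Y : set {ffun 'I_3 -> R[i]}) :
    set (mpoly 3 R[i]) :=
  [set f | forall y, Y y -> meval y f = 0].

(* Points of the closure of Y in C x (C^* )^2 lying on the divisor C-coordinate
   = 0. *)
Definition divisor_points (R : realType) (Y : set {ffun 'I_3 -> R[i]}) :
    set {ffun 'I_3 -> R[i]} :=
  [set p | [/\ p 0 = 0, p 1 != 0, p 2 != 0 &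
             forall f, vanishing_ideal Y f -> meval p f = 0]].

(* The local ring of C x (C^* )^2 at p, inside the field of rational functions. *)
Definition local_ring (R : realType) (p : {ffun 'I_3 -> R[i]}) :
    set {fraction mpoly 3 R[i]} :=
  [set x | exists f g : mpoly 3 R[i],
     meval p g != 0 /\ x = tofrac f / tofrac g].

(* The ideal generated in the local ring at p by the ideal of Y and by the
   equation of the divisor. *)
Definition local_intersection_ideal (R : realType)
    (Y : set {ffun 'I_3 -> R[i]}) (p : {ffun 'I_3 -> R[i]}) :
    set {fraction mpoly 3 R[i]} :=
  [set x | exists f h g : mpoly 3 R[i],
     [/\ vanishing_ideal Y f, meval p g != 0 &
         x = tofrac (f + h * mpolyX R[i] (mnm1 0)) / tofrac g]].

(* The intersection multiplicity at p of the closure of Y with the divisor is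
   the dimension over C of the quotient of the two sets above: m is this
   dimension iff the classes of some b_1, ..., b_m form a basis. *)
Definition intersection_multiplicity (R : realType)
    (Y : set {ffun 'I_3 -> R[i]}) (p : {ffun 'I_3 -> R[i]}) (m : nat) : Prop :=
  exists b : 'I_m -> {fraction mpoly 3 R[i]},
    (forall i, local_ring p (b i)) /\
    forall x, local_ring p x ->
      exists! c : 'rV[R[i]]_m,
        local_intersection_ideal Y p
          (x - \sum_i tofrac (mpolyC 3 (c 0 i)) * b i).

(* Log_t z tends to infinity in the direction v along the curves
   s |-> (s^(-v_i) c_i) as s tends to 0. When B v = (-1, 0, 0), the monomial
   change of coordinates B therefore identifies the toric chart of the ray
   spanned by v, i.e. the union of the torus and of the open orbit of the
   corresponding divisor, with C x (C^* )^2, the divisor being the zero locus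
   of the first coordinate. As the closure of X meets no intersection of two
   divisors, all its intersection points with the divisor are in this chart. *)
Definition edge_weight (R : realType) (X : set {ffun 'I_3 -> R[i]})
    (v : 'cV[int]_3) (w : nat) : Prop :=
  exists B : 'M[int]_3,
    [/\ B \in unitmx, B *m v = - delta_mx 0 0 &
      exists (s : seq {ffun 'I_3 -> R[i]}) (m : {ffun 'I_3 -> R[i]} -> nat),
        [/\ uniq s,
            forall p, p \in s <-> divisor_points (@monomial_map R 3 3 B @` X) p,
            forall p, p \in s ->
              intersection_multiplicity (@monomial_map R 3 3 B @` X) p (m p) &
            w = (\sum_(p <- s) m p)%N]].

(** ** Approximation *)

(* Trop(X) = C, as a weighted fan. *)
Definition tropicalizes_to (R : realType) (X : set {ffun 'I_3 -> R[i]})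
    (C : seq ('cV[int]_3 * nat)) : Prop :=
  log_limit X (@fan_support R C) /\
  forall e, e \in C -> edge_weight X e.1 e.2.

Definition approximable_in (R : realType) (P : set {ffun 'I_3 -> R[i]})
    (C : seq ('cV[int]_3 * nat)) : Prop :=
  exists X, [/\ algebraic_curve X, X `<=` P & tropicalizes_to X C].

(* Main.v *)
Require Import Defs.
From mathcomp Require Import all_boot all_order all_algebra.
From mathcomp Require Import boolp classical_sets reals topology normedtype sequences exp.
From mathcomp Require Import complex.
From mathcomp Require Import -(notations) mpoly.
From mathcomp Require Import ring lra zify.

Set Implicit Arguments.
Unset Strict Implicit.
Unset Printing Implicit Defensive.

Import Order.TTheory GRing.Theory Num.Theory.
Import numFieldNormedType.Exports.
Local Open Scope classical_set_scope.
Local Open Scope ring_scope.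

(** Put n = d - 1. After a monomial change of coordinates and a rescaling the
    plane is the graph W = - (Y + S^n + S^(n+1)) over the plane of (S, Y): the
    equation z1 + z2 + z3 + 1 = 0 is multiplied by z3^n, and S = z3,
    Y = z3^n z1, W = z3^n z2 ([standard_coordinates]). The only thing to check
    there is that the edges of Trop(P), given as a limit, are the directions in
    which three of the four monomials of the equation have equal and maximal
    size ([tropical_edges]). In the coordinates (log|S|, log|Y|, log|W|) the
    rays of C are spanned by
      (0, -1, -n),  (1, 1, n+1),  (-1, 0, 0)  and  (0, 0, -1).

    Necessity of d <= 3. Let X be a curve in P that tropicalizes to C. By
    compactness, the points of X far from the origin have logarithms close to
    the four rays ([near_asymptotic_cone]). Consider the equation G(S, Y) of
    smallest degree in Y satisfied by X over the rational functions of S.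
      - Its leading coefficient in Y has no root: near a root some branch Y
        would tend to infinity with S bounded, and no ray allows this
        ([lead_coef_no_root]).
      - G(0, 0) is nonzero: otherwise some branch Y would tend to 0 at least as
        fast as a power of S when S tends to 0, and no ray allows this
        ([constant_coef_neq0]).
      - The roots of G(0, Y) are thus nonzero, as many as the degree, and give
        intersections of the closure of X with the divisor of (-1, 0, 0). This
        ray has weight 1, so the degree is 1 ([X_graph], [trace_weight]).
    Hence X is the graph of a polynomial Y = h(S) with h(0) nonzero. The ray
    (1, 1, n+1) gives deg h = 1, so h = e (S - al) with al nonzero. When S tends
    to al, the curve follows the ray (0, -1, -n), so (S - al)^n divides
    h + S^n + S^(n+1). The value at al gives al = -1; dividing by S + 1 shows
    that (S + 1)^(n-1) divides S^n + e, whose derivative does not vanish at -1.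
    Therefore n <= 2 ([graph_small_degree]).

    Sufficiency. For n = 0, 1, 2 there is a line Y = c1 + a1 S on which
    W = Y^n (c2 + a2 S) ([third_on_line]). In the coordinates (S, Y, W / Y^n)
    the corresponding curve is a line in general position, with rays - e_0,
    - e_1, - e_2 and (1, 1, 1). The class of such lines is stable under the
    monomial maps that permute these four directions, so it is enough to look
    at the divisor of - e_0, which the line meets in one point, transversally
    ([line_chart_tropicalizes]). *)

(** * Absolute values and logarithms of polynomials *)

Notation nm := ComplexField.Normc.normc.
Notation lg z := (ln (nm z)).

Section Norm.
Variable R : realType.
Local Notation C := R[i].
Implicit Types (x y z : C) (p q : {poly C}).

Lemma nm_ge0 x : 0 <= nm x.
Proof. by case: x => a b; rewrite /= sqrtr_ge0. Qed.

Lemma nm0 : nm (0 : C) = 0.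
Proof. by rewrite ComplexField.Normc.normc0. Qed.

Lemma nm_eq0 x : (nm x == 0) = (x == 0).
Proof.
by apply/eqP/eqP => [/ComplexField.Normc.eq0_normc//|->]; rewrite nm0.
Qed.

Lemma nm_gt0 x : (0 < nm x) = (x != 0).
Proof. by rewrite lt_neqAle nm_ge0 andbT eq_sym nm_eq0. Qed.

Lemma nm1 : nm (1 : C) = 1. Proof. exact: ComplexField.Normc.normc1. Qed.

Lemma nmM x y : nm (x * y) = nm x * nm y.
Proof. exact: ComplexField.Normc.normcM. Qed.

Lemma nmV x : nm x^-1 = (nm x)^-1.
Proof. exact: ComplexField.Normc.normcV. Qed.

Lemma nmX x n : nm (x ^+ n) = nm x ^+ n.
Proof. by elim: n => [|n IH]; rewrite ?expr0 ?nm1// !exprS nmM IH. Qed.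

Lemma nm_le_add x y : nm (x + y) <= nm x + nm y.
Proof. exact: le_normcD. Qed.

Lemma nmN x : nm (- x) = nm x.
Proof. exact: normcN. Qed.

Lemma nm_distC x y : nm (x - y) = nm (y - x).
Proof. by rewrite -opprB nmN. Qed.

Lemma nm_sub_le x y : nm x - nm y <= nm (x + y).
Proof. by have := nm_le_add (x + y) (- y); rewrite nmN addrK; lra. Qed.

Lemma nm_real (a : R) : nm (real_complex R a) = `|a|.
Proof. by rewrite /= expr0n /= addr0 sqrtr_sqr. Qed.

Lemma nm_prod (I : Type) (s : seq I) (F : I -> C) :
  nm (\prod_(i <- s) F i) = \prod_(i <- s) nm (F i).
Proof. by elim: s => [|i s IH]; rewrite ?big_nil ?nm1// !big_cons nmM IH. Qed.

Lemma nm_sum_le (I : Type) (s : seq I) (Q : pred I) (F : I -> C) :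
  nm (\sum_(i <- s | Q i) F i) <= \sum_(i <- s | Q i) nm (F i).
Proof.
elim: s => [|i s IH]; rewrite ?big_nil ?nm0// !big_cons.
by case: ifP => // _; apply: le_trans (nm_le_add _ _) _; rewrite lerD2l.
Qed.

Lemma lgM x y : x != 0 -> y != 0 -> lg (x * y) = lg x + lg y.
Proof. by move=> x0 y0; rewrite nmM lnM // posrE nm_gt0. Qed.

Lemma lgV x : x != 0 -> lg x^-1 = - lg x.
Proof. by move=> x0; rewrite nmV lnV // posrE nm_gt0. Qed.

Lemma lgX x n : x != 0 -> lg (x ^+ n) = lg x *+ n.
Proof. by move=> x0; rewrite nmX lnXn // nm_gt0. Qed.

Lemma lgXz x (n : int) : x != 0 -> lg (x ^ n) = n%:~R * lg x.
Proof.
move=> x0; case: n => n; first by rewrite -exprnP lgX // -mulr_natl.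
rewrite NegzE -exprnN lgV ?expf_neq0 // lgX //.
by rewrite rmorphN mulNr -mulr_natl.
Qed.

Lemma lg_prod (I : Type) (s : seq I) (F : I -> C) : (forall i, F i != 0) ->
  lg (\prod_(i <- s) F i) = \sum_(i <- s) lg (F i).
Proof.
move=> F0; elim: s => [|i s IH]; rewrite ?big_nil ?nm1 ?ln1// !big_cons lgM//.
  by rewrite IH.
by elim: s {IH} => [|j s IH]; rewrite ?big_nil ?oner_eq0// big_cons mulf_neq0.
Qed.

Lemma poly_bounded p z0 : exists2 M : R, 0 < M &
  forall z, nm (z - z0) <= 1 -> nm p.[z] <= M.
Proof.
elim/poly_ind: p => [|p c [M M0 IH]].
  by exists 1 => // z _; rewrite horner0 nm0 ler01.
exists (M * (1 + nm z0) + nm c + 1); first by have := nm_ge0 z0; have := nm_ge0 c; nra.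
move=> z hz; rewrite hornerMXaddC.
have h1 : nm z <= 1 + nm z0.
  by have := nm_le_add (z - z0) z0; rewrite subrK; lra.
apply: le_trans (nm_le_add _ _) _; rewrite nmM.
have : nm p.[z] * nm z <= M * (1 + nm z0).
  by apply: ler_pM => //; [exact: nm_ge0|exact: nm_ge0|exact: IH].
lra.
Qed.

Lemma poly_near_lt p z0 (e : R) : 0 < e -> exists2 dl : R, 0 < dl &
  forall z, nm (z - z0) < dl -> nm (p.[z] - p.[z0]) < e.
Proof.
move=> e0.
have /factor_theorem[q Eq] : root (p - p.[z0]%:P) z0.
  by rewrite /root hornerD hornerN hornerC subrr.
have [M M0 hM] := poly_bounded q z0.
exists (Num.min 1 (e / M)); first by rewrite lt_min ltr01 divr_gt0.
move=> z; rewrite lt_min ltr_pdivlMr // => /andP[z1 z2].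
have := congr1 (fun r => r.[z]) Eq.
rewrite /= hornerD hornerN hornerC => ->.
rewrite hornerM hornerXsubC nmM mulrC.
apply: le_lt_trans z2; apply: ler_wpM2l; first exact: nm_ge0.
by apply: hM; exact: ltW.
Qed.

Lemma poly_near_ge p z0 : p.[z0] != 0 -> exists c dl : R,
  [/\ 0 < c, 0 < dl & forall z, nm (z - z0) < dl -> c <= nm p.[z]].
Proof.
move=> p0; have c0 : 0 < nm p.[z0] / 2 by rewrite divr_gt0 // nm_gt0.
have [dl dl0 h] := poly_near_lt p z0 c0.
exists (nm p.[z0] / 2), dl; split=> // z /h.
have := nm_le_add (- (p.[z] - p.[z0])) p.[z]; rewrite nmN.
by rewrite opprB subrK; lra.
Qed.

Lemma poly_isolated p z0 : p != 0 -> exists2 dl : R, 0 < dl &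
  forall z, z != z0 -> nm (z - z0) < dl -> p.[z] != 0.
Proof.
move=> p0; have [m [q qz Eq]] := multiplicity_XsubC p z0.
move: qz; rewrite p0 /= => qz; have [c [dl [c0 dl0 h]]] := poly_near_ge qz.
exists dl => // z zz0 /h hz; rewrite Eq hornerM mulf_neq0 //.
  by rewrite -nm_gt0; apply: lt_le_trans hz.
by rewrite horner_exp hornerXsubC expf_neq0 // subr_eq0.
Qed.

Lemma poly_at_infty p : p != 0 -> exists rho c1 c2 : R,
  [/\ 1 <= rho, 0 < c1, 0 < c2 & forall z, rho <= nm z ->
    c1 * nm z ^+ (size p).-1 <= nm p.[z] <= c2 * nm z ^+ (size p).-1].
Proof.
elim/poly_ind: p => [|p c IH]; first by rewrite eqxx.
have [->|p0] := eqVneq p 0.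
  rewrite mul0r add0r polyC_eq0 => c0; exists 1, (nm c), (nm c).
  rewrite nm_gt0 c0; split=> // z _.
  by rewrite size_polyC c0 /= expr0 mulr1 hornerC lexx.
move=> _; have [rho [c1 [c2 [r1 c10 c20 h]]]] := IH p0.
have -> : (size (p * 'X + c%:P)).-1 = (size p).-1.+1.
  by rewrite size_MXaddC (negPf p0) /= prednK // size_poly_gt0.
set n := (size p).-1 in h *.
exists (rho + 2 * nm c / c1), (c1 / 2), (c2 + nm c); split=> //.
- have : 0 <= 2 * nm c / c1 by apply: divr_ge0 (ltW c10); rewrite mulr_ge0 // nm_ge0.
  lra.
- lra.
- by have := nm_ge0 c; lra.
move=> z hz; have q0 : 0 <= 2 * nm c / c1 by apply: divr_ge0 (ltW c10); rewrite mulr_ge0 // nm_ge0.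
have /h /andP[h1 h2] : rho <= nm z by lra.
have z1 : 1 <= nm z by lra.
have hc : nm c <= c1 / 2 * nm z.
  have : 2 * nm c / c1 <= nm z by lra.
  by rewrite ler_pdivrMr //; lra.
have e1 : 1 <= nm z ^+ n by apply: exprn_ege1.
rewrite hornerMXaddC exprS; set E := nm z ^+ n in h1 h2 e1 *.
have := nm_le_add (p.[z] * z) c; have := nm_sub_le (p.[z] * z) c; rewrite !nmM.
set u := nm p.[z] in h1 h2 *; set w := nm z in z1 hc *; set k := nm c in hc *.
have k0 : 0 <= k by exact: nm_ge0.
move=> A B; apply/andP; split.
  apply: le_trans A.
  have : c1 * E * w <= u * w by apply: ler_wpM2r => //; lra.
  have : c1 / 2 * w <= c1 / 2 * w * E by apply: ler_peMr => //; nra.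
  nra.
apply: le_trans B _.
have : u * w <= c2 * E * w by apply: ler_wpM2r => //; lra.
have : k <= k * (w * E) by apply: ler_peMr => //; nra.
nra.
Qed.

End Norm.

Section Log.
Variable R : realType.
Local Notation C := R[i].
Implicit Types (x y z : C) (p q : {poly C}).

Lemma ln_le_sub1 (u : R) : 0 < u -> ln u <= u - 1.
Proof. by move=> u0; rewrite -[X in ln X](subrKC 1 u); apply: le_ln1Dx; lra. Qed.

Lemma ln_mono (a b : R) : 0 < a -> a <= b -> ln a <= ln b.
Proof. by move=> a0 ab; rewrite ler_ln // posrE //; exact: lt_le_trans ab. Qed.

Lemma lg_close x y (c : R) : x != 0 -> y != 0 -> 1 <= c ->
  nm x <= c * nm y -> nm y <= c * nm x -> `|lg x - lg y| <= c - 1.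
Proof.
move=> x0 y0 c1 h1 h2; have c0 : 0 < c by lra.
have hc := ln_le_sub1 c0.
have aux a b : a != 0 -> b != 0 -> nm a <= c * nm b -> lg a <= ln c + lg b.
  move=> a0 b0 h; rewrite -lnM ?posrE ?nm_gt0 // ler_ln // ?posrE ?nm_gt0 //.
  by rewrite mulr_gt0 // nm_gt0.
have := aux _ _ x0 y0 h1; have := aux _ _ y0 x0 h2.
by rewrite ler_norml => ? ?; apply/andP; split; lra.
Qed.

(** These two estimates turn the growth of a polynomial at infinity, and its
    order of vanishing at a point, into slopes of logarithms. *)
Lemma lg_at_infty p : p != 0 -> exists rho c : R, [/\ 1 <= rho, 0 <= c &
  forall z, rho <= nm z -> `|lg p.[z] - (size p).-1%:R * lg z| <= c].
Proof.
move=> p0; have [rho [c1 [c2 [r1 c10 c20 h]]]] := poly_at_infty p0.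
exists rho, (`|ln c1| + `|ln c2|); split=> //; first exact: addr_ge0.
move=> z hz.
have z0 : 0 < nm z by lra.
have zn : 0 < nm z ^+ (size p).-1 by apply: exprn_gt0.
have /andP[h1 h2] := h z hz.
have pz : 0 < nm p.[z] by apply: lt_le_trans h1; apply: mulr_gt0.
have E : ln (nm z ^+ (size p).-1) = (size p).-1%:R * lg z by rewrite lnXn // mulr_natl.
move/ln_mono: h1 => /(_ (mulr_gt0 c10 zn)) h1; move/(ln_mono pz): h2; move: h1.
rewrite !lnM ?posrE // E => h1 h2.
have := ler_norm (ln c2); have := ler_norm (- ln c1); rewrite normrN.
have := normr_ge0 (ln c1); have := normr_ge0 (ln c2).
by rewrite ler_norml => ? ? ? ?; apply/andP; split; lra.
Qed.

Lemma lg_near_root p (k : nat) z0 q : p = q * ('X - z0%:P) ^+ k -> q.[z0] != 0 ->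
  exists dl c : R, [/\ 0 < dl, 0 <= c & forall z, z != z0 -> nm (z - z0) < dl ->
    p.[z] != 0 /\ `|lg p.[z] - k%:R * lg (z - z0)| <= c].
Proof.
move=> -> q0; have [c [dl [c0 dl0 h]]] := poly_near_ge q0.
have [M M0 hM] := poly_bounded q z0.
exists (Num.min 1 dl), (`|ln c| + `|ln M|); split; [by rewrite lt_min ltr01|exact: addr_ge0|].
move=> z zz0; rewrite lt_min => /andP[z1 /h hz].
have zz : z - z0 != 0 by rewrite subr_eq0.
have qz : q.[z] != 0 by rewrite -nm_gt0; apply: lt_le_trans hz.
rewrite hornerM horner_exp hornerXsubC; split; first by rewrite mulf_neq0 // expf_neq0.
rewrite lgM ?expf_neq0 // lgX // -[_ *+ k]mulr_natl addrK.
have := hM z (ltW z1); move/(ln_mono c0): hz => hz /ln_mono; rewrite nm_gt0 => /(_ qz); move: hz.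
have := ler_norm (ln M); have := ler_norm (- ln c); rewrite normrN.
have := normr_ge0 (ln c); have := normr_ge0 (ln M).
by rewrite ler_norml => ? ? ? ? ? ?; apply/andP; split; lra.
Qed.

Lemma prod_nm_le (s : seq C) (b : R) : (forall x, x \in s -> nm x <= b) ->
  \prod_(x <- s) nm x <= b ^+ size s.
Proof.
elim: s => [|a s IH] h; first by rewrite big_nil expr0.
rewrite big_cons exprS; apply: ler_pM; rewrite ?nm_ge0 //.
- by apply: prodr_ge0 => x _; exact: nm_ge0.
- by apply: h; exact: mem_head.
- by apply: IH => x xs; apply: h; rewrite inE xs orbT.
Qed.

Lemma prod_nm_ge (s : seq C) (b : R) : 0 <= b -> (forall x, x \in s -> b <= nm x) ->
  b ^+ size s <= \prod_(x <- s) nm x.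
Proof.
move=> b0; elim: s => [|a s IH] h; first by rewrite big_nil expr0.
rewrite big_cons exprS; apply: ler_pM; rewrite ?exprn_ge0 //.
- by apply: h; exact: mem_head.
- by apply: IH => x xs; apply: h; rewrite inE xs orbT.
Qed.

Lemma large_factor (s : seq C) (B : R) : (0 < size s)%N ->
  B <= \prod_(x <- s) nm x -> exists2 x, x \in s & B <= nm x ^+ size s.
Proof.
move=> s0 hB.
suff [x xs hx] : exists2 x, x \in s & forall y, y \in s -> nm y <= nm x.
  by exists x => //; apply: le_trans hB _; exact: prod_nm_le.
elim: s s0 {hB} => // a [|b s] IH _.
  by exists a; rewrite ?mem_head // => y; rewrite inE => /eqP->.
have [//|x xs hx] := IH _; have [h|/ltW h] := leP (nm x) (nm a).
  exists a; first exact: mem_head.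
  by move=> y; rewrite inE => /predU1P[->//|/hx]; move=> /le_trans; apply.
exists x; first by rewrite inE xs orbT.
by move=> y; rewrite inE => /predU1P[->|/hx].
Qed.

Lemma small_factor (s : seq C) (B : R) : (0 < size s)%N ->
  \prod_(x <- s) nm x <= B -> exists2 x, x \in s & nm x ^+ size s <= B.
Proof.
move=> s0 hB.
suff [x xs hx] : exists2 x, x \in s & forall y, y \in s -> nm x <= nm y.
  by exists x => //; apply: le_trans hB; apply: prod_nm_ge => //; exact: nm_ge0.
elim: s s0 {hB} => // a [|b s] IH _.
  by exists a; rewrite ?mem_head // => y; rewrite inE => /eqP->.
have [//|x xs hx] := IH _; have [h|/ltW h] := leP (nm a) (nm x).
  exists a; first exact: mem_head.
  by move=> y; rewrite inE => /predU1P[->//|/hx]; exact: le_trans.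
exists x; first by rewrite inE xs orbT.
by move=> y; rewrite inE => /predU1P[->|/hx].
Qed.

(** If a product is large and all its factors are bounded above, then no factor
    is small. *)
Lemma factor_ge (s : seq C) (b B : R) x : (forall y, y \in s -> nm y <= b) ->
  x \in s -> B <= \prod_(y <- s) nm y -> B <= nm x * b ^+ (size s).-1.
Proof.
move=> h xs hB; apply: le_trans hB _.
rewrite (perm_big _ (perm_to_rem xs)) big_cons /= ler_wpM2l ?nm_ge0 //.
by rewrite -(size_rem xs); apply: prod_nm_le => y /mem_rem; exact: h.
Qed.

End Log.

(** * Asymptotic directions and the four rays *)

(** Triples of A go to infinity in this direction; A will be the set of
    logarithms of the points of a curve, and t the logarithm of the base of
    Log_t. *)
Definition asymptotic_direction (R : realType) (A : R -> R -> R -> Prop)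
    (p0 p1 p2 : R) : Prop :=
  forall e T : R, 0 < e -> exists t a b g : R,
    [/\ T < t, A a b g, `|a - t * p0| <= e * t, `|b - t * p1| <= e * t &
        `|g - t * p2| <= e * t].

(** Far points of A, divided by their size, lie in a compact cube. A family of
    counterexamples with sizes tending to infinity would therefore have a
    cluster point, which is an asymptotic direction and so belongs to K. *)
Lemma near_asymptotic_cone (R : realType) (A K : R -> R -> R -> Prop) :
  (forall p0 p1 p2, asymptotic_direction A p0 p1 p2 -> K p0 p1 p2) ->
  (forall t p0 p1 p2, 0 < t -> K p0 p1 p2 -> K (t * p0) (t * p1) (t * p2)) ->
  forall e : R, 0 < e -> exists rho : R, forall a b g, A a b g ->
    rho <= `|a| + `|b| + `|g| -> exists p0 p1 p2, [/\ K p0 p1 p2,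
      `|a - p0| <= e * (`|a| + `|b| + `|g|),
      `|b - p1| <= e * (`|a| + `|b| + `|g|) &
      `|g - p2| <= e * (`|a| + `|b| + `|g|)].
Proof.
move=> AK Kscale e e0; apply: contrapT => /forallNP bad.
(* B rho is the set of normalized counterexamples of size at least rho. *)
pose good a b g (l : R) := exists p0 p1 p2, [/\ K p0 p1 p2,
      `|a - p0| <= e * l, `|b - p1| <= e * l & `|g - p2| <= e * l].
pose B (rho : R) : set (R * R * R) := [set q | exists a b g l,
  [/\ A a b g, l = `|a| + `|b| + `|g|, rho <= l & [/\ 0 < l, ~ good a b g l & 
   q = (a / l, b / l, g / l)]]].
have FB : Filter (filter_from setT B).
  apply: filter_fromT_filter; first by exists 0.
  move=> i j; exists (Num.max i j) => q [a [b [g [l [h1 h2 h3 h4]]]]].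
  by move: h3; rewrite ge_max => /andP[hi hj]; split; exists a, b, g, l.
have PB : ProperFilter (filter_from setT B).
  apply: filter_from_proper => // rho _.
  have /existsNP[a /existsNP[b /existsNP[g /not_implyP[hA /not_implyP[hr nb]]]]] :=
    bad (Num.max rho 1).
  exists (a / (`|a| + `|b| + `|g|), b / (`|a| + `|b| + `|g|), g / (`|a| + `|b| + `|g|)).
  exists a, b, g, (`|a| + `|b| + `|g|); move: hr; rewrite ge_max => /andP[hr h1].
  by split=> //; split=> //; apply: lt_le_trans h1.
have cI := @segment_compact R (-1) 1.
have [] := compact_setX (compact_setX cI cI) cI PB.
  exists 1 => // q [a [b [g [l [_ El _ [l0 _ ->]]]]]].
  have main : forall x, `|x| <= l -> -1 <= x / l <= 1.
    by move=> x xl; rewrite -ler_norml normrM normfV (gtr0_norm l0) ler_pdivrMr // mul1r.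
  have [p1 p2 p3] : [/\ 0 <= `|a|, 0 <= `|b| & 0 <= `|g|] by [].
  by split=> /=; [split=> /=|]; rewrite /= in_itv /=; apply: main; lra.
move=> [[p0 p1] p2] [_ cl].
have key d rho : 0 < d -> exists a b g l, [/\ A a b g, rho <= l, 0 < l, ~ good a b g l &
    [/\ `|a - l * p0| <= d * l, `|b - l * p1| <= d * l & `|g - l * p2| <= d * l]].
  move=> d0.
  have [|_ [[a [b [g [l [hA El hr [l0 ng ->]]]]]] [[b0 b1] b2]]] :=
    cl (B rho) (ball (p0, p1, p2) d) _ (nbhsx_ballx _ _ d0).
    by exists rho.
  exists a, b, g, l; split=> //.
  have main x p : ball p d (x / l) -> `|x - l * p| <= d * l.
    rewrite /ball /= => /ltW h.
    have -> : x - l * p = - (p - x / l) * l by field; rewrite gt_eqF.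
    by rewrite normrM normrN (gtr0_norm l0) ler_wpM2r // ltW.
  by split; apply: main.
have Kp : K p0 p1 p2.
  apply: AK => d T d0; have [a [b [g [l [h1 h2 h3 _ [k1 k2 k3]]]]]] := key d (T + 1) d0.
  by exists l, a, b, g; split=> //; lra.
have [a [b [g [l [h1 h2 h3 ng [k1 k2 k3]]]]]] := key e 0 e0.
by apply: ng; exists (l * p0), (l * p1), (l * p2); split=> //; apply: Kscale.
Qed.

(** The rays of C in the coordinates (log|S|, log|Y|, log|W|). *)
Definition on_rays (R : realType) (n : nat) (p0 p1 p2 : R) : Prop :=
  exists r : R, 0 <= r /\
   [\/ [/\ p0 = 0, p1 = - r & p2 = - (n%:R * r)],
       [/\ p0 = r, p1 = r & p2 = n.+1%:R * r],
       [/\ p0 = - r, p1 = 0 & p2 = 0] |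
       [/\ p0 = 0, p1 = 0 & p2 = - r]].

Lemma on_rays_scale (R : realType) n (t p0 p1 p2 : R) : 0 < t ->
  on_rays n p0 p1 p2 -> on_rays n (t * p0) (t * p1) (t * p2).
Proof.
move=> t0 [r [r0 H]]; exists (t * r); split; first by rewrite mulr_ge0 // ltW.
case: H => [[-> -> ->]|[-> -> ->]|[-> -> ->]|[-> -> ->]].
- by apply: Or41; split; ring.
- by apply: Or42; split; ring.
- by apply: Or43; split; ring.
- by apply: Or44; split; ring.
Qed.

Section Estimates.
Variables (R : realType) (n : nat) (A : R -> R -> R -> Prop).
Hypothesis hn : (0 < n)%N.
Hypothesis hA : forall p0 p1 p2, asymptotic_direction A p0 p1 p2 ->
  on_rays n p0 p1 p2.

Lemma near_rays (e : R) : 0 < e -> exists rho : R, forall a b g, A a b g ->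
  rho <= `|a| + `|b| + `|g| -> exists p0 p1 p2 h, [/\ on_rays n p0 p1 p2,
      h <= e * (`|a| + `|b| + `|g|), `|a - p0| <= h, `|b - p1| <= h & `|g - p2| <= h].
Proof.
move=> e0; have [rho H] := near_asymptotic_cone hA (@on_rays_scale R n) e0.
exists rho => a b g h1 h2; have [p0 [p1 [p2 [k0 k1 k2 k3]]]] := H _ _ _ h1 h2.
by exists p0, p1, p2, (e * (`|a| + `|b| + `|g|)); split.
Qed.

(** Points with |Y| large, |W| about |Y| and |S| bounded above stay away from the
    rays: only (1, 1, n+1) has a positive second coordinate, and its first
    coordinate is then positive as well. The lower bound on a makes the size of
    the triple comparable to b, so that being near a ray is meaningful. *)
Lemma no_large_Y (k k' : R) : 0 <= k -> 0 <= k' -> exists rho : R, forall a b g,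
  A a b g -> rho <= b -> `|g - b| <= 1 -> a <= k' -> - (k * b) <= a -> False.
Proof.
move=> k0 k'0; have e0 : 0 < (4 * (k + k' + 4))^-1 by rewrite invr_gt0; lra.
have [rho H] := near_rays e0.
exists (Num.max (Num.max rho (2 * k' + 1)) 1) => a b g hAb.
rewrite !ge_max => /andP[/andP[h1 h2] h3] hg ha ha'.
have b0 : 0 < b by lra.
have hl : `|a| + `|b| + `|g| <= (k + k' + 4) * b.
  have : `|a| <= (k + k') * b.
    by rewrite ler_norml; apply/andP; split; nra.
  have : `|g| <= 2 * b.
    by move: hg; rewrite !ler_norml => /andP[? ?]; apply/andP; split; lra.
  rewrite (gtr0_norm b0); lra.
have [|p0 [p1 [p2 [h [[r [r0 kk]] he k1 k2 k3]]]]] := H _ _ _ hAb.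
  by rewrite (gtr0_norm b0); have := normr_ge0 a; have := normr_ge0 g; lra.
have hb : h <= b / 4.
  apply: le_trans he _; rewrite mulrC ler_pdivrMr; last lra.
  by lra.
move: k1 k2 k3; rewrite !ler_norml => /andP[k1 k1'] /andP[k2 k2'] /andP[k3 k3'].
by case: kk => -[E0 E1 E2]; subst p0 p1 p2; lra.
Qed.

(** No ray has its first two coordinates negative, whereas here m b is
    at most a up to a constant, with a tending to - oo. The lower bound on g
    prevents the size of the triple from being dominated by g, that is, the
    point from being near the ray (0, 0, -1), and likewise for (0, -1, -n). *)
Lemma no_small_Y (k m c : R) : 0 <= k -> 0 <= m -> 0 <= c -> exists rho : R,
  forall a b g, A a b g -> a <= - rho -> b <= 0 -> g <= 0 -> m * b <= a + c ->
    k * a - c <= g -> False.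
Proof.
move=> k0 m0 c0; pose M := 2 * (k + m + 4) : R.
have e0 : 0 < (2 * M)^-1 by rewrite invr_gt0 /M; lra.
have [rho H] := near_rays e0.
exists (Num.max rho (8 * c + 1)) => a b g hAb.
rewrite lerNr ge_max => /andP[h1 h2] b0 g0 hb hg.
have a0 : a <= 0 by lra.
have [|p0 [p1 [p2 [h [[r [r0 kk]] he k1 k2 k3]]]]] := H _ _ _ hAb.
  by rewrite (ler0_norm a0); have := normr_ge0 b; have := normr_ge0 g; lra.
rewrite (ler0_norm a0) (ler0_norm b0) (ler0_norm g0) in he.
set l := (- a - b - g) in he; have hM : 2 * M * h <= l.
  by move: he; rewrite mulrC ler_pdivlMr /M /l; lra.
have hl : 8 * c + 1 <= l by rewrite /l; lra.
have h0 : 0 <= h by apply: le_trans k1.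
have hkm : 0 <= k * h /\ 0 <= m * h by split; apply: mulr_ge0.
rewrite /M in hM.
have n1 : 1 <= n%:R :> R by rewrite ler1n.
move: k1 k2 k3; rewrite !ler_norml => /andP[k1 k1'] /andP[k2 k2'] /andP[k3 k3'].
have nS : n.+1%:R = n%:R + 1 :> R by rewrite -natr1.
rewrite /l in hM hl.
case: kk => -[E0 E1 E2]; subst p0 p1 p2.
- have : r <= n%:R * r by apply: ler_peMl.
  have : k * - h <= k * a by apply: ler_wpM2l => //; lra.
  nra.
- have : 0 <= n.+1%:R * r by apply: mulr_ge0.
  nra.
- have : m * - h <= m * b by apply: ler_wpM2l => //; lra.
  nra.
- have : k * - h <= k * a by apply: ler_wpM2l => //; lra.
  nra.
Qed.

End Estimates.

(** * Equations of a plane curve over its first coordinate *)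

Section Algebra.
Variable F : closedFieldType.
Implicit Types (G H : {poly {poly F}}) (S Y : F).

(** The outer variable is Y, the inner one is S. *)
Definition ev G S Y : F := G.[Y%:P].[S].

Definition fiber S G : {poly F} := map_poly (horner_eval S) G.

Lemma ev_fiber G S (p : {poly F}) : G.[p].[S] = (fiber S G).[p.[S]].
Proof. exact: esym (horner_map (horner_eval S) G p). Qed.

Lemma evE G S Y : ev G S Y = (fiber S G).[Y].
Proof. by rewrite /ev ev_fiber hornerC. Qed.

Lemma evM G H S Y : ev (G * H) S Y = ev G S Y * ev H S Y.
Proof. by rewrite /ev !hornerM. Qed.

Lemma evD G H S Y : ev (G + H) S Y = ev G S Y + ev H S Y.
Proof. by rewrite /ev !hornerD. Qed.

Lemma evC (c : {poly F}) S Y : ev c%:P S Y = c.[S].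
Proof. by rewrite /ev hornerC. Qed.

Lemma evZ (c : {poly F}) G S Y : ev (c *: G) S Y = c.[S] * ev G S Y.
Proof. by rewrite /ev hornerZ hornerM. Qed.

Lemma coef_fiber S G i : (fiber S G)`_i = (G`_i).[S].
Proof. by rewrite coef_map. Qed.

Lemma size_fiber S G : (lead_coef G).[S] != 0 -> size (fiber S G) = size G.
Proof. by move=> h; apply: size_map_poly_id0. Qed.

Lemma lead_coef_fiber S G : (lead_coef G).[S] != 0 ->
  lead_coef (fiber S G) = (lead_coef G).[S].
Proof. by move=> h; rewrite lead_coefE size_fiber // coef_fiber. Qed.

Lemma fiber_roots S G : (lead_coef G).[S] != 0 -> exists s : seq F,
  [/\ size s = (size G).-1, forall y, y \in s -> ev G S y = 0,
      fiber S G = (lead_coef G).[S] *: \prod_(x <- s) ('X - x%:P) &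
      forall y, ev G S y = (lead_coef G).[S] * \prod_(x <- s) (y - x)].
Proof.
move=> h; have [s Es] := closed_field_poly_normal (fiber S G).
rewrite lead_coef_fiber // in Es.
have Ey y : ev G S y = (lead_coef G).[S] * \prod_(x <- s) (y - x).
  rewrite evE Es hornerZ horner_prod; congr (_ * _).
  by apply: eq_bigr => x _; rewrite hornerXsubC.
exists s; split=> //.
- by rewrite -(size_fiber h) Es size_scale // size_prod_XsubC.
- move=> y ys; apply/eqP; rewrite Ey mulf_eq0 prodf_seq_eq0; apply/orP; right.
  by apply/hasP; exists y => //=; rewrite subrr.
Qed.

(** The coefficients of G then vanish at S, so that S can be divided out of G. *)
Lemma fiber_zero S G : fiber S G = 0 -> exists H, G = ('X - S%:P)%:P * H.
Proof.
move=> h; exists (map_poly (fun p => p %/ ('X - S%:P)) G).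
apply/polyP => i; rewrite coefCM coef_map_id0 ?div0p // mulrC divpK //.
by rewrite dvdp_XsubCl /root -coef_fiber h coef0.
Qed.

Lemma poly_nonzero_at (p : {poly F}) : p != 0 -> exists y, p.[y] != 0.
Proof. by move=> /closed_nonrootP[y hy]; exists y. Qed.

Section Saturation.
Variable X : F -> F -> Prop.

Definition vanishes G := forall S Y, X S Y -> ev G S Y = 0.

(** The equations of X over the field of rational functions of S, without
    denominators. *)
Definition generically_vanishes G :=
  exists2 c : {poly F}, c != 0 & vanishes (c%:P * G).

Lemma vanishes_generically G : vanishes G -> generically_vanishes G.
Proof. by exists 1; rewrite ?oner_eq0 // mul1r. Qed.

Lemma gvB G H : generically_vanishes G -> generically_vanishes H ->
  generically_vanishes (G - H).
Proof.
move=> [c c0 hc] [e e0 he]; exists (c * e); first by rewrite mulf_neq0.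
move=> S Y XSY; have := hc S Y XSY; have := he S Y XSY.
rewrite !evM !evC evD hornerM => h1 h2; rewrite mulrDr mulrAC h2 mul0r add0r.
rewrite -mulN1r evM mulrCA -mulrA h1; ring.
Qed.

Lemma gvMl Q G : generically_vanishes G -> generically_vanishes (Q * G).
Proof.
move=> [c c0 hc]; exists c => // S Y XSY.
by rewrite mulrCA evM hc // mulr0.
Qed.

Lemma gv_cancel (K G : {poly {poly F}}) : (forall S Y, X S Y -> ev K S Y != 0) ->
  generically_vanishes (K * G) -> generically_vanishes G.
Proof.
move=> hK [c c0 hc]; exists c => // S Y XSY; have /eqP := hc S Y XSY.
by rewrite mulrCA evM mulf_eq0 (negPf (hK _ _ XSY)) => /eqP.
Qed.

Lemma gv_cancelC (k : {poly F}) G : k != 0 ->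
  generically_vanishes (k%:P * G) -> generically_vanishes G.
Proof.
move=> k0 [c c0 hc]; exists (c * k); first by rewrite mulf_neq0.
by rewrite polyCM -mulrA.
Qed.

(** Minimal degree in Y makes G divide every equation up to a polynomial in S;
    minimal degree of the leading coefficient makes G primitive, so that no
    fibre of G is identically zero. *)
Definition generic_equation G := [/\ G != 0, generically_vanishes G &
  forall H, H != 0 -> generically_vanishes H -> (size G <= size H)%N /\
    (size H = size G -> (size (lead_coef G) <= size (lead_coef H))%N)].

Lemma generic_equation_exists H : H != 0 -> generically_vanishes H ->
  exists G, generic_equation G.
Proof.
move=> H0 gH.
pose P k := `[< exists G, [/\ G != 0, generically_vanishes G & size G = k] >].
have exP : exists k, P k by exists (size H); apply/asboolP; exists H.
case: (ex_minnP exP) => m /asboolP[G1 [G10 gG1 sG1]] hm.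
pose Q k := `[< exists G, [/\ G != 0, generically_vanishes G, size G = m &
   size (lead_coef G) = k] >].
have exQ : exists k, Q k by exists (size (lead_coef G1)); apply/asboolP; exists G1.
case: (ex_minnP exQ) => k /asboolP[G [G0 gG sG lG]] hk.
exists G; split=> // K K0 gK; split; first by rewrite sG; apply: hm; apply/asboolP; exists K.
by rewrite lG sG => sK; apply: hk; apply/asboolP; exists K.
Qed.

Section Equation.
Variable G : {poly {poly F}}.
Hypothesis hG : generic_equation G.

Lemma geq_neq0 : G != 0. Proof. by case: hG. Qed.

Lemma geq_lead_neq0 : lead_coef G != 0.
Proof. by rewrite lead_coef_eq0 geq_neq0. Qed.

(** The remainder of the pseudo-division by G is an equation of smaller degree,
    hence zero. *)
Lemma geq_divides H : generically_vanishes H -> exists k Q,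
  lead_coef G ^+ k *: H = Q * G.
Proof.
move=> gH; exists (scalp H G), (H %/ G).
have E := Pdiv.Idomain.divp_eq H G.
have [/eqP r0|r0] := boolP (H %% G == 0).
  by rewrite r0 addr0 in E.
have g0 := geq_neq0.
have : generically_vanishes (H %% G).
  have -> : H %% G = (lead_coef G ^+ scalp H G)%:P * H
       - H %/ G * G.
    by rewrite mul_polyC E addrC addKr.
  by apply: gvB; apply: gvMl => //; case: hG.
case: hG => _ _ hmin /(hmin _ r0)[]; rewrite leqNgt.
by rewrite ltn_modp g0.
Qed.

(** Otherwise a factor of degree 1 in the inner variable could be cancelled from
    G, which lowers the degree of the leading coefficient. *)
Lemma geq_fiber_neq0 S : fiber S G != 0.
Proof.
apply/eqP => /fiber_zero[H E]; have g0 := geq_neq0.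
have X0 : ('X - S%:P : {poly F}) != 0 by rewrite polyXsubC_eq0.
have H0 : H != 0 by apply: contraNneq g0 => H0; rewrite E H0 mulr0.
have gH : generically_vanishes H by apply: (gv_cancelC X0); rewrite -E; case: hG.
have sH : size H = size G by rewrite E size_Cmul.
case: hG => _ _ /(_ H H0 gH)[_ /(_ sH)].
rewrite E lead_coefM lead_coefC size_mul ?lead_coef_eq0 // size_XsubC.
by rewrite add2n /= ltnn.
Qed.

(** A factor Y - p(S) which has no zero on X could be cancelled, giving an
    equation of smaller degree. *)
Lemma geq_not_root (p : {poly F}) : (forall S Y, X S Y -> Y != p.[S]) -> G.[p] != 0.
Proof.
move=> hp; apply/eqP => G0; have /factor_theorem[H E] : root G p by rewrite /root G0.
have g0 := geq_neq0.
have H0 : H != 0 by apply: contraNneq g0 => H0; rewrite E H0 mul0r.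
have gH : generically_vanishes H.
  apply: (@gv_cancel ('X - p%:P)); last by rewrite mulrC -E; case: hG.
  move=> S Y XSY; rewrite /ev hornerXsubC hornerD hornerN hornerC subr_eq0.
  exact: hp.
case: hG => _ _ /(_ H H0 gH)[+ _].
by rewrite E size_mul ?polyXsubC_eq0 // size_XsubC addn2 /= ltnn.
Qed.

End Equation.
End Saturation.
End Algebra.

(** * The leading coefficient of the minimal equation *)

Lemma sub_real (R : realType) (S1 : R[i]) (d : R) : 0 <= d ->
  nm (S1 + real_complex R d - S1) = d.
Proof. by move=> d0; rewrite addrAC subrr add0r nm_real ger0_norm. Qed.

(** The displacement from S1 used in [lead_coef_no_root], small with respect to
    all the constants there. *)
Lemma small_parameter (R : realType) (d1 d2 d3 be L K : R) : 0 < d1 -> 0 < d2 ->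
  0 < d3 -> 0 < be -> 0 < L -> 0 < K -> exists d : R, 0 < d /\
    [/\ d < d1, d < d2, d <= d3 & [/\ d <= 1, d * L <= be & d * K <= be ^+ 2]].
Proof.
move=> d10 d20 d30 be0 L0 K0.
pose w := Num.min (Num.min (Num.min d1 d2) (Num.min d3 1)) (Num.min (be / L) (be ^+ 2 / K)).
have q1 : 0 < be / L by exact: divr_gt0.
have q2 : 0 < be ^+ 2 / K by rewrite divr_gt0 ?exprn_gt0.
have w0 : 0 < w by rewrite !lt_min d10 d20 d30 ltr01 q1 q2.
have : w <= w by [].
rewrite {2}/w !le_min => /andP[/andP[/andP[w1 w2] /andP[w3 w4]] /andP[w5 w6]].
rewrite ler_pdivlMr // in w5; rewrite ler_pdivlMr // in w6.
have [k1 k2] : 0 < w * L /\ 0 < w * K by split; apply: mulr_gt0.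
clearbody w; clear q1 q2.
by exists (w / 2); split; [lra|split; [lra|lra|lra|split; lra]].
Qed.

Lemma half_bounds (R : realType) (rho y0 Q y : R) : 0 <= y0 ->
  2 * (`|rho| + y0 + 1) <= Q -> Q <= y0 + y -> Q / 2 <= y /\ rho <= y.
Proof. by move=> h1 h2 h3; have := ler_norm rho; have := normr_ge0 rho; split; lra. Qed.

Lemma half_distance (R : realType) (a b d : R) : a - b <= d -> d <= a / 2 -> d <= b.
Proof. by move=> ? ?; lra. Qed.

Lemma square_growth (R : realType) (d be y : R) (m : nat) : 0 < d -> 0 <= be -> 0 <= y ->
  be / d <= y ^+ m * 2 ^+ m -> d * 4 ^+ m <= be ^+ 2 -> 1 <= d * y ^+ (2 * m).
Proof.
move=> d0 be0 y0 h1 h2.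
have hb2 : (be / d) ^+ 2 <= (y ^+ m * 2 ^+ m) ^+ 2.
  have q0 : 0 <= be / d by rewrite divr_ge0 // ltW.
  by apply: lerXn2r => //; rewrite nnegrE //; apply: le_trans h1.
have p4 : (2 ^+ m) ^+ 2 = 4 ^+ m :> R by rewrite -exprM mulnC exprM; congr (_ ^+ _); ring.
rewrite [leRHS]exprMn p4 expr_div_n ler_pdivrMr ?exprn_gt0 // in hb2.
rewrite mulnC exprM; set E := (y ^+ m) ^+ 2 in hb2 *.
have p40 : 0 < 4 ^+ m :> R by rewrite exprn_gt0.
rewrite -(@ler_pM2l _ (d * 4 ^+ m)) ?mulr_gt0 // mulr1.
apply: le_trans h2 _; apply: le_trans hb2 _.
by rewrite le_eqVlt; apply/orP; left; apply/eqP; ring.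
Qed.

Definition offset (R : realType) (n : nat) : {poly R[i]} := 'X^n + 'X^(n.+1).

(** The plane in standard coordinates is the graph of this function. *)
Definition third (R : realType) (n : nat) (S Y : R[i]) : R[i] := - (Y + (offset R n).[S]).

Definition log_image (R : realType) (n : nat) (X : R[i] -> R[i] -> Prop) (a b g : R) : Prop :=
  exists S Y, [/\ X S Y, a = lg S, b = lg Y & g = lg (third n S Y)].

Lemma nm_offset (R : realType) (n : nat) (S : R[i]) (s : R) : nm S <= s ->
  nm (offset R n).[S] <= s ^+ n + s ^+ n.+1.
Proof.
move=> hs; rewrite /offset hornerD !hornerXn.
apply: le_trans (nm_le_add _ _) _; rewrite !nmX.
have s0 := le_trans (nm_ge0 S) hs.
by apply: lerD; apply: lerXn2r => //; rewrite nnegrE // nm_ge0.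
Qed.

(** What the necessity of d <= 3 uses of the projection to the plane of (S, Y) of
    a curve with tropical limit C. The last field is a consequence of the ray
    (-1, 0, 0). *)
Record adapted_curve (R : realType) (n : nat) (X : R[i] -> R[i] -> Prop) : Prop := {
  adapted_torus : forall S Y, X S Y -> [/\ S != 0, Y != 0 & third n S Y != 0];
  adapted_closed : forall S Y : R[i], S != 0 -> Y != 0 -> third n S Y != 0 ->
    (forall F : {poly {poly R[i]}}, vanishes X F -> ev F S Y = 0) -> X S Y;
  adapted_rays : forall p0 p1 p2,
    asymptotic_direction (log_image n X) p0 p1 p2 -> on_rays n p0 p1 p2;
  adapted_zero : forall e : R, 0 < e -> exists S Y, X S Y /\ nm S < e }.

Section Core.
Variables (R : realType) (n : nat) (X : R[i] -> R[i] -> Prop).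
Local Notation C := R[i].
Hypothesis X_adapted : adapted_curve n X.
Let X_torus := adapted_torus X_adapted.
Let X_closed := adapted_closed X_adapted.
Let X_asym := adapted_rays X_adapted.
Let X_zero := adapted_zero X_adapted.

(** When |Y| is large and S bounded, W is close to - Y, so that log|W| is within
    1 of log|Y|. *)
Lemma X_no_large_Y (k : nat) (s : R) : exists rho : R, forall S Y, X S Y ->
  nm S <= s -> rho <= nm Y -> 1 <= nm S * nm Y ^+ k -> False.
Proof.
have [rho H] := no_large_Y X_asym (ler0n R k) (normr_ge0 (ln s)).
set t := s ^+ n + s ^+ n.+1.
exists (Num.max (expR rho) (2 * t + 1)) => S Y XSY hs.
rewrite ge_max => /andP[hY1 hY2] hSY.
have [S0 Y0 W0] := X_torus XSY.
have nS : 0 < nm S by rewrite nm_gt0.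
have nY : 0 < nm Y by rewrite nm_gt0.
have ht := nm_offset n hs; rewrite -/t in ht.
apply: (H (lg S) (lg Y) (lg (third n S Y))).
- by exists S, Y.
- by have := ln_mono (expR_gt0 rho) hY1; rewrite expRK.
- have -> : 1 = 2 - 1 :> R by ring.
  apply: lg_close; rewrite ?ler1n // /third nmN.
  + by apply: le_trans (nm_le_add _ _) _; have := nm_ge0 (offset R n).[S]; lra.
  + by have := nm_sub_le Y (offset R n).[S]; lra.
- by apply: le_trans (ler_norm _); apply: ln_mono.
- have := ln_mono ltr01 hSY; rewrite ln1 lnM ?posrE ?exprn_gt0 // lnXn // -mulr_natl.
  by lra.
Qed.

(** A curve without equation would contain all the points (1, Y), and |Y| could
    be arbitrarily large there. *)
Lemma X_equation : exists G, generic_equation X G.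
Proof.
have [F F0 vF] : exists2 F, F != 0 & vanishes X F.
  apply: contrapT => hF; have [rho H] := X_no_large_Y 0 1.
  pose y := Num.max (Num.max rho 1) (nm (offset R n).[1] + 1).
  have [y1 y2 y3] : [/\ rho <= y, 1 <= y & nm (offset R n).[1] + 1 <= y].
    by split; rewrite /y !le_max lexx ?orbT.
  have ny : nm (real_complex R y) = y by rewrite nm_real ger0_norm //; lra.
  apply: (H 1 (real_complex R y)); rewrite ?nm1 ?ny ?expr0 ?mulr1 ?lexx //.
  apply: X_closed; first exact: oner_neq0.
  - by rewrite -nm_gt0 ny; lra.
  - rewrite /third oppr_eq0 -nm_gt0.
    by have := nm_sub_le (real_complex R y) (offset R n).[1]; rewrite ny; lra.
  - move=> F vF; have [->|F0] := eqVneq F 0; first by rewrite /ev !horner0.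
    by case: hF; exists F.
by apply: (generic_equation_exists F0); exact: vanishes_generically.
Qed.

Section Equation.
Variable G : {poly {poly C}}.
Hypothesis hG : generic_equation X G.

(** Outside this locus every root Y of G(S, Y) gives a point of the torus, and
    the number of roots is the degree of G. *)
Definition bad_locus : {poly C} := 'X * lead_coef G * G.[0] * G.[- offset R n].

Lemma bad_locus_neq0 : bad_locus != 0.
Proof.
rewrite /bad_locus !mulf_neq0 ?polyX_eq0 ?(geq_lead_neq0 hG) //.
- by apply: (geq_not_root hG) => S Y /X_torus[_ Y0 _]; rewrite horner0.
- apply: (geq_not_root hG) => S Y /X_torus[_ _].
  by rewrite /third oppr_eq0 addr_eq0 hornerN.
Qed.

Lemma outside_bad_locus S : bad_locus.[S] != 0 -> [/\ S != 0, (lead_coef G).[S] != 0,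
  G.[0].[S] != 0 & G.[- offset R n].[S] != 0].
Proof.
by rewrite /bad_locus !hornerM hornerX !mulf_eq0 !negb_or => /andP[/andP[/andP[-> ->] ->] ->].
Qed.

(** Pseudo-division by G shows that all the equations of X hold at (S, Y). *)
Lemma equation_subset S Y : bad_locus.[S] != 0 -> ev G S Y = 0 -> X S Y.
Proof.
move=> /outside_bad_locus[S0 l0 g0 t0] EG; apply: X_closed => //.
- apply: contra_neq g0 => Y0; rewrite -EG Y0 /ev polyC0 //.
- apply: contra_neq t0 => W0; rewrite -EG evE ev_fiber; congr _.[_].
  by move/eqP: W0; rewrite /third oppr_eq0 addr_eq0 hornerN eq_sym => /eqP.
- move=> F /vanishes_generically/(geq_divides hG)[k [Q E]].
  apply/eqP; have := congr1 (fun P => ev P S Y) E.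
  rewrite /= evZ evM EG mulr0 horner_exp => /eqP.
  by rewrite mulf_eq0 expf_eq0 (negPf l0) andbF.
Qed.

(** An equation in S alone has finitely many roots, but X has points with S
    arbitrarily close to 0. *)
Lemma equation_degree_gt0 : (0 < (size G).-1)%N.
Proof.
rewrite -subn1 subn_gt0 ltnNge; apply/negP => /size1_polyC E.
have [G0 [c c0 hc] _] := hG.
have cg0 : c * G`_0 != 0 by rewrite mulf_neq0 // -polyC_eq0 -E.
have [dl dl0 h] := poly_isolated 0 cg0.
have [S [Y [XSY hS]]] := X_zero dl0; have [S0 _ _] := X_torus XSY.
have := hc _ _ XSY; rewrite E -polyCM evC => /eqP; apply/negP; apply: h => //.
by rewrite subr0.
Qed.

(** Let the leading coefficient vanish at S1, and take y0 with G(S1, y0) nonzero.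
    The product of the distances from y0 to the roots of the fibre over S is the
    ratio of |G(S, y0)|, bounded below, by the leading coefficient, which is
    O(|S - S1|). So one of the m roots is at least of size
    |S - S1|^(-1/m) up to a constant, and this contradicts [X_no_large_Y]. *)
Lemma lead_coef_no_root S1 : (lead_coef G).[S1] != 0.
Proof.
apply/eqP => l0; set m := (size G).-1.
have m0 : (0 < m)%N := equation_degree_gt0.
have /poly_nonzero_at[y0 hy0] := geq_fiber_neq0 hG S1.
have [h Eh] : exists h, lead_coef G = h * ('X - S1%:P).
  by have /factor_theorem[h Eh] : root (lead_coef G) S1 by [rewrite /root l0]; exists h.
have [M M0 hM] := poly_bounded h S1.
have q0 : G.[y0%:P].[S1] != 0 by rewrite -/(ev _ _ _) evE.
have [c [d1 [c0 d10 hc]]] := poly_near_ge q0.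
have [d2 d20 hbad] := poly_isolated S1 bad_locus_neq0.
(* The exponent 2 m leaves room for the constants: |y|^m >= const / d implies
   1 <= d |y|^(2 m) once d is small. *)
have [rho H] := X_no_large_Y (2 * m) (nm S1 + 1).
pose be := c / M; have be0 : 0 < be by rewrite divr_gt0.
pose L := (2 * (`|rho| + nm y0 + 1)) ^+ m.
have L0 : 0 < L by rewrite exprn_gt0 //; have := normr_ge0 rho; have := nm_ge0 y0; lra.
(* This bound ensures |S| >= d, also when S1 = 0. *)
pose d3 := if S1 == 0 then 1 else nm S1 / 2.
have d30 : 0 < d3 by rewrite /d3; case: eqVneq => // s0; rewrite divr_gt0 // nm_gt0.
have p4 : 0 < 4 ^+ m :> R by rewrite exprn_gt0.
have [d [dpos [e1 e2 e3 [e4 e5 e6]]]] := small_parameter d10 d20 d30 be0 L0 p4.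
pose S := S1 + real_complex R d.
have nSS : nm (S - S1) = d by rewrite sub_real // ltW.
have SS1 : S != S1 by rewrite -subr_eq0 -nm_gt0 nSS.
have bS : bad_locus.[S] != 0 by apply: hbad; rewrite ?nSS.
have [S0 lS _ _] := outside_bad_locus bS.
have [s [sz sr _ Es]] := fiber_roots lS.
have hcS : c <= nm (ev G S y0) by apply: hc; rewrite nSS.
rewrite Es nmM nm_prod Eh hornerM hornerXsubC nmM nSS in hcS.
have hMS : nm h.[S] <= M by apply: hM; rewrite nSS.
set s' := [seq y0 - x | x <- s].
have hB : be / d <= \prod_(x <- s') nm x.
  rewrite /s' big_map /be -mulrA -invfM ler_pdivrMr ?mulr_gt0 //.
  apply: le_trans hcS _; rewrite mulrC ler_wpM2l //.
    by apply: prodr_ge0 => x _; exact: nm_ge0.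
  by rewrite ler_wpM2r // ltW.
have [|z] := large_factor _ hB; first by rewrite size_map sz.
rewrite size_map sz -/m => /mapP[y ys ->{z}] hz.
have XSy := equation_subset bS (sr _ ys).
have nm1S : d <= nm S.
  have h1 := nm_sub_le S1 (- S); rewrite nmN nm_distC nSS in h1.
  move: e3; rewrite /d3; case: eqVneq => [E0 _|_ e3].
    by move: nSS; rewrite E0 subr0 => ->.
  exact: half_distance h1 e3.
set Q := nm (y0 - y) in hz.
have Q0 : 0 <= Q by exact: nm_ge0.
have hQ : 2 * (`|rho| + nm y0 + 1) <= Q.
  rewrite -(@ler_pXn2r _ m) ?nnegrE //; last by rewrite mulr_ge0 // !addr_ge0 // nm_ge0.
  by apply: le_trans hz; rewrite ler_pdivlMr // mulrC.
have hy : Q <= nm y0 + nm y by rewrite /Q; apply: le_trans (nm_le_add _ _) _; rewrite nmN.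
have [hyQ hrho] := half_bounds (nm_ge0 y0) hQ hy.
apply: (H S y) => //.
  by apply: le_trans (nm_le_add _ _) _; rewrite nm_real (gtr0_norm dpos) lerD2l.
have : (Q / 2) ^+ m <= nm y ^+ m by apply: lerXn2r; rewrite ?nnegrE // ?nm_ge0 // divr_ge0.
rewrite expr_div_n ler_pdivrMr ?exprn_gt0 // => hym.
apply: le_trans (_ : d * nm y ^+ (2 * m) <= _).
  by apply: square_growth dpos (ltW be0) (nm_ge0 _) _ e6; apply: le_trans hym.
by rewrite ler_wpM2r // exprn_ge0 // nm_ge0.
Qed.

End Equation.
End Core.

(** * The constant coefficient of the minimal equation *)

Lemma small_parameter3 (R : realType) (d1 d2 d3 : R) : 0 < d1 -> 0 < d2 ->
  0 < d3 -> exists d : R, [/\ 0 < d, d < d1, d < d2 & d < d3].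
Proof.
move=> h1 h2 h3; pose w := Num.min (Num.min d1 d2) d3.
have w0 : 0 < w by rewrite !lt_min h1 h2 h3.
have : w <= w by []; rewrite {2}/w !le_min => /andP[/andP[w1 w2] w3].
by exists (w / 2); split; lra.
Qed.

Lemma nm_offset_small (R : realType) (n : nat) (S : R[i]) : (0 < n)%N ->
  nm S <= 1 / 4 -> nm (offset R n).[S] <= 1 / 2.
Proof.
move=> n0 hS; have := nm_offset n hS.
have h k : (0 < k)%N -> (1 / 4) ^+ k <= (1 / 4 : R).
  by move=> k0; rewrite -[leRHS]expr1; apply: ler_wiXn2l => //; lra.
by have := h n n0; have := h n.+1 isT; lra.
Qed.

Lemma log_upper_slack (R : realType) (a b l u : R) : u <= a + l -> u <= l + (`|a| + `|b|).
Proof. by move=> h; have := ler_norm a; have := normr_ge0 b; lra. Qed.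

Lemma log_lower_slack (R : realType) (a b l u : R) : b + l <= u -> l - (`|a| + `|b|) <= u.
Proof. by move=> h; have := ler_norm (- b); rewrite normrN; have := normr_ge0 a; lra. Qed.

Lemma ln_half_le0 (R : realType) : ln (1 / 2 : R) <= 0.
Proof. by apply: ln_le0; lra. Qed.

Section ConstantCoefficient.
Variables (R : realType) (n : nat) (X : R[i] -> R[i] -> Prop).
Local Notation C := R[i].
Hypothesis n_gt0 : (0 < n)%N.
Hypothesis X_adapted : adapted_curve n X.
Variable G : {poly {poly C}}.
Hypothesis hG : generic_equation X G.
Let m := (size G).-1.
Let m_gt0 : (0 < m)%N := equation_degree_gt0 X_adapted hG.

(** The product of the values of W at the roots y of the fibre over S is, up to
    sign, the ratio of G(S, Y) at W = 0 by the leading coefficient, hence at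
    least a power of |S|, up to a constant. Every single value of W is
    O(1 / |S|) by [X_no_large_Y], so none of them is smaller than a constant
    times some power of |S|. *)
Lemma root_third_ge : exists (k : nat) (c d : R), [/\ 0 < c, 0 < d &
  forall S y, (bad_locus n G).[S] != 0 -> nm S < d -> ev G S y = 0 ->
    c * nm S ^+ k <= nm (third n S y)].
Proof.
have [M M0 hM] := poly_bounded (lead_coef G) 0.
have q0 : G.[- offset R n] != 0.
  by have := bad_locus_neq0 X_adapted hG; rewrite /bad_locus !mulf_eq0 !negb_or => /andP[_ ->].
have [N [q1 q10 Eq]] := multiplicity_XsubC (G.[- offset R n]) 0.
rewrite q0 /= subr0 in q10 Eq.
have [c [d1 [c0 d10 hc]]] := poly_near_ge q10.
have [rho hrho] := X_no_large_Y X_adapted 1 1.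
have [rh [rh1 rhE]] : exists rh : R, 1 <= rh /\ rho <= rh.
  by exists (`|rho| + 1); have := ler_norm rho; have := normr_ge0 rho; split; lra.
exists (N + m.-1)%N, (c / M / (rh + 2) ^+ m.-1), (Num.min 1 d1); split.
- by rewrite !divr_gt0 // exprn_gt0; lra.
- by rewrite lt_min ltr01.
move=> S y bS; rewrite lt_min => /andP[S1 S2] hy.
have [S0 lS _ _] := outside_bad_locus bS.
have nS : 0 < nm S by rewrite nm_gt0.
have [s [sz sr _ Es]] := fiber_roots lS.
have ys : y \in s.
  move: hy => /eqP; rewrite Es mulf_eq0 (negPf lS) /= prodf_seq_eq0 => /hasP[x xs] /=.
  by rewrite subr_eq0 => /eqP->.
pose s' := [seq third n S x | x <- s].
have h1 : c / M * nm S ^+ N <= \prod_(x <- s') nm x.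
  have E : ev G S (- offset R n).[S] = G.[- offset R n].[S] by rewrite ev_fiber evE.
  have := hc S; rewrite subr0 => /(_ S2) h1.
  have := congr1 (fun z => nm z) E; rewrite /= Eq hornerM nmM horner_exp ?hornerXsubC ?subr0 ?hornerX nmX.
  rewrite Es nmM nm_prod => E'.
  rewrite mulrAC ler_pdivrMr //.
  have -> : \prod_(x <- s') nm x = \prod_(x <- s) nm ((- offset R n).[S] - x).
    rewrite big_map; apply: eq_bigr => x _; rewrite /third hornerN; congr nm; ring.
  apply: le_trans (_ : nm q1.[S] * nm S ^+ N <= _).
    by rewrite ler_wpM2r // exprn_ge0 // ltW.
  rewrite -E' mulrC ler_wpM2l //; first by apply: prodr_ge0 => x _; exact: nm_ge0.
  by apply: hM; rewrite subr0 ltW.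
have h2 x : x \in s' -> nm x <= (rh + 2) / nm S.
  move=> /mapP[z zs ->]; have Xz := equation_subset X_adapted hG bS (sr _ zs).
  rewrite ler_pdivlMr // /third nmN.
  have hz : nm z * nm S <= rh.
    rewrite leNgt; apply/negP => hz; apply: (hrho _ _ Xz (ltW S1)).
      apply: le_trans rhE _; apply: le_trans (ltW hz) _.
      by rewrite ler_piMr ?nm_ge0 // ltW.
    by rewrite expr1 mulrC; apply: le_trans rh1 (ltW hz).
  have ht := nm_offset n (ltW S1); rewrite !expr1n in ht.
  apply: le_trans (_ : (nm z + 2) * nm S <= _).
    rewrite ler_wpM2r ?nm_ge0 //; apply: le_trans (nm_le_add _ _) _.
    by rewrite lerD2l; apply: le_trans ht _; lra.
  by rewrite mulrDl lerD //; lra.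
have := factor_ge h2 (map_f (third n S) ys) h1.
rewrite size_map sz -/m expr_div_n.
have p1 : 0 < (rh + 2) ^+ m.-1 by rewrite exprn_gt0; lra.
have p2 : 0 < nm S ^+ m.-1 by rewrite exprn_gt0.
rewrite mulrA ler_pdivlMr // => h3.
by rewrite exprD mulrAC ler_pdivrMr // mulrA.
Qed.

(** If G(0, 0) = 0, the product of the roots of the fibre over S is O(|S|), so
    one of the m roots satisfies |y|^m = O(|S|). Then W is small as well, but by
    [root_third_ge] not smaller than a power of |S|, and this contradicts
    [no_small_Y]. *)
Lemma constant_coef_neq0 : G.[0].[0] != 0.
Proof.
apply/eqP => g0; have bad0 := bad_locus_neq0 X_adapted hG.
have [h Eh] : exists h, G.[0] = h * 'X.
  have /factor_theorem[h Eh] : root G.[0] 0 by rewrite /root g0.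
  by exists h; rewrite Eh subr0.
have [M M0 hM] := poly_bounded h 0.
have l0 := lead_coef_no_root X_adapted hG 0.
have [cl [d1 [cl0 d10 hcl]]] := poly_near_ge l0.
have [k [c2 [d2 [c20 d20 hW]]]] := root_third_ge.
have [d3 d30 hbad] := poly_isolated 0 bad0.
pose c1 := M / cl; have c10 : 0 < c1 by rewrite divr_gt0.
pose c := `|ln c1| + `|ln c2|.
have c0 : 0 <= c by rewrite addr_ge0.
have [rho H] := no_small_Y n_gt0 (adapted_rays X_adapted) (ler0n R k) (ler0n R m) c0.
have e0 : 0 < Num.min (expR (- rho)) ((1 / 2) ^+ m / c1).
  by rewrite lt_min expR_gt0 divr_gt0 // exprn_gt0 // divr_gt0.
have d10' : 0 < Num.min d1 (1 / 4) by rewrite lt_min d10; lra.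
have d20' : 0 < Num.min d2 d3 by rewrite lt_min d20.
have [d [dpos]] := small_parameter3 d10' d20' e0.
rewrite !lt_min => /andP[e1 e2] /andP[e3 e4] /andP[e5 e6].
pose S : C := real_complex R d.
have nS : nm S = d by rewrite nm_real gtr0_norm.
have nS' : nm (S - 0) = d by rewrite subr0.
have S0' : S != 0 by rewrite -nm_gt0 nS.
have bS : (bad_locus n G).[S] != 0 by apply: hbad; rewrite ?nS'.
have [S0 lS _ _] := outside_bad_locus bS.
have [s [sz sr _ Es]] := fiber_roots lS.
have hB : \prod_(x <- s) nm x <= c1 * d.
  have := congr1 (fun z => nm z) (Es 0); rewrite /ev polyC0 Eh hornerM hornerX /= !nmM nS nm_prod.
  under eq_bigr do rewrite sub0r nmN.
  move=> E; rewrite /c1 mulrAC ler_pdivlMr // mulrC.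
  apply: le_trans (_ : nm (lead_coef G).[S] * \prod_(x <- s) nm x <= _).
    apply: ler_wpM2r; first by apply: prodr_ge0 => x _; exact: nm_ge0.
    by apply: hcl; rewrite nS'.
  rewrite -E ler_wpM2r //; first exact: ltW.
  by apply: hM; rewrite nS'; lra.
have sz0 : (0 < size s)%N by rewrite sz.
have [y ys hy] := small_factor sz0 hB; rewrite sz -/m in hy.
have XSy := equation_subset X_adapted hG bS (sr _ ys).
have [_ y0 W0] := adapted_torus X_adapted XSy.
have ny : nm y <= 1 / 2.
  rewrite -(@ler_pXn2r _ m) ?nnegrE ?nm_ge0 //; last by rewrite divr_ge0.
  apply: le_trans hy _; rewrite mulrC -ler_pdivlMr //; exact: ltW.
have nS2 : nm S < d2 by rewrite nS.
have hw := hW S y bS nS2 (sr _ ys).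
have yp : 0 < nm y by rewrite nm_gt0.
have wp : 0 < nm (third n S y) by rewrite nm_gt0.
apply: (H (lg S) (lg y) (lg (third n S y))).
- by exists S, y.
- rewrite nS; have := ln_mono dpos (ltW e5); rewrite expRK; exact.
- exact: le_trans (ln_mono yp ny) (ln_half_le0 R).
- have : nm (third n S y) <= 1.
    rewrite /third nmN; apply: le_trans (nm_le_add _ _) _.
    have hS : nm S <= 1 / 4 by rewrite nS ltW.
    by apply: le_trans (lerD ny (nm_offset_small n_gt0 hS)) _; rewrite -splitr.
  by move=> /(ln_mono wp); rewrite ln1.
- have := ln_mono (exprn_gt0 m yp) hy; rewrite lnXn // lnM ?posrE // nS mulr_natl.
  exact: log_upper_slack.
- have dk : 0 < d ^+ k by rewrite exprn_gt0.
  have := ln_mono (mulr_gt0 c20 dk); rewrite -nS => /(_ _ hw).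
  rewrite lnM ?posrE // nS // lnXn // mulr_natl.
  exact: log_lower_slack.
Qed.

End ConstantCoefficient.

(** * Curves that are graphs, and the bound on the exponent *)

(** Slopes of the graph at S = oo and at a zero of Y, read off the rays. *)
Lemma on_rays_infty (R : realType) (n : nat) (p1 p2 : R) : on_rays n 1 p1 p2 -> p1 = 1.
Proof. by move=> [r [r0 [[k _ _]|[k k' _]|[k _ _]|[k _ _]]]]; lra. Qed.

Lemma on_rays_tangent (R : realType) (n : nat) (k : R) : on_rays n 0 (- 1) (- k) -> k = n%:R.
Proof.
move=> [r [r0 [[_ k1 k2]|[_ k1 k2]|[_ k1 k2]|[_ k1 k2]]]]; try by lra.
have r1 : r = 1 by lra.
by rewrite r1 in k2; lra.
Qed.

Section Graph.
Variables (R : realType) (n : nat) (X : R[i] -> R[i] -> Prop).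
Local Notation C := R[i].
Hypothesis n_gt0 : (0 < n)%N.
Hypothesis X_adapted : adapted_curve n X.
(* The closure of X meets the line S = 0 at most once away from Y = 0,
   with multiplicity. *)
Hypothesis X_weight : forall r1 r2 : C, r1 != 0 -> r2 != 0 ->
  ~ (forall F : {poly {poly C}}, vanishes X F ->
      ('X - r1%:P) * ('X - r2%:P) %| fiber 0 F).

(** Suppose that G(0, Y) has two nonzero roots, counted with multiplicity. Every
    equation of X is a multiple of G up to a power of the leading coefficient,
    which is a nonzero constant, so its restriction to S = 0 vanishes at both
    roots; the weight hypothesis excludes this. So G has degree 1 in Y. *)
Lemma X_graph : exists h b : {poly C}, [/\ b != 0, h.[0] != 0 &
  forall S, b.[S] != 0 -> X S h.[S]].
Proof.
have [G hG] := X_equation X_adapted.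
have l0 := lead_coef_no_root X_adapted hG.
have c0 := constant_coef_neq0 n_gt0 X_adapted hG.
have m_gt0 := equation_degree_gt0 X_adapted hG.
have bad0 := bad_locus_neq0 X_adapted hG.
have [s [sz sr Es _]] := fiber_roots (l0 0).
have s_neq0 x : x \in s -> x != 0.
  by move=> /sr E; apply: contraNneq c0 => x0; move: E; rewrite x0 /ev polyC0 => ->.
have m_le1 : ((size G).-1 <= 1)%N.
  rewrite -sz leqNgt; apply/negP => s2; move: s2 s_neq0 Es {sz sr}.
  case: s => [|r1 [|r2 s]] //= _ s_neq0 Es.
  apply: (X_weight (s_neq0 r1 _) (s_neq0 r2 _)); rewrite ?inE ?eqxx ?orbT // => F vF.
  have [k [Q E]] := geq_divides hG (vanishes_generically vF).
  have : fiber 0 (lead_coef G ^+ k *: F) = fiber 0 (Q * G) by rewrite E.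
  rewrite -mul_polyC /fiber !rmorphM /= map_polyC /= -!/(fiber _ _) /horner_eval.
  rewrite horner_exp mul_polyC Es !big_cons => E'.
  rewrite -(dvdpZr _ _ (expf_neq0 k (l0 0))) E' -scalerAr (dvdpZr _ _ (l0 0)).
  by rewrite (mulrA ('X - r1%:P)); apply/dvdp_mull/dvdp_mulr.
have sG : size G = 2%N by case: (size G) m_gt0 m_le1 => [|[|[|]]].
have [l1 l10 El] : exists2 l1 : C, l1 != 0 & lead_coef G = l1%:P.
  have : size (lead_coef G) == 1%N.
    by apply: contraT => /closed_rootP[x]; rewrite /root (negPf (l0 x)).
  by move=> /size_poly1P.
have g1 : G`_1 = l1%:P by rewrite -El lead_coefE sG.
exists (- l1^-1 *: G`_0), (bad_locus n G); split.
- exact: bad0.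
- have := c0; rewrite (horner_coef0 G) => c0'.
  by rewrite hornerZ mulf_neq0 ?oppr_eq0 ?invr_eq0.
move=> S bS; apply: (equation_subset X_adapted hG bS).
rewrite /ev (horner_coef G) sG !big_ord_recl big_ord0 /= expr0 mulr1 expr1 addr0 g1.
rewrite hornerD hornerM !hornerC hornerZ; field.
exact: l10.
Qed.

Lemma lg_real_exp (t : R) : lg (real_complex R (expR t)) = t.
Proof. by rewrite nm_real gtr0_norm ?expR_gt0 // expRK. Qed.

Section WithGraph.
Variables h b : {poly C}.
Hypothesis b_neq0 : b != 0.
Hypothesis h0 : h.[0] != 0.
Hypothesis X_h : forall S, b.[S] != 0 -> X S h.[S].

Let w : {poly C} := h + offset R n.

Lemma graph_third S : third n S h.[S] = - w.[S].
Proof. by rewrite /third /w hornerD. Qed.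

Lemma graph_third_neq0 : w != 0.
Proof.
apply: contraTneq isT => w0; have [S bS] := poly_nonzero_at b_neq0.
by have [_ _] := adapted_torus X_adapted (X_h bS); rewrite graph_third w0 horner0 oppr0 eqxx.
Qed.

(** A path sigma on the line of S along which all logarithms are linear in t up
    to a bounded error gives an asymptotic direction. *)
Lemma branch_direction (p0 p1 p2 c : R) (sigma : R -> C) : (exists T, forall t, T < t ->
    [/\ b.[sigma t] != 0, `|lg (sigma t) - t * p0| <= c,
        `|lg h.[sigma t] - t * p1| <= c & `|lg w.[sigma t] - t * p2| <= c]) ->
  on_rays n p0 p1 p2.
Proof.
move=> [T0 hT]; apply: (adapted_rays X_adapted) => e T e0.
pose t := Num.max (Num.max T T0) (c / e) + 1.
have [t1 [t2 t3]] : T < t /\ T0 < t /\ c <= e * t.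
  have h1 : T <= Num.max (Num.max T T0) (c / e) by rewrite !le_max lexx.
  have h2 : T0 <= Num.max (Num.max T T0) (c / e) by rewrite !le_max lexx ?orbT.
  have h3 : c / e <= t.
    have : c / e <= Num.max (Num.max T T0) (c / e) by rewrite !le_max lexx ?orbT.
    by rewrite /t; lra.
  by rewrite /t; split; [lra|split; [lra|]]; rewrite mulrC -ler_pdivrMr.
have [k0 k1 k2 k3] := hT t t2.
exists t, (lg (sigma t)), (lg h.[sigma t]), (lg w.[sigma t]); split=> //.
- by exists (sigma t), h.[sigma t]; rewrite graph_third nmN; split=> //; exact: X_h.
- exact: le_trans t3.
- exact: le_trans t3.
- exact: le_trans t3.
Qed.

(** Let S tend to infinity: log|h| / log|S| tends to the degree of h. *)
Lemma graph_degree : size h = 2%N.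
Proof.
have hn0 : h != 0 by apply: contraNneq h0 => ->; rewrite horner0.
have [r1 [c1 [r11 c10 H1]]] := lg_at_infty hn0.
have [r2 [c2 [r21 c20 H2]]] := lg_at_infty graph_third_neq0.
have [r3 [k1 [k2 [r31 k10 k20 H3]]]] := poly_at_infty b_neq0.
have : on_rays n (1 : R) (size h).-1%:R (size w).-1%:R.
  apply: (@branch_direction _ _ _ (c1 + c2) (fun t => real_complex R (expR t))).
  exists (r1 + r2 + r3) => t ht.
  have ne : nm (real_complex R (expR t)) = expR t by rewrite nm_real gtr0_norm ?expR_gt0.
  have et : t <= expR t by have := expR_ge1Dx t; lra.
  have b1 : r1 <= nm (real_complex R (expR t)) by rewrite ne; lra.
  have b2 : r2 <= nm (real_complex R (expR t)) by rewrite ne; lra.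
  have b3 : r3 <= nm (real_complex R (expR t)) by rewrite ne; lra.
  split.
  - have /andP[+ _] := H3 _ b3.
    rewrite -nm_gt0; apply: lt_le_trans; apply: mulr_gt0 => //.
    by rewrite exprn_gt0 // ne expR_gt0.
  - by rewrite lg_real_exp mulr1 subrr normr0; lra.
  - have := H1 _ b1; rewrite lg_real_exp mulrC; lra.
  - have := H2 _ b2; rewrite lg_real_exp mulrC; lra.
move=> /on_rays_infty /eqP; rewrite (eqr_nat _ _ 1) => /eqP E.
by rewrite -E prednK // size_poly_gt0.
Qed.

Lemma graph_linear : exists e al : C, [/\ e != 0, al != 0 & h = e *: ('X - al%:P)].
Proof.
have sh := graph_degree.
have h1 : h`_1 != 0 by have := lead_coef_eq0 h; rewrite lead_coefE sh -size_poly_eq0 sh /= => ->.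
exists h`_1, (- h`_0 / h`_1); split=> //.
  by rewrite mulf_neq0 ?invr_eq0 // oppr_eq0 -horner_coef0.
apply/polyP => i; rewrite coefZ coefB coefX coefC.
case: i => [|[|i]] /=.
- by rewrite mulNr sub0r opprK mulrC divfK.
- by rewrite subr0 mulr1.
- by rewrite subr0 mulr0 nth_default // sh.
Qed.

(** Let S tend to the zero al of h: the slopes of log|Y| and log|W| are the orders
    of vanishing of h and of w at al, and their ratio on the ray (0, -1, -n) is
    n. *)
Lemma graph_tangency e al : e != 0 -> al != 0 -> h = e *: ('X - al%:P) ->
  exists q, w = q * ('X - al%:P) ^+ n.
Proof.
move=> e0 al0 Eh.
have [k [q qal Ew]] := multiplicity_XsubC w al; rewrite graph_third_neq0 /= in qal.
have Eh' : h = e%:P * ('X - al%:P) ^+ 1 by rewrite expr1 mul_polyC.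
have EX : ('X : {poly C}) = 'X * ('X - al%:P) ^+ 0 by rewrite expr0 mulr1.
have e0' : (e%:P : {poly C}).[al] != 0 by rewrite hornerC.
have X0' : ('X : {poly C}).[al] != 0 by rewrite hornerX.
have [d1 [c1 [d10 c10 H1]]] := lg_near_root Eh' e0'.
have [d2 [c2 [d20 c20 H2]]] := lg_near_root Ew qal.
have [d3 [c3 [d30 c30 H3]]] := lg_near_root EX X0'.
have [d4 d40 H4] := poly_isolated al b_neq0.
suff : on_rays n (0 : R) (- 1) (- k%:R).
  move=> /on_rays_tangent /eqP; rewrite eqr_nat => /eqP E.
  by exists q; rewrite Ew E.
clear Eh' EX e0' X0' qal.
apply: (@branch_direction _ _ _ (c1 + c2 + c3) (fun t => al + real_complex R (expR (- t)))).
pose d := Num.min (Num.min d1 d2) (Num.min d3 d4).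
have d0 : 0 < d by rewrite !lt_min d10 d20 d30.
exists (- ln d) => t ht.
have ne : nm (al + real_complex R (expR (- t)) - al) = expR (- t).
  by rewrite sub_real // ltW // expR_gt0.
have : expR (- t) < d by rewrite -ltr_ln ?posrE ?expR_gt0 // expRK; lra.
rewrite !lt_min => /andP[/andP[l1 l2] /andP[l3 l4]].
have za : al + real_complex R (expR (- t)) != al.
  by rewrite -subr_eq0 -nm_gt0 ne expR_gt0.
rewrite -ne in l1 l2 l3 l4.
have [_ K1] := H1 _ za l1; have [_ K2] := H2 _ za l2; have [_ K3] := H3 _ za l3.
rewrite hornerX in K3; rewrite ne expRK in K1 K2 K3.
split.
- exact: H4.
- by move: K3; rewrite mul0r mulr0; lra.
- by move: K1; rewrite mul1r mulrN1; lra.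
- by move: K2; rewrite !mulrN mulrC; lra.
Qed.

(** Evaluation at al of the equality w = q (X - al)^n gives al = -1. After
    division by X + 1, the number -1 is for n >= 3 a multiple root of X^n + e,
    and this is excluded by the derivative. *)
Lemma graph_small_degree : (n <= 2)%N.
Proof.
rewrite leqNgt; apply/negP => n3.
have [e [al [e0 al0 Eh]]] := graph_linear.
have [q Ew] := graph_tangency e0 al0 Eh.
have Eoff : offset R n = 'X^n * ('X + 1) by rewrite /offset exprSr mulrDr mulr1 addrC.
have al1 : al = -1.
  have := congr1 (fun p => p.[al]) Ew; rewrite /w Eh Eoff.
  rewrite !(hornerE, horner_exp, hornerXn) subrr mulr0 add0r expr0n /=.
  rewrite (gtn_eqF (ltnW (ltnW n3))) mulr0 => /eqP.
  by rewrite mulf_eq0 expf_eq0 (negPf al0) andbF /= addr_eq0 => /eqP.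
have X1 : ('X - al%:P : {poly C}) = 'X + 1 by rewrite al1 polyCN opprK.
have X10 : ('X + 1 : {poly C}) != 0 by rewrite -X1 polyXsubC_eq0.
have E : 'X^n + e%:P = q * ('X + 1) ^+ n.-1 :> {poly C}.
  apply: (mulIf X10); rewrite -mulrA -exprSr prednK; last by case: (n) n3.
  by rewrite -{2}X1 -Ew /w Eh Eoff X1 -mul_polyC mulrDl addrC.
have := congr1 (fun p => p^`().[-1]) E.
rewrite /= derivD derivC addr0 derivXn derivM deriv_exp.
rewrite !(hornerE, hornerMn, horner_exp) addNr.
have [k hn] : exists k, n = k.+3 by case: (n) n3 => [|[|[|k]]] // _; exists k.
have [-> ->] : (0 : C) ^+ n.-1 = 0 /\ (0 : C) ^+ n.-2 = 0.
  by rewrite hn /= !exprS !mul0r.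
rewrite !mulr0 mul0rn !mulr0 addr0 => /eqP.
by rewrite mulrn_eq0 expf_eq0 oppr_eq0 oner_eq0 andbF orbF hn.
Qed.

End WithGraph.

Lemma adapted_curve_bound : (n <= 2)%N.
Proof.
by have [h [b [b0 h0 Xh]]] := X_graph; exact: graph_small_degree b0 h0 Xh.
Qed.

End Graph.

(** * Monomial maps and logarithmic limits *)

Section Monomial.
Variable R : realType.
Local Notation C := R[i].
Implicit Types (m n p : nat).

Lemma field_exprzM (x y : C) (k : int) : (x * y) ^ k = x ^ k * y ^ k.
Proof. by case: k => k; rewrite ?NegzE -?exprnN -?exprnP exprMn ?invfM. Qed.

Lemma exprz_prod (I : Type) (s : seq I) (F : I -> C) (k : int) :
  (\prod_(i <- s) F i) ^ k = \prod_(i <- s) F i ^ k.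
Proof.
by elim: s => [|i s IH]; rewrite ?big_nil ?exp1rz// !big_cons field_exprzM IH.
Qed.

Lemma exprz_sum (I : Type) (s : seq I) (x : C) (F : I -> int) : x != 0 ->
  x ^ (\sum_(i <- s) F i) = \prod_(i <- s) x ^ F i.
Proof.
move=> x0; elim: s => [|i s IH]; rewrite ?big_nil ?expr0z// !big_cons.
by rewrite expfzDr // IH.
Qed.

Lemma torus_monomial m n (A : 'M[int]_(m, n)) (z : {ffun 'I_n -> C}) :
  torus z -> torus (monomial_map A z).
Proof.
by move=> hz i; rewrite ffunE; apply/prodf_neq0 => j _; rewrite expfz_neq0.
Qed.

Lemma monomial_mapM m n p (A : 'M[int]_(m, n)) (B : 'M[int]_(n, p))
    (z : {ffun 'I_p -> C}) : torus z ->
  monomial_map (A *m B) z = monomial_map A (monomial_map B z).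
Proof.
move=> hz; apply/ffunP => i; rewrite !ffunE.
under [RHS]eq_bigr => j _ do rewrite ffunE exprz_prod.
rewrite exchange_big /=; apply: eq_bigr => k _; rewrite mxE exprz_sum //.
by apply: eq_bigr => j _; rewrite exprz_exp mulrC.
Qed.

Lemma monomial_map1 n (z : {ffun 'I_n -> C}) : monomial_map 1%:M z = z.
Proof.
apply/ffunP => i; rewrite ffunE (bigD1 i) //= mxE eqxx expr1z big1 ?mulr1 //.
by move=> j /negPf ji; rewrite mxE eq_sym ji expr0z.
Qed.

Lemma monomial_mapK n (A : 'M[int]_n) (z : {ffun 'I_n -> C}) : torus z ->
  A \in unitmx -> monomial_map (invmx A) (monomial_map A z) = z.
Proof. by move=> hz hA; rewrite -monomial_mapM // mulVmx // monomial_map1. Qed.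

Lemma monomial_mapKV n (A : 'M[int]_n) (z : {ffun 'I_n -> C}) : torus z ->
  A \in unitmx -> monomial_map A (monomial_map (invmx A) z) = z.
Proof. by move=> hz hA; rewrite -monomial_mapM // mulmxV // monomial_map1. Qed.

Lemma monomial_map_scale m n (A : 'M[int]_(m, n)) (c z : {ffun 'I_n -> C}) i :
  monomial_map A [ffun j => c j * z j] i = monomial_map A c i * monomial_map A z i.
Proof.
rewrite !ffunE -big_split; apply: eq_bigr => j _ /=; rewrite ffunE.
exact: field_exprzM.
Qed.

Lemma lg_monomial m n (A : 'M[int]_(m, n)) (z : {ffun 'I_n -> C}) i : torus z ->
  lg (monomial_map A z i) = \sum_j (A i j)%:~R * lg (z j).
Proof.
move=> hz; rewrite ffunE lg_prod => [|j]; last by rewrite expfz_neq0.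
by apply: eq_bigr => j _; rewrite lgXz.
Qed.

(** Monomial maps act on logarithms by integer matrices, hence preserve bounded
    and sublinear errors. *)
Lemma int_matrix_bounded m n (A : 'M[int]_(m, n)) : exists2 K : R, 0 < K &
  forall (u : 'I_n -> R) e, (forall j, `|u j| <= e) -> 0 <= e ->
    forall i, `|\sum_j (A i j)%:~R * u j| <= K * e.
Proof.
pose K : R := \sum_i \sum_j `|(A i j)%:~R|.
exists (K + 1); first by rewrite ltr_wpDl // !sumr_ge0 // => i _; rewrite sumr_ge0.
move=> u e ue e0 i; apply: le_trans (ler_norm_sum _ _ _) _.
apply: le_trans (_ : \sum_j `|(A i j)%:~R| * e <= _).
  by apply: ler_sum => j _; rewrite normrM ler_wpM2l.
rewrite -mulr_suml ler_wpM2r //.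
rewrite /K (bigD1 i) //= -addrA lerDl addr_ge0 // sumr_ge0 // => k _.
by rewrite sumr_ge0.
Qed.

(** Here t is the logarithm of the base of Log_t, so that the division by log t
    and the topology of the space of column vectors disappear. *)
Lemma log_limsupP (X : set {ffun 'I_3 -> C}) (x : 'cV[R]_3) : log_limsup X x <->
  forall e T : R, 0 < e -> exists t z, [/\ T < t, X z &
    forall i, `|lg (z i) - t * x i 0| <= e * t].
Proof.
split=> [hx e T e0|hx U /nbhs_ballP[e /= e0 hU] T].
  have [t Tt [_ [[z Xz <-] hz]]] := hx _ (nbhsx_ballx x e e0) (expR (Num.max T 1)).
  have t0 : 0 < t by apply: le_lt_trans Tt; exact: expR_ge0.
  have lt : Num.max T 1 < ln t by rewrite -[ltLHS]expRK ltr_ln ?posrE ?expR_gt0.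
  move: lt; rewrite gt_max => /andP[lt1 lt2].
  have l0 : 0 < ln t by apply: lt_trans lt2.
  exists (ln t), z; split=> // i; have /ltW := hz.2 i 0; rewrite mxE.
  have -> : lg (z i) - ln t * x i 0 = - (x i 0 - lg (z i) / ln t) * ln t.
    by field; rewrite gt_eqF.
  by rewrite normrM normrN (gtr0_norm l0) => h; rewrite ler_wpM2r // ltW.
have [t [z [Tt Xz hz]]] := hx (e / 2) (Num.max T 0) (divr_gt0 e0 (ltr0n _ 2)).
move: Tt; rewrite gt_max => /andP[Tt t0].
exists (expR t); first by apply: lt_trans Tt _; have := expR_ge1Dx t; lra.
exists (Logt (expR t) z); split; first by exists z.
apply: hU; split=> // i j; rewrite ord1 mxE expRK /ball /=.
have -> : x i 0 - lg (z i) / t = - (lg (z i) - t * x i 0) / t by field; rewrite gt_eqF.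
rewrite normrM normrN normfV (gtr0_norm t0) ltr_pdivrMr //.
by apply: le_lt_trans (hz i) _; rewrite mulrAC -mulrA mulrC; nra.
Qed.

Lemma realvM (A : 'M[int]_3) (v : 'cV[int]_3) i :
  realv R (A *m v) i 0 = \sum_j (A i j)%:~R * realv R v j 0.
Proof.
rewrite !mxE rmorph_sum; apply: eq_bigr => j _; rewrite rmorphM /=.
by rewrite mxE.
Qed.

Lemma log_limsup_monomial (X : set {ffun 'I_3 -> C}) m (A : 'M[int]_(m, 3)) x :
  X `<=` @torus R 3 -> log_limsup X x ->
  forall e T : R, 0 < e -> exists t z, [/\ T < t, X z & forall i,
    `|lg (monomial_map A z i) - t * (\sum_j (A i j)%:~R * x j 0)| <= e * t].
Proof.
move=> XT /log_limsupP hx e T e0.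
have [K K0 hK] := int_matrix_bounded A.
have [t [z [Tt Xz hz]]] := hx (e / K) (Num.max T 0) (divr_gt0 e0 K0).
move: Tt; rewrite gt_max => /andP[Tt t0].
exists t, z; split=> // i; rewrite lg_monomial; last exact: XT.
have := hK _ _ hz (mulr_ge0 (divr_ge0 (ltW e0) (ltW K0)) (ltW t0)) i.
have -> : K * (e / K * t) = e * t by field; rewrite gt_eqF.
congr (_ <= _).
  congr (`|_|); rewrite mulr_sumr -sumrB; apply: eq_bigr => j _; ring.
Qed.

Lemma log_limsup_of_monomial (X : set {ffun 'I_3 -> C}) (A : 'M[int]_3) (y : 'cV[R]_3) :
  X `<=` @torus R 3 -> A \in unitmx ->
  (forall e T : R, 0 < e -> exists t z, [/\ T < t, X z & forall i,
    `|lg (monomial_map A z i) - t * y i 0| <= e * t]) ->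
  log_limsup X (map_mx intr (invmx A) *m y).
Proof.
move=> XT hA hy; apply/log_limsupP => e T e0.
have [K K0 hK] := int_matrix_bounded (invmx A).
have [t [z [Tt Xz hz]]] := hy (e / K) (Num.max T 0) (divr_gt0 e0 K0).
move: Tt; rewrite gt_max => /andP[Tt t0].
exists t, z; split=> // i.
have := hK _ _ hz (mulr_ge0 (divr_ge0 (ltW e0) (ltW K0)) (ltW t0)) i.
have -> : K * (e / K * t) = e * t by field; rewrite gt_eqF.
congr (_ <= _).
  rewrite -{2}(monomial_mapK (XT _ Xz) hA) lg_monomial; last exact/torus_monomial/XT.
  congr (`|_|); rewrite mxE mulr_sumr -sumrB; apply: eq_bigr => j _; rewrite mxE; ring.
Qed.

End Monomial.

Section Regular.
Variables (C : fieldType) (T : Type) (A : comNzRingType) (ev : T -> A -> C).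
Variables (cst : C -> A) (D : T -> Prop) (g : A).
Hypothesis evD : forall t, {morph ev t : x y / x + y}.
Hypothesis evM : forall t, {morph ev t : x y / x * y}.
Hypothesis evC : forall t c, ev t (cst c) = c.
Hypothesis g_neq0 : forall t, D t -> ev t g != 0.

(** The restrictions to D of the elements of the localization of A at g. The
    ring A and its evaluation are left abstract because they will be, in turn,
    polynomials in one, two and three variables. *)
Definition regular (f : T -> C) : Prop :=
  exists F k, forall t, D t -> ev t F = ev t g ^+ k * f t.

Let ev1 t : ev t 1 = 1.
Proof. by have := evM t 1 (cst 1); rewrite mul1r evC mulr1. Qed.

Let evX t x k : ev t (x ^+ k) = ev t x ^+ k.
Proof. by elim: k => [|k IH]; rewrite ?expr0 ?ev1// !exprS evM IH. Qed.

Lemma regular_const c : regular (fun=> c).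
Proof. by exists (cst c), 0%N => t _; rewrite evC expr0 mul1r. Qed.

Lemma regular_ev F : regular (ev^~ F).
Proof. by exists F, 0%N => t _; rewrite expr0 mul1r. Qed.

Lemma regularD f1 f2 : regular f1 -> regular f2 -> regular (fun t => f1 t + f2 t).
Proof.
move=> [F1 [k1 h1]] [F2 [k2 h2]].
exists (g ^+ k2 * F1 + g ^+ k1 * F2), (k1 + k2)%N => t Dt.
by rewrite evD !evM !evX // h1 // h2 // exprD; ring.
Qed.

Lemma regularM f1 f2 : regular f1 -> regular f2 -> regular (fun t => f1 t * f2 t).
Proof.
move=> [F1 [k1 h1]] [F2 [k2 h2]]; exists (F1 * F2), (k1 + k2)%N => t Dt.
by rewrite evM h1 // h2 // exprD; ring.
Qed.

Lemma eq_regular f1 f2 : (forall t, D t -> f1 t = f2 t) -> regular f1 -> regular f2.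
Proof. by move=> E [F [k h]]; exists F, k => t Dt; rewrite -E // h. Qed.

Lemma regular_sum (I : Type) (s : seq I) (f : I -> T -> C) :
  (forall i, regular (f i)) -> regular (fun t => \sum_(i <- s) f i t).
Proof.
move=> h; elim: s => [|i s IH].
  by apply: (@eq_regular (fun=> 0)) (regular_const 0) => t _; rewrite big_nil.
apply: eq_regular (regularD (h i) IH) => t _; by rewrite big_cons.
Qed.

Lemma regular_prod (I : Type) (s : seq I) (f : I -> T -> C) :
  (forall i, regular (f i)) -> regular (fun t => \prod_(i <- s) f i t).
Proof.
move=> h; elim: s => [|i s IH].
  by apply: (@eq_regular (fun=> 1)) (regular_const 1) => t _; rewrite big_nil.
apply: eq_regular (regularM (h i) IH) => t _; by rewrite big_cons.
Qed.

Lemma regular_exp f k : regular f -> regular (fun t => f t ^+ k).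
Proof.
move=> h; elim: k => [|k IH].
  by apply: (@eq_regular (fun=> 1)) (regular_const 1) => t _; rewrite expr0.
by apply: eq_regular (regularM h IH) => t _; rewrite exprS.
Qed.

Lemma regular_expz f (k : int) : regular f -> regular (fun t => (f t)^-1) ->
  regular (fun t => f t ^ k).
Proof.
move=> h h'; case: k => k; first exact: regular_exp.
by apply: eq_regular (regular_exp k.+1 h') => t _; rewrite NegzE -exprnN exprVn.
Qed.

(** The inverse of a factor f of g is the complementary factor F divided by g. *)
Lemma regular_inv f F : (forall t, D t -> ev t F * f t = ev t g) ->
  regular (fun t => (f t)^-1).
Proof.
move=> h; exists F, 1%N => t Dt; rewrite expr1 -(h t Dt) mulfK //.
by have := g_neq0 Dt; rewrite -(h t Dt) mulf_eq0 negb_or => /andP[].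
Qed.

End Regular.

Lemma regular_meval (C : fieldType) (T : Type) (A : comNzRingType)
    (ev : T -> A -> C) (cst : C -> A) (D : T -> Prop) (g : A) n
    (x : T -> 'I_n -> C) (f : mpoly.mpoly n C) :
  (forall t, {morph ev t : x y / x + y}) ->
  (forall t, {morph ev t : x y / x * y}) ->
  (forall t c, ev t (cst c) = c) ->
  (forall i, regular ev D g (x^~ i)) ->
  regular ev D g (fun t => mpoly.meval (x t) f).
Proof.
move=> evD evM evC hx.
have h : regular ev D g (fun t => \sum_(m <- mpoly.msupp f)
    mpoly.mcoeff m f * \prod_(i < n) x t i ^+ mpoly.fun_of_multinom m i).
  apply: (regular_sum evD evM evC) => m.
  have h1 := @regular_const _ _ _ ev cst D g evC (mpoly.mcoeff m f).
  have h2 : regular ev D g (fun t => \prod_(i < n) x t i ^+ mpoly.fun_of_multinom m i).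
    apply: (regular_prod evM evC) => i.
    exact: (regular_exp evM evC (mpoly.fun_of_multinom m i) (hx i)).
  exact: (regularM evM h1 h2).
by apply: eq_regular h => t _; rewrite mpoly.mevalE.
Qed.

(** * Edges of the tropical plane *)

Section Extended.
Variable R : realType.
Local Notation C := R[i].

(** The exponents of the four monomials 1, x_1, x_2, x_3 of a linear equation,
    where x_i are the monomial coordinates given by A. *)
Definition homogenized (A : 'M[int]_3) : 'M[int]_(4, 3) :=
  \matrix_(j, k) if unlift ord0 j is Some j' then A j' k else 0.

Lemma homogenized0 A k : homogenized A 0 k = 0.
Proof. by rewrite mxE unlift_none. Qed.

Lemma homogenizedS A j k : homogenized A (lift ord0 j) k = A j k.
Proof. by rewrite mxE liftK. Qed.

Lemma homogenizedM0 n A (v : 'M_(3, n)) k : (homogenized A *m v) 0 k = 0.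
Proof. by rewrite mxE big1 // => j _; rewrite homogenized0 mul0r. Qed.

Lemma homogenizedMS n A (v : 'M_(3, n)) j k :
  (homogenized A *m v) (lift ord0 j) k = (A *m v) j k.
Proof. by rewrite !mxE; apply: eq_bigr => l _; rewrite homogenizedS. Qed.

Lemma homogenized_row_inj A p q : A \in unitmx ->
  row p (homogenized A) = row q (homogenized A) -> p = q.
Proof.
move=> hA E; apply: contraTeq isT => pq.
have E' : row p (homogenized A *m invmx A) = row q (homogenized A *m invmx A).
  by rewrite !row_mul E.
have key r k : (homogenized A *m invmx A) r k = (r == lift ord0 k)%:R.
  case: (unliftP ord0 r) => [j ->|->]; last by rewrite homogenizedM0 (negPf (neq_lift _ _)).
  by rewrite homogenizedMS mulmxV // mxE (inj_eq lift_inj).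
have E2 k : (p == lift ord0 k)%:R = (q == lift ord0 k)%:R :> int.
  by rewrite -!key; have /rowP/(_ k) := E'; rewrite !mxE.
case: (unliftP ord0 p) pq E2 => [j ->|->] pq E2.
  by have := E2 j; rewrite eqxx eq_sym (negPf pq).
case: (unliftP ord0 q) pq E2 => [j ->|->] pq E2; last by rewrite eqxx in pq.
by have := E2 j; rewrite eqxx (negPf pq).
Qed.

Lemma monomial_homogenized0 A (z : {ffun 'I_3 -> C}) : monomial_map (homogenized A) z 0 = 1.
Proof. by rewrite ffunE big1 // => k _; rewrite homogenized0 expr0z. Qed.

Lemma monomial_homogenizedS A (z : {ffun 'I_3 -> C}) j :
  monomial_map (homogenized A) z (lift ord0 j) = monomial_map A z j.
Proof. by rewrite !ffunE; apply: eq_bigr => k _; rewrite homogenizedS. Qed.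

Lemma linear_equation_homogenized (a : {ffun 'I_4 -> C}) A (z : {ffun 'I_3 -> C}) :
  a 0 + \sum_i a (lift ord0 i) * monomial_map A z i =
  \sum_j a j * monomial_map (homogenized A) z j.
Proof.
rewrite [RHS]big_ord_recl monomial_homogenized0 mulr1; congr (_ + _).
by apply: eq_bigr => j _; rewrite monomial_homogenizedS.
Qed.

(** If a_j = 0, the j-th coordinate point lies on the closure of the plane and on
    the three other boundary lines. *)
Lemma generic_boundary_coef (a : {ffun 'I_4 -> C}) j : generic_boundary a -> a j != 0.
Proof.
move=> [_ _ h3]; apply/eqP => aj.
pose x : {ffun 'I_4 -> C} := [ffun k => (k == j)%:R].
have hb k : boundary_line a (lift j k) x.
  split; [split|].
  - by apply/eqP => /ffunP/(_ j); rewrite !ffunE eqxx => /eqP; rewrite oner_eq0.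
  - rewrite (bigD1 j) //= aj mul0r add0r big1 // => l lj.
    by rewrite ffunE (negPf lj) mulr0.
  - by rewrite /= ffunE eq_sym (negPf (neq_lift _ _)).
have lneq k l : k != l -> lift j k != lift j l by rewrite (inj_eq lift_inj).
have [n01 n12 n02] : [/\ (0 : 'I_3) != 1, (1 : 'I_3) != 2%:R & (0 : 'I_3) != 2%:R] by [].
have := h3 _ _ _ (lneq _ _ n01) (lneq _ _ n12) (lneq _ _ n02).
by move=> /seteqP[+ _] => /(_ x); apply.
Qed.

(** The terms of a vanishing sum cannot have one of them exponentially larger
    than all the others. This is the half of the description of tropical
    hypersurfaces that holds by a direct estimate. *)
Lemma no_dominant_monomial (P : set {ffun 'I_3 -> C}) (a : {ffun 'I_4 -> C}) A x k (dl : R) :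
  P `<=` [set z | torus z /\ \sum_j a j * monomial_map (homogenized A) z j = 0] ->
  a k != 0 -> log_limsup P x -> 0 < dl ->
  (forall j, j != k -> \sum_i (homogenized A j i)%:~R * x i 0 + dl <=
     \sum_i (homogenized A k i)%:~R * x i 0) -> False.
Proof.
move=> hP ak hx dl0 hdom.
have PT : P `<=` @torus R 3 by move=> z /hP[].
pose S := \sum_j nm (a j).
have S0 : 0 <= S by apply: sumr_ge0 => j _; exact: nm_ge0.
have nk : 0 < nm (a k) by rewrite nm_gt0.
have e0 : 0 < dl / 4 by rewrite divr_gt0.
have [t [z [Tt Pz hz]]] :=
  @log_limsup_monomial _ _ _ (homogenized A) _ PT hx (dl / 4) (Num.max 1 (2 * S / (dl * nm (a k)))) e0.
have [zT Ez] := hP z Pz; set W := monomial_map _ z in hz Ez.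
have WT : torus W by exact: torus_monomial.
move: Tt; rewrite gt_max => /andP[t1 t2].
have hW j : j != k -> nm (W j) <= nm (W k) * expR (- (t * dl / 2)).
  move=> jk; rewrite -ler_ln ?posrE ?mulr_gt0 ?expR_gt0 ?nm_gt0 ?WT //.
  rewrite lnM ?posrE ?expR_gt0 ?nm_gt0 ?WT // expRK.
  have := hz j; have := hz k; rewrite !ler_norml => /andP[h1 _] /andP[_ h2].
  have := hdom j jk; set yj := \sum_i _; set yk := \sum_i _ => h3.
  rewrite -/yk in h1; rewrite -/yj in h2.
  have : t * (yj + dl) <= t * yk by rewrite ler_wpM2l //; lra.
  lra.
have hS : nm (a k) * nm (W k) <= S * (nm (W k) * expR (- (t * dl / 2))).
  have : a k * W k = - \sum_(j | j != k) a j * W j.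
    by move: Ez; rewrite (bigD1 k) //= => /eqP; rewrite addr_eq0 => /eqP.
  move=> /(congr1 (fun u => nm u)); rewrite nmM nmN => ->.
  apply: le_trans (nm_sum_le _ _ _) _.
  apply: le_trans (_ : \sum_(j | j != k) nm (a j) * (nm (W k) * expR (- (t * dl / 2))) <= _).
    by apply: ler_sum => j jk; rewrite nmM ler_wpM2l ?nm_ge0 // hW.
  rewrite -mulr_suml ler_wpM2r ?mulr_ge0 ?expR_ge0 ?nm_ge0 //.
  by rewrite /S [leRHS](bigD1 k) //= lerDr nm_ge0.
have Wk : 0 < nm (W k) by rewrite nm_gt0 WT.
rewrite mulrCA mulrC ler_pM2l // expRN ler_pdivlMr ?expR_gt0 // in hS.
have := expR_ge1Dx (t * dl / 2).
move: t2; rewrite ltr_pdivrMr ?mulr_gt0 // => t2 h1.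
have : nm (a k) * (1 + t * dl / 2) <= S by apply: le_trans hS; rewrite ler_wpM2l // ltW.
lra.
Qed.

End Extended.

Lemma fourth_index (p q r : 'I_4) : p != q -> p != r -> q != r ->
  exists s, forall j, j != s -> [|| j == p, j == q | j == r].
Proof.
move=> pq pr qr; pose S := (p |: (q |: [set r]))%SET.
have c3 : #|S| = 3 by rewrite /S !cardsU1 cards1 !inE negb_or pq pr qr.
have : #|~: S| == 1%N.
  by have := cardsC S; rewrite c3 card_ord => /eqP; rewrite -[4%N]/(3 + 1)%N eqn_add2l.
move=> /cards1P[s Es]; exists s => j js.
have : (j \in ~: S) = false by rewrite Es finset.in_set1 (negPf js).
by rewrite finset.in_setC => /negbFE; rewrite !finset.inE.
Qed.

(** An integral gap b < a is not closed by perturbations bounded by N, after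
    multiplication by 2 N + 1. *)
Lemma dominated_perturbation (a b c e : int) (N : nat) : `|c| <= N%:Z -> `|e| <= N%:Z ->
  b + 1 <= a -> a *+ (N + N).+1 + c <= b *+ (N + N).+1 + e -> False.
Proof.
move=> hc he hab.
have : (b + 1) *+ (N + N).+1 <= a *+ (N + N).+1 by rewrite lerMn2r hab orbT.
rewrite mulrnDl; move: (a *+ _) (b *+ _) => x y; rewrite natz; lia.
Qed.

(** The edges of the standard tropical plane: - e_(s-1) for s > 0, and (1, 1, 1)
    for s = 0. On the s-th edge the values of the exponents other than the s-th
    are equal. *)
Definition edge_dir (s : 'I_4) : 'cV[int]_3 := \col_k ((s == 0)%:R - (lift ord0 k == s)%:R).

(** At every point of Trop(P) the largest of the four exponents is attained
    twice. On the edge u_i let it be attained at p and q. If there were no third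
    index, then at all points close to u_i in the cones of u_i and u_l the
    maximum would still be attained at p and q only, so p and q would agree on
    all the u_l, which span the space: a contradiction. Hence three exponents
    agree and u_i is a multiple of an edge of the standard plane; it is that
    edge because u_i is primitive. *)
Lemma tropical_edges (R : realType) (P TropP : set _) (A : 'M[int]_3)
    (a : {ffun 'I_4 -> R[i]}) (u : 'I_4 -> 'cV[int]_3) :
  A \in unitmx -> (forall j, a j != 0) ->
  P = [set z | torus z /\ \sum_j a j * monomial_map (homogenized A) z j = 0] ->
  log_limit P TropP -> uniform_plane_fan TropP u ->
  forall i, exists s, A *m u i = edge_dir s.
Proof.
move=> hA ha EP [_ hlim] [hprim _ hbasis ET] i.
pose y l j := (homogenized A *m u l) j 0.
(* The maximum is attained twice at the points of the cone of u_i and u_l. *)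
have trop l m n p : i != l -> exists2 q, q != p &
    y i p *+ m + y l p *+ n <= y i q *+ m + y l q *+ n.
  move=> il; apply: contrapT => hq.
  pose x : 'cV[R]_3 := m%:R *: realv R (u i) + n%:R *: realv R (u l).
  have Tx : log_limsup P x.
    rewrite hlim ET; exists i, l; split=> //; exists m%:R, n%:R; split=> //; exact: ler0n.
  have Ey r : \sum_k (homogenized A r k)%:~R * x k 0 = (y i r *+ m + y l r *+ n)%:~R.
    rewrite /y !mxE -!sumrMnl -big_split rmorph_sum; apply: eq_bigr => k _ /=.
    rewrite /x !mxE rmorphD !rmorphMn !rmorphM /= mulrDr !mulr_natl.
    by rewrite !mulrnAr.
  apply: (@no_dominant_monomial R P a A x p 1) => //.
  - by move=> z; rewrite EP.
  - move=> j jp; rewrite !Ey -[1]/(1%:~R) -rmorphD ler_int lezD1.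
    by rewrite ltNge; apply/negP => h; apply: hq; exists j.
have other : exists l, i != l.
  by have [->|i0] := eqVneq i 0; [exists 1|exists 0].
pose p := [arg max_(p > (0 : 'I_4)) y i p]%O.
have hp r : y i r <= y i p.
  by rewrite /p; case: arg_maxP => // p' _ /(_ r isT).
have [q qp hq] : exists2 q, q != p & y i q = y i p.
  have [l il] := other; have [q qp hq] := trop l 1 0 p il.
  exists q => //; apply/eqP; rewrite eq_le hp /=.
  by move: hq; rewrite !mulr1n !mulr0n !addr0.
have [r [rp rq hr]] : exists r, [/\ r != p, r != q & y i r = y i p].
  apply: contrapT => hr.
  have lt r : r != p -> r != q -> y i r + 1 <= y i p.
    move=> rp rq; rewrite lezD1 lt_neqAle hp andbT.
    by apply/eqP => E; apply: hr; exists r.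
  have key l p1 q1 : i != l -> y i p1 = y i p -> y i q1 = y i p ->
      (forall r, r != p1 -> r != q1 -> y i r + 1 <= y i p) -> y l p1 <= y l q1.
    move=> il E1 E2 ltr; rewrite leNgt; apply/negP => h.
    (* The point (2 N + 1) u_i + u_l is close enough to u_i. *)
    pose N := (\sum_r `|y l r|%N)%N.
    have hN r : `|y l r| <= N%:Z.
      by rewrite -abszE lez_nat /N (bigD1 r) //= leq_addr.
    have [r rp1 hle] := trop l (N + N).+1 1 p1 il.
    rewrite !mulr1n E1 in hle.
    have [rq1|rq1] := eqVneq r q1; first by move: hle; rewrite rq1 E2; lia.
    exact: dominated_perturbation (hN p1) (hN r) (ltr r rp1 rq1) hle.
  have eqy l : y l p = y l q.
    have [<-|il] := eqVneq i l; first by rewrite hq.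
    apply/eqP; rewrite eq_le; apply/andP; split; apply: key => // r h1 h2; exact: lt.
  suff : p = q by move=> E; rewrite E eqxx in qp.
  apply: (homogenized_row_inj hA).
  pose U := \matrix_(k < 3, j < 3) u (lift ord0 j) k 0.
  have hU : U \in unitmx by exact: hbasis.
  apply: (can_inj (mulmxK hU)); apply/rowP => j; rewrite !mxE.
  have := eqy (lift ord0 j); rewrite /y !mxE => E.
  have rowE r : \sum_k row r (homogenized A) 0 k * U k j =
      \sum_k homogenized A r k * u (lift ord0 j) k 0.
    by apply: eq_bigr => k _; rewrite [row _ _ _ _]mxE [U _ _]mxE.
  by rewrite !rowE.
rewrite eq_sym in rp; rewrite eq_sym in rq; rewrite eq_sym in qp.
have [s hs] := fourth_index qp rp rq.
have hM j : j != s -> y i j = y i p.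
  by move=> /hs /or3P[] /eqP->.
pose c := y i p - y i s.
have y0 : y i 0 = 0 by rewrite /y homogenizedM0.
have Eu : A *m u i = c *: edge_dir s.
  apply/colP => k; rewrite [in RHS]mxE [edge_dir s k 0]mxE.
  have -> : (A *m u i) k 0 = y i (lift ord0 k) - y i 0.
    by rewrite y0 subr0 /y homogenizedMS.
  rewrite /c; have [E|ks] := eqVneq (lift ord0 k) s; have [E'|s0] := eqVneq s 0.
  - by move: (neq_lift ord0 k); rewrite E E' eqxx.
  - by rewrite E (hM 0) 1?eq_sym // mulr0n mulr1n sub0r mulrN1 opprB.
  - by rewrite (hM _ ks) E' mulr0n mulr1n subr0 mulr1.
  - by rewrite (hM _ ks) (hM 0) 1?eq_sym // mulr0n subr0 mulr0 subrr.
have c_ge0 : 0 <= c by rewrite /c subr_ge0.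
have Eu' : u i = c *: (invmx A *m edge_dir s).
  by rewrite scalemxAr -Eu mulKmx.
have [un0 uprim] := hprim i.
have cu := uprim _ _ Eu'.
exists s; rewrite Eu; suff -> : c = 1 by rewrite scale1r.
move: cu; rewrite qualifE /= => /orP[/eqP//|/eqP E]; move: c_ge0; by rewrite E.
Qed.

(** * Standard coordinates of the plane *)

Lemma avoid_two_indices (i j : 'I_4) : exists l, l != i /\ l != j.
Proof.
apply: contrapT => hl.
have h k : k = i \/ k = j.
  apply: contrapT => /not_orP[h1 h2]; apply: hl; exists k.
  by split; apply/eqP.
have [n01 n02 n12] : [/\ (0 : 'I_4) <> 1, (0 : 'I_4) <> 2%:R & (1 : 'I_4) <> 2%:R] by [].
by have [] := h 0; have [] := h 1; have [] := h 2%:R; congruence.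
Qed.

(** The matching sg between the u_i and the edges of the standard plane is a
    permutation of the four monomials of the equation. Division by the monomial
    of index sg 0 gives an equation of degree 1 in the coordinates dual to
    - u_1, - u_2, - u_3. *)
Lemma plane_normal_form (R : realType) (P TropP : set _) (u : 'I_4 -> 'cV[int]_3) :
  @uniform_plane R P -> log_limit P TropP -> uniform_plane_fan TropP u ->
  exists (F : 'M[int]_3) (e : {ffun 'I_4 -> R[i]}), [/\ F \in unitmx, forall j, e j != 0,
    forall i, F *m u (lift ord0 i) = - delta_mx i 0 &
    P = [set z | torus z /\
           e 0 + \sum_(i < 3) e (lift ord0 i) * monomial_map F z i = 0]].
Proof.
move=> [_ [A [a [[hA _ EP0] ga]]]] hlim hu.
have ha j : a j != 0 by exact: generic_boundary_coef.
have EP : P = [set z | torus z /\ \sum_j a j * monomial_map (homogenized A) z j = 0].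
  by rewrite EP0; apply/seteqP; split=> z [h1 h2]; split=> //;
     rewrite ?linear_equation_homogenized // -linear_equation_homogenized.
have [sg hsg] := choice (tropical_edges hA ha EP hlim hu).
have [hprim hsum hbasis _] := hu.
pose U := \matrix_(k < 3, j < 3) u (lift ord0 j) k 0.
have hU : U \in unitmx by exact: hbasis.
pose F := - invmx U.
have u_inj i j : u i = u j -> i = j.
  move=> E; apply: contrapT => /eqP ij.
  have [l [li lj]] := avoid_two_indices i j.
  rewrite eq_sym in li; rewrite eq_sym in lj.
  have [i' Ei'] : exists i', i = lift l i' by case: (unliftP l i) li => [i' ->|->] li; [exists i'|rewrite eqxx in li].
  have [j' Ej'] : exists j', j = lift l j' by case: (unliftP l j) lj => [j' ->|->] lj; [exists j'|rewrite eqxx in lj].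
  have := hbasis l; rewrite unitmxE -det_tr (@determinant_alternate _ _ _ i' j') ?unitr0 //.
    by apply: contra ij => /eqP E'; rewrite Ei' Ej' E'.
  by move=> k; rewrite !mxE -Ei' -Ej' E.
have sg_inj : injective sg.
  move=> i j E; apply: u_inj; apply: (can_inj (mulKmx hA)).
  by rewrite !hsg E.
have Fu i : F *m u (lift ord0 i) = - delta_mx i 0.
  have -> : u (lift ord0 i) = U *m delta_mx i 0.
    by rewrite -colE; apply/colP => k; rewrite !mxE.
  by rewrite /F mulNmx mulKmx.
have hF : F \in unitmx by rewrite /F unitmxE -scaleN1r detZ unitrM -!unitmxE unitmx_inv hU unitrX // unitrN1.
exists F, [ffun j => a (sg j)]; split=> //; first by move=> j; rewrite ffunE.
have hy i r : (homogenized A *m u i) r 0 = (sg i == 0)%:R - (r == sg i)%:R.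
  case: (unliftP ord0 r) => [k ->|->].
    by rewrite homogenizedMS hsg mxE.
  by rewrite homogenizedM0 [0 == _]eq_sym subrr.
have Erow i : row (sg (lift ord0 i)) (homogenized A) - row (sg 0) (homogenized A) = row i F.
  apply: (can_inj (mulmxK hU)); apply/rowP => j.
  have rowE r : (row r (homogenized A) *m U) 0 j = (homogenized A *m u (lift ord0 j)) r 0.
    by rewrite !mxE; apply: eq_bigr => k _; rewrite [row _ _ _ _]mxE [U _ _]mxE.
  rewrite mulmxBl mxE [(- _ : 'M_(_, _)) _ _]mxE !rowE !hy.
  rewrite (inj_eq sg_inj) (inj_eq sg_inj) (inj_eq lift_inj) (negPf (neq_lift _ _)).
  by rewrite -row_mul /F mulNmx mulVmx // !mxE mulr0n subr0 addrAC subrr sub0r.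
have EW z k0 : torus z -> monomial_map (homogenized A) z (sg (lift ord0 k0)) =
    monomial_map (homogenized A) z (sg 0) * monomial_map F z k0.
  move=> zT; rewrite !ffunE -big_split; apply: eq_bigr => k _ /=.
  rewrite -expfzDr //; congr (_ ^ _).
  by have /rowP/(_ k) := Erow k0; rewrite !mxE => <-; ring.
have key z : torus z -> \sum_j a j * monomial_map (homogenized A) z j =
    monomial_map (homogenized A) z (sg 0) * (a (sg 0) +
      \sum_(i < 3) a (sg (lift ord0 i)) * monomial_map F z i).
  move=> zT; rewrite (reindex_inj sg_inj) /= big_ord_recl mulrDr mulrC; congr (_ + _).
  rewrite mulr_sumr; apply: eq_bigr => i _; rewrite EW //; ring.
have Ea j : [ffun j => a (sg j)] j = a (sg j) by rewrite ffunE.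
rewrite EP; apply/seteqP; split=> z [zT hz]; split=> //.
  have := key z zT; rewrite hz => /esym/eqP; rewrite mulf_eq0.
  rewrite (negPf (torus_monomial (homogenized A) zT (sg 0))) /= => /eqP E; rewrite -[RHS]E.
  by rewrite Ea; congr (_ + _); apply: eq_bigr => i _; rewrite Ea.
rewrite (key z zT); apply/eqP; rewrite mulf_eq0; apply/orP; right; apply/eqP.
rewrite -[RHS]hz Ea; congr (_ + _); apply: eq_bigr => i _; by rewrite Ea.
Qed.

Definition mat3 (rows : seq (seq int)) : 'M[int]_3 :=
  \matrix_(i, j) nth 0 (nth [::] rows i) j.

Definition vec3 (a b c : int) : 'cV[int]_3 := \col_i nth 0 [:: a; b; c] i.

Lemma ord3_ind (Q : 'I_3 -> Prop) : Q 0 -> Q 1 -> Q 2%:R -> forall i, Q i.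
Proof.
move=> h0 h1 h2 [[|[|[|//]]] hi].
- by rewrite (_ : Ordinal hi = 0) //; exact: val_inj.
- by rewrite (_ : Ordinal hi = 1) //; exact: val_inj.
- by rewrite (_ : Ordinal hi = 2%:R) //; exact: val_inj.
Qed.

Lemma sum3 (V : nmodType) (f : 'I_3 -> V) : \sum_i f i = f 0 + f 1 + f 2%:R.
Proof.
rewrite !big_ord_recl big_ord0 addr0 addrA; congr (_ + f _ + f _); exact: val_inj.
Qed.

Lemma prod3 (C : comNzRingType) (f : 'I_3 -> C) : \prod_i f i = f 0 * f 1 * f 2%:R.
Proof.
rewrite !big_ord_recl big_ord0 mulr1 mulrA; congr (_ * f _ * f _); exact: val_inj.
Qed.

(** The exponents of S, Y, W, which are z3, z3^n z1 and z3^n z2. *)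
Definition offset_mx (n : nat) : 'M[int]_3 :=
  mat3 [:: [:: 0; 0; 1]; [:: 1; 0; n%:Z]; [:: 0; 1; n%:Z]].

Lemma offset_mx_unit n : offset_mx n \in unitmx.
Proof.
suff : offset_mx n *m mat3 [:: [:: - n%:Z; 1; 0]; [:: - n%:Z; 0; 1]; [:: 1; 0; 0]] = 1%:M.
  by move=> /mulmx1_unit[].
apply/matrixP; elim/ord3_ind; elim/ord3_ind; rewrite !mxE sum3 !mxE /=; ring.
Qed.

(** The equation of [plane_normal_form], multiplied by the n-th power of the third
    monomial; the scaling factors ka make all the coefficients equal to 1. *)
Theorem standard_coordinates (R : realType) (P TropP : set _) (u : 'I_4 -> 'cV[int]_3)
    (n : nat) :
  @uniform_plane R P -> log_limit P TropP -> uniform_plane_fan TropP u ->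
  exists (N : 'M[int]_3) (ka : {ffun 'I_3 -> R[i]}), [/\ N \in unitmx, torus ka,
    [/\ N *m (u 1 + u 2 *+ n) = vec3 0 (-1) (- n%:Z),
        N *m (u 1 *+ n + u 0) = vec3 1 1 n.+1%:Z,
        N *m (u 3 *+ n.+1 + u 0 *+ n) = vec3 (-1) 0 0 &
        N *m u 2 = vec3 0 0 (-1)] &
    P = [set z | torus z /\ ka 2%:R * monomial_map N z 2%:R =
           third n (ka 0 * monomial_map N z 0) (ka 1 * monomial_map N z 1)]].
Proof.
move=> hP hlim hu; have [F [e [hF he Fu EP]]] := plane_normal_form hP hlim hu.
have [_ hsum _ _] := hu.
have E1 : (1 : 'I_4) = lift ord0 (0 : 'I_3) by exact: val_inj.
have E2 : (2%:R : 'I_4) = lift ord0 (1 : 'I_3) by exact: val_inj.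
have E3 : (3%:R : 'I_4) = lift ord0 (2%:R : 'I_3) by exact: val_inj.
have Fu1 : F *m u 1 = vec3 (-1) 0 0.
  by rewrite E1 Fu; apply/colP; elim/ord3_ind; rewrite !mxE.
have Fu2 : F *m u 2 = vec3 0 (-1) 0.
  by rewrite E2 Fu; apply/colP; elim/ord3_ind; rewrite !mxE.
have Fu3 : F *m u 3 = vec3 0 0 (-1).
  by rewrite E3 Fu; apply/colP; elim/ord3_ind; rewrite !mxE.
have Fu0 : F *m u 0 = vec3 1 1 1.
  have : u 0 = - (u 1 + u 2 + u 3).
    move: hsum; rewrite big_ord_recl sum3 -E1 -E2 -E3 => /eqP.
    by rewrite addr_eq0 => /eqP.
  move=> ->; rewrite mulmxN !mulmxDr Fu1 Fu2 Fu3.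
  by apply/colP; elim/ord3_ind; rewrite !mxE.
have e0 := he 0.
pose k0 := e 3 / e 0; have k00 : k0 != 0 by rewrite mulf_neq0 ?invr_eq0 // he.
pose ka : {ffun 'I_3 -> R[i]} := [ffun i : 'I_3 => nth 0 [:: k0; k0 ^+ n * (e 1 / e 0); k0 ^+ n * (e 2 / e 0)] i].
exists (offset_mx n *m F), ka; split.
- by rewrite unitmx_mul offset_mx_unit.
- have h k : e k / e 0 != 0 by rewrite mulf_neq0 ?invr_eq0 ?he.
  by elim/ord3_ind; rewrite ffunE //= mulf_neq0 ?h // expf_neq0.
- have FM v k : F *m (v *+ k) = k%:Z *: (F *m v) by rewrite scalemxAr -scaler_nat natz.
  rewrite -!mulmxA !mulmxDr !FM Fu0 Fu1 Fu2 Fu3.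
  by split; apply/colP; elim/ord3_ind; rewrite !mxE !sum3 !mxE /= ?intS; ring.
have key z : torus z -> let m := monomial_map (offset_mx n *m F) z in
    ka 2%:R * m 2%:R - third n (ka 0 * m 0) (ka 1 * m 1) =
    (ka 0 * m 0) ^+ n / e 0 *
      (e 0 + \sum_(i < 3) e (lift ord0 i) * monomial_map F z i).
  move=> zT m; rewrite /m monomial_mapM // sum3 -E1 -E2 -E3.
  move: (monomial_map F z) (torus_monomial F zT) => q qT.
  rewrite /third /offset hornerD !hornerXn !(ffunE, prod3) !mxE /=.
  rewrite !expr0z !expr1z !mul1r !mulr1 -!exprnP exprS !exprMn.
  rewrite /k0; field.
  exact: e0.
have S0 z : torus z -> (ka 0 * monomial_map (offset_mx n *m F) z 0) ^+ n / e 0 != 0.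
  move=> zT; rewrite mulf_neq0 ?invr_eq0 // expf_neq0 // mulf_neq0 //.
    by rewrite ffunE.
  exact: torus_monomial.
rewrite EP; apply/seteqP; split=> z [zT hz]; split=> //.
  by apply/eqP; rewrite -subr_eq0 key // hz mulr0.
apply/eqP; have := key z zT; rewrite /= hz subrr => /esym/eqP.
by rewrite mulf_eq0 (negPf (S0 z zT)).
Qed.

(** * Closed sets and pullbacks to the surface *)

Lemma zariski_closedU (R : realType) (X Y : set {ffun 'I_3 -> R[i]}) :
  zariski_closed X -> zariski_closed Y -> zariski_closed (X `|` Y).
Proof.
move=> [S ->] [T ->]; exists [set h : mpoly.mpoly 3 R[i] | exists f g, [/\ S f, T g & h = (f * g)%R]].
apply/seteqP; split=> [z [[zT h]|[zT h]]|z [zT h]].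
- by split=> // _ [f [g [Sf Tg ->]]]; rewrite mpoly.mevalM h // mul0r.
- by split=> // _ [f [g [Sf Tg ->]]]; rewrite mpoly.mevalM [X in _ * X]h // mulr0.
have [hS|/existsNP[f /not_implyP[Sf /eqP fz]]] :=
  pselect (forall f, S f -> mpoly.meval z f = 0); first by left.
right; split=> // g Tg; have := h (f * g); rewrite mpoly.mevalM => /(_ _)/eqP.
by rewrite mulf_eq0 (negPf fz) /= => E; apply/eqP/E; exists f, g.
Qed.

Lemma algebraic_curve_closed (R : realType) (X : set {ffun 'I_3 -> R[i]}) :
  algebraic_curve X -> zariski_closed X.
Proof.
move=> [n [Y [hY ->]]]; have {hY} : forall i, zariski_closed (Y i).
  by move=> i; have [[]] := hY i.
elim: n Y => [|n IH] Y hY.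
  rewrite (_ : \bigcup_i Y i = Y ord0) //; apply/seteqP; split=> [z [i _]|z Yz].
    by rewrite ord1.
  by exists ord0.
rewrite (_ : \bigcup_i Y i = Y ord0 `|` \bigcup_i Y (lift ord0 i)).
  by apply: zariski_closedU; [exact: hY|apply: IH => i; exact: hY].
apply/seteqP; split=> [z [i _]|z].
  by case: (unliftP ord0 i) => [j ->|->] h; [right; exists j|left].
by move=> [h|[j _ h]]; [exists ord0|exists (lift ord0 j)].
Qed.

Lemma poly_eq_off_zero (R : realType) (p q : {poly R[i]}) :
  (forall y, y != 0 -> p.[y] = q.[y]) -> p = q.
Proof.
move=> h; apply/eqP; rewrite -subr_eq0; apply: contraT => pq.
have [dl dl0 hd] := poly_isolated 0 pq.
pose y : R[i] := real_complex R (dl / 2).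
have ny : nm y = dl / 2 by rewrite nm_real gtr0_norm // divr_gt0.
have y0 : y != 0 by rewrite -nm_gt0 ny divr_gt0.
have := hd y y0; rewrite subr0 ny => /(_ _)/negP; case; first lra.
by rewrite hornerD hornerN h // subrr.
Qed.

Section Coordinates.
Variables (R : realType) (n : nat).
Local Notation C := R[i].
Local Notation point := {ffun 'I_3 -> R[i]}.

(** The parametrization of the plane by (S, Y) in standard coordinates. *)
Definition surface_point (S Y : C) : point :=
  [ffun i : 'I_3 => nth 0 [:: S; Y; third n S Y] i].

Lemma surface_point_torus S Y : S != 0 -> Y != 0 -> third n S Y != 0 ->
  torus (surface_point S Y).
Proof. by move=> h0 h1 h2; elim/ord3_ind; rewrite ffunE. Qed.

Definition third_poly : {poly {poly C}} := - ('X + (offset R n)%:P).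

Lemma ev_third S Y : ev third_poly S Y = third n S Y.
Proof. by rewrite /ev /third_poly hornerN hornerD hornerX hornerC hornerN hornerD hornerC. Qed.

Let evT (t : C * C) (F : {poly {poly C}}) : C := ev F t.1 t.2.
Let cst (c : C) : {poly {poly C}} := c%:P%:P.
Let evTD t : {morph evT t : x y / x + y}. Proof. by move=> x y; exact: evD. Qed.
Let evTM t : {morph evT t : x y / x * y}. Proof. by move=> x y; exact: evM. Qed.
Let evTC t c : evT t (cst c) = c. Proof. by rewrite /evT /cst evC hornerC. Qed.

Lemma surface_point_regular (D : C * C -> Prop) g i :
  regular evT D g (fun t => surface_point t.1 t.2 i).
Proof.
elim/ord3_ind: i.
- apply: eq_regular (regular_ev evT D g 'X%:P) => t _.
  by rewrite /evT evC hornerX ffunE.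
- apply: eq_regular (regular_ev evT D g 'X) => t _.
  by rewrite /evT /ev hornerX hornerC ffunE.
- apply: eq_regular (regular_ev evT D g third_poly) => t _.
  by rewrite /evT ev_third ffunE.
Qed.

Lemma monomial_regular (D : C * C -> Prop) g (K : 'M[int]_3) (c : point) i :
  (forall j, K i j < 0 -> regular evT D g (fun t => (surface_point t.1 t.2 j)^-1)) ->
  regular evT D g (fun t => c i * monomial_map K (surface_point t.1 t.2) i).
Proof.
move=> hK; apply: (regularM evTM (regular_const _ _ evTC (c i))).
suff : regular evT D g (fun t => \prod_j surface_point t.1 t.2 j ^ K i j).
  by apply: eq_regular => t _; rewrite ffunE.
apply: (regular_prod evTM evTC) => j; have r := surface_point_regular D g j.
have := hK j; case: (K i j) => k hk.
  by apply: eq_regular (regular_exp evTM evTC k r).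
by apply: eq_regular (regular_exp evTM evTC k.+1 (hk isT)) => t _; rewrite NegzE -exprnN exprVn.
Qed.

(** Restricted to the surface and written in (S, Y), a polynomial in other
    monomial coordinates becomes polynomial after multiplication by a power of
    S Y W. No power of S is needed if S has no negative exponent, and the
    restriction then extends to the divisor S = 0 ([pullback_chart]). *)
Lemma pullback_torus (K : 'M[int]_3) (c : point) (f : mpoly.mpoly 3 C) :
  exists F k, forall S Y, S != 0 -> Y != 0 -> third n S Y != 0 ->
    ev F S Y = (S * Y * third n S Y) ^+ k *
      mpoly.meval (fun i => c i * monomial_map K (surface_point S Y) i) f.
Proof.
pose D (t : C * C) := [/\ t.1 != 0, t.2 != 0 & third n t.1 t.2 != 0].
pose g : {poly {poly C}} := 'X%:P * 'X * third_poly.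
have Eg t : evT t g = t.1 * t.2 * third n t.1 t.2.
  by rewrite /evT /g !evM ev_third evC hornerX {1}/ev hornerX hornerC.
have g0 t : D t -> evT t g != 0 by move=> [h0 h1 h2]; rewrite Eg !mulf_neq0.
have [F [k h]] : regular evT D g (fun t => mpoly.meval
    (fun i => c i * monomial_map K (surface_point t.1 t.2) i) f).
  apply: (regular_meval _ evTD evTM evTC) => i; apply: monomial_regular => j _.
  elim/ord3_ind: j.
  - apply: (@regular_inv _ _ _ evT D g g0 (fun t => surface_point t.1 t.2 0) ('X * third_poly)) => t _.
    by rewrite Eg /evT evM ev_third {1}/ev hornerX hornerC ffunE /=; ring.
  - apply: (@regular_inv _ _ _ evT D g g0 (fun t => surface_point t.1 t.2 1) ('X%:P * third_poly)) => t _.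
    by rewrite Eg /evT evM ev_third evC hornerX ffunE /=; ring.
  - apply: (@regular_inv _ _ _ evT D g g0 (fun t => surface_point t.1 t.2 2%:R) ('X%:P * 'X)) => t _.
    by rewrite Eg /evT evM evC hornerX {1}/ev hornerX hornerC ffunE /=; ring.
exists F, k => S Y h0 h1 h2; by have := h (S, Y) (And3 h0 h1 h2); rewrite Eg.
Qed.

Lemma pullback_chart (K : 'M[int]_3) (c : point) (f : mpoly.mpoly 3 C) :
  (forall i, 0 <= K i 0) ->
  exists F k, forall S Y, Y != 0 -> third n S Y != 0 ->
    ev F S Y = (Y * third n S Y) ^+ k *
      mpoly.meval (fun i => c i * monomial_map K (surface_point S Y) i) f.
Proof.
move=> hK; pose D (t : C * C) := t.2 != 0 /\ third n t.1 t.2 != 0.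
pose g : {poly {poly C}} := 'X * third_poly.
have Eg t : evT t g = t.2 * third n t.1 t.2.
  by rewrite /evT /g !evM ev_third {1}/ev hornerX hornerC.
have g0 t : D t -> evT t g != 0 by move=> [h1 h2]; rewrite Eg !mulf_neq0.
have [F [k h]] : regular evT D g (fun t => mpoly.meval
    (fun i => c i * monomial_map K (surface_point t.1 t.2) i) f).
  apply: (regular_meval _ evTD evTM evTC) => i; apply: monomial_regular => j.
  elim/ord3_ind: j => hj.
  - by have := hK i; rewrite leNgt hj.
  - apply: (@regular_inv _ _ _ evT D g g0 (fun t => surface_point t.1 t.2 1) third_poly) => t _.
    by rewrite Eg /evT ev_third ffunE /=; ring.
  - apply: (@regular_inv _ _ _ evT D g g0 (fun t => surface_point t.1 t.2 2%:R) 'X) => t _.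
    by rewrite Eg /evT /ev hornerX hornerC ffunE.
exists F, k => S Y h1 h2; by have := h (S, Y) (conj h1 h2); rewrite Eg.
Qed.

End Coordinates.

(** * The trace of a space curve on the coordinate plane *)

Lemma clear_denominators1 (F : fieldType) (c a b n d : F) : b != 0 -> d != 0 ->
  1 - c * (a / b) = n / d -> d * b - c * d * a = b * n.
Proof.
move=> b0 d0 E; have -> : n = (1 - c * (a / b)) * d by rewrite E divfK.
by field.
Qed.

Lemma clear_denominators2 (F : fieldType) (f g c a b n d : F) : g != 0 -> b != 0 -> d != 0 ->
  f / g - c * (a / b) = n / d -> f * b * d - c * a * g * d = g * b * n.
Proof.
move=> g0 b0 d0 E; have -> : n = (f / g - c * (a / b)) * d by rewrite E divfK.
by field; apply/andP.
Qed.

Lemma scaled_identity1 (F : fieldType) (t g b c a n : F) :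
  g * b - c * g * a = b * n ->
  t * g * (t * b) - c * (t * g) * (t * a) = t * b * (t * n).
Proof.
by move=> E; transitivity (t * t * (g * b - c * g * a)); [ring|rewrite E; ring].
Qed.

Lemma scaled_identity2 (F : fieldType) (t g k b d c a n : F) : g != 0 ->
  k * g * b * d - c * a * g * d = g * b * n ->
  k * (t * b) * (t * d) - c * (t * a) * (t * d) = t * b * (t * n).
Proof.
move=> g0 E; apply: (mulfI g0).
by transitivity (t * t * (k * g * b * d - c * a * g * d)); [ring|rewrite E; ring].
Qed.

Lemma unit_sum (T : eqType) (s : seq T) (m : T -> nat) p1 p2 : uniq s ->
  p1 \in s -> p2 \in s -> (forall p, p \in s -> (0 < m p)%N) ->
  1%N = (\sum_(p <- s) m p)%N -> p2 = p1 /\ m p1 = 1%N.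
Proof.
move=> us s1 s2 m_gt0; rewrite (bigD1_seq p1) //= => hw.
have g1 := m_gt0 _ s1; split; last by lia.
apply/eqP; apply: contraT => p21; have g2 := m_gt0 _ s2.
by move: hw; rewrite -big_filter (bigD1_seq p2) /= ?filter_uniq ?mem_filter ?p21 //; lia.
Qed.

Lemma leq_sum6 (a b c d e f : nat) (M := (a + b + c + d + e + f)%N) :
  [/\ a <= M, b <= M & c <= M]%N /\ [/\ d <= M, e <= M & f <= M]%N.
Proof. by rewrite /M; do 2!split; lia. Qed.

(** The class of 1 is nonzero in the quotient of the local ring, because the ideal
    vanishes at p. *)
Lemma multiplicity_gt0 (R : realType) (Y : set {ffun 'I_3 -> R[i]}) p m :
  divisor_points Y p -> intersection_multiplicity Y p m -> (0 < m)%N.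
Proof.
move=> [p0 _ _ hp] [b [hb hx]]; case: m b hb hx => // b hb hx.
have l1 : local_ring p 1 by exists 1, 1; rewrite meval1 oner_neq0 tofrac1 divr1.
have [c [[f [h [g [vf g0 E]]]] _]] := hx _ l1.
have gn : g != 0 by apply: contraNneq g0 => ->; rewrite meval0.
rewrite big_ord0 subr0 in E.
have : g = f + h * mpolyX R[i] (mnm1 0).
  apply/eqP; rewrite -tofrac_eq; apply/eqP.
  by rewrite -[RHS](@divfK _ (tofrac g)) ?tofrac_eq0 // -E mul1r.
move=> /(congr1 (meval p)); rewrite mevalD mevalM mevalXU p0 mulr0 addr0 (hp f vf) => E0.
by rewrite E0 eqxx in g0.
Qed.

Section Transfer.
Variables (R : realType) (n : nat).
Local Notation C := R[i].
Local Notation point := {ffun 'I_3 -> R[i]}.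
Variables (N : 'M[int]_3) (ka : point) (P X : set point).
Hypothesis N_unit : N \in unitmx.
Hypothesis ka_torus : torus ka.
Hypothesis P_eq : P = [set z | torus z /\ ka 2%:R * monomial_map N z 2%:R =
           third n (ka 0 * monomial_map N z 0) (ka 1 * monomial_map N z 1)].
Hypothesis X_sub : X `<=` P.

Definition coords (z : point) : point := [ffun i => ka i * monomial_map N z i].

Definition ka_inv : point := [ffun i => (ka i)^-1].

Definition from_coords (x : point) : point :=
  monomial_map (invmx N) [ffun i => ka_inv i * x i].

Lemma ka_inv_torus : torus ka_inv.
Proof. by move=> i; rewrite ffunE invr_eq0. Qed.

Lemma coordsE z i : coords z i = ka i * monomial_map N z i.
Proof. exact: ffunE. Qed.

Lemma coords_torus z : torus z -> torus (coords z).
Proof. by move=> zT i; rewrite ffunE mulf_neq0 //; exact: torus_monomial. Qed.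

Lemma scale_torus (c x : point) : torus c -> torus x -> torus [ffun i => c i * x i].
Proof. by move=> h1 h2 i; rewrite ffunE mulf_neq0. Qed.

Lemma ka_inv_coords z : [ffun i => ka_inv i * coords z i] = monomial_map N z.
Proof. by apply/ffunP => i; rewrite 3!ffunE mulKf. Qed.

Lemma coordsK z : torus z -> from_coords (coords z) = z.
Proof. by move=> zT; rewrite /from_coords ka_inv_coords monomial_mapK. Qed.

Lemma from_coordsK x : torus x -> coords (from_coords x) = x.
Proof.
move=> xT; apply/ffunP => i; rewrite ffunE monomial_mapKV //.
  by rewrite !ffunE mulrA mulfV // mul1r.
exact: scale_torus ka_inv_torus xT.
Qed.

Lemma from_coords_torus x : torus x -> torus (from_coords x).
Proof. by move=> xT; apply/torus_monomial/scale_torus => //; exact: ka_inv_torus. Qed.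

Lemma coords_plane z : P z -> coords z = surface_point n (coords z 0) (coords z 1).
Proof.
rewrite P_eq => -[zT E]; apply/ffunP; elim/ord3_ind; rewrite [RHS]ffunE //=.
by rewrite !coordsE E.
Qed.

Lemma plane_torus z : P z -> torus z. Proof. by rewrite P_eq => -[]. Qed.

Lemma X_torus_sub : X `<=` @torus R 3.
Proof. by move=> z /X_sub/plane_torus. Qed.

(** The projection of X to the plane of (S, Y), which is injective on P. *)
Definition trace (S Y : C) : Prop := exists2 z, X z & coords z = surface_point n S Y.

Lemma trace_coords z : X z -> trace (coords z 0) (coords z 1).
Proof. by move=> Xz; exists z => //; apply/coords_plane/X_sub. Qed.

Lemma trace_torus S Y : trace S Y -> [/\ S != 0, Y != 0 & third n S Y != 0].
Proof.
move=> [z Xz E]; have := coords_torus (X_torus_sub Xz); rewrite E => T.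
by have := T 0; have := T 1; have := T 2%:R; rewrite !ffunE.
Qed.

Lemma trace_closed S Y : zariski_closed X -> S != 0 -> Y != 0 -> third n S Y != 0 ->
  (forall F : {poly {poly C}}, vanishes trace F -> ev F S Y = 0) -> trace S Y.
Proof.
move=> [E EX] S0 Y0 W0 hF; have T := surface_point_torus S0 Y0 W0.
exists (from_coords (surface_point n S Y)); last by rewrite from_coordsK.
rewrite EX; split=> [|f Ef]; first exact: from_coords_torus.
have [F [k h]] := pullback_torus n (invmx N) (monomial_map (invmx N) ka_inv) f.
have ef S' Y' : meval (from_coords (surface_point n S' Y')) f =
    meval (fun i => monomial_map (invmx N) ka_inv i * monomial_map (invmx N) (surface_point n S' Y') i) f.
  by apply: meval_eq => i; rewrite /from_coords monomial_map_scale.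
have vF : vanishes trace F.
  move=> S' Y' tr; have [z Xz Ez] := tr; have [h0 h1 h2] := trace_torus tr.
  rewrite h // -ef -Ez coordsK; last exact: X_torus_sub.
  by move: Xz; rewrite EX => -[_ /(_ f Ef) ->]; rewrite mulr0.
have := hF F vF; rewrite h // -ef => /eqP.
by rewrite mulf_eq0 expf_eq0 !mulf_eq0 (negPf S0) (negPf Y0) (negPf W0) andbF => /eqP.
Qed.

Lemma lg_coords z i : torus z -> lg (coords z i) = lg (ka i) + lg (monomial_map N z i).
Proof. by move=> zT; rewrite ffunE lgM //; exact: torus_monomial. Qed.

Lemma trace_asymptotic p0 p1 p2 : asymptotic_direction (log_image n trace) p0 p1 p2 ->
  exists2 x, log_limsup X x & forall i,
    \sum_j (N i j)%:~R * x j 0 = nth 0 [:: p0; p1; p2] i.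
Proof.
move=> hp; pose y : 'cV[R]_3 := \col_i nth 0 [:: p0; p1; p2] i.
exists (map_mx intr (invmx N) *m y); last first.
  move=> i; have : (map_mx intr N *m (map_mx intr (invmx N) *m y)) i 0 = y i 0.
    by rewrite mulmxA -map_mxM mulmxV // map_mx1 mul1mx.
  by rewrite [RHS]mxE => <-; rewrite [RHS]mxE; apply: eq_bigr => j _; rewrite [map_mx _ N _ _]mxE.
apply: (log_limsup_of_monomial X_torus_sub N_unit) => e T e0.
pose M := \sum_i `|lg (ka i)|.
have hM i : `|lg (ka i)| <= M by rewrite /M (bigD1 i) //= lerDl sumr_ge0.
have M0 : 0 <= M by rewrite sumr_ge0.
have [t [a [b [g [Tt [S [Y [tr -> -> ->]]] h0 h1 h2]]]]] :=
  hp (e / 2) (Num.max T (2 * M / e)) (divr_gt0 e0 (ltr0n _ 2)).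
move: Tt; rewrite gt_max ltr_pdivrMr // => /andP[Tt Mt].
have [z Xz Ez] := tr; exists t, z; split=> // i.
have zT := X_torus_sub Xz.
have E : lg (monomial_map N z i) = lg (coords z i) - lg (ka i).
  by rewrite lg_coords // addrC addKr.
rewrite E mxE; suff h : `|lg (coords z i) - t * nth 0 [:: p0; p1; p2] i| <= e / 2 * t.
  have := hM i; move: h; rewrite !ler_norml => /andP[k1 k2] /andP[k3 k4].
  by apply/andP; split; lra.
by rewrite Ez; elim/ord3_ind: i {E}; rewrite ffunE.
Qed.

(** Along a direction whose first coordinate is -1, S tends to 0. *)
Lemma trace_near_zero : (exists2 x, log_limsup X x &
    \sum_j (N 0 j)%:~R * x j 0 = -1 :> R) ->
  forall e : R, 0 < e -> exists S Y, trace S Y /\ nm S < e.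
Proof.
move=> [x hx Ex] e e0.
have h2 : 0 < 1 / 2 :> R by rewrite divr_gt0.
have [t [z [Tt Xz hz]]] := @log_limsup_monomial _ _ _ N _ X_torus_sub hx (1 / 2) (2 * (lg (ka 0) - ln e)) h2.
exists (coords z 0), (coords z 1); split; first exact: trace_coords.
have zT := X_torus_sub Xz.
rewrite -ltr_ln ?posrE ?nm_gt0 ?coords_torus // lg_coords //.
by have := hz 0; rewrite Ex ler_norml => /andP[_]; lra.
Qed.

Section Weight.
Variables (v : 'cV[int]_3) (B : 'M[int]_3).
Hypothesis n_gt0 : (0 < n)%N.
Hypothesis Nv : N *m v = vec3 (-1) 0 0.
Hypothesis B_unit : B \in unitmx.
Hypothesis Bv : B *m v = - delta_mx 0 0.

Let K := B *m invmx N.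
(* B is any chart of the divisor of v; in terms of the standard coordinates it
   is c times the monomial map of K. *)
Let c : point := monomial_map K ka_inv.
Let chart S Y : point := [ffun i => c i * monomial_map K (surface_point n S Y) i].
(* The divisor S = 0 of the surface, with Y = r as parameter and W = - r. *)
Let boundary r := chart 0 r.
Let X' := monomial_map B @` X.

Lemma chart_matrix_col i : K i 0 = (i == 0)%:R.
Proof.
have : K *m (N *m v) = B *m v by rewrite /K mulmxA mulmxKV.
rewrite Nv Bv => /colP/(_ i); rewrite !mxE sum3 !mxE /= !mulr0 !addr0 mulrN1.
by move=> /oppr_inj ->; rewrite andbT.
Qed.

Lemma c_torus : torus c. Proof. exact/torus_monomial/ka_inv_torus. Qed.

Lemma chartE S Y i : chart S Y i = c i * monomial_map K (surface_point n S Y) i.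
Proof. exact: ffunE. Qed.

Lemma chart_trace S Y : trace S Y -> X' (chart S Y).
Proof.
move=> [z Xz Ez]; exists z => //; have zT := X_torus_sub Xz.
have -> : B = K *m N by rewrite /K mulmxKV.
rewrite monomial_mapM // -(ka_inv_coords z) Ez; apply/ffunP => i.
by rewrite monomial_map_scale chartE.
Qed.

Lemma third_zero (r : C) : third n 0 r = - r.
Proof.
by rewrite /third /offset hornerD !hornerXn expr0n gtn_eqF // expr0n !addr0.
Qed.

Lemma boundaryE r i : boundary r i = c i * (0 ^ K i 0 * r ^ K i 1 * (- r) ^ K i 2%:R).
Proof.
rewrite /boundary chartE; congr (_ * _).
by rewrite [LHS]ffunE prod3 !(ffunE _ (_ : 'I_3)) /= third_zero.
Qed.

Lemma boundary0 r : boundary r 0 = 0.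
Proof. by rewrite boundaryE chart_matrix_col eqxx expr1z !mul0r mulr0. Qed.

Lemma boundary_neq0 r i : r != 0 -> i != 0 -> boundary r i != 0.
Proof.
move=> r0 i0; rewrite boundaryE chart_matrix_col (negPf i0) expr0z mul1r.
by rewrite !mulf_neq0 ?c_torus // expfz_neq0 // oppr_eq0.
Qed.

(** The equations of the closure of X in the chart restrict on the divisor to the
    equations of the trace with S = 0, up to a power of the parameter. *)
Lemma pullback_boundary f : exists (q : {poly {poly C}}) k,
  [/\ forall y, y != 0 -> (fiber 0 q).[y] = y ^+ k * meval (boundary y) f &
      vanishing_ideal X' f -> vanishes trace q].
Proof.
have K0 i : 0 <= K i 0 by rewrite chart_matrix_col ler0n.
have [F [k h]] := pullback_chart n c f K0.
have ef S Y : meval (fun i => c i * monomial_map K (surface_point n S Y) i) f = meval (chart S Y) f.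
  by apply: meval_eq => i; rewrite chartE.
exists ((-1) ^+ k *: F), (k + k)%N; split=> [y y0|vf S Y tr].
  rewrite -evE evZ horner_exp hornerN hornerC h ?third_zero ?oppr_eq0 // ef.
  by rewrite -/(boundary y) mulrA -exprMn mulrN mulN1r opprK exprMn exprD.
have [h0 h1 h2] := trace_torus tr.
by rewrite evZ h // ef vf ?mulr0 //; exact: chart_trace.
Qed.

(** The parameter of the divisor is a quotient of two monomials in the
    coordinates of the chart, because the change of chart is invertible. The
    fraction f / g is that parameter times a constant. *)
Lemma boundary_parameter : exists (f g : mpoly 3 C) (k : C), [/\ k != 0,
  forall r, r != 0 -> meval (boundary r) g != 0 &
  forall r, r != 0 -> meval (boundary r) f = k * r * meval (boundary r) g].
Proof.
pose L := N *m invmx B.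
have LK : L *m K = 1%:M by rewrite /L /K mulmxA mulmxKV // mulmxV.
have L0 i : L i 0 = (i == 0)%:R.
  have : - col 0 L = vec3 (-1) 0 0 by rewrite colE -mulmxN -Bv mulmxA mulmxKV.
  move=> /colP/(_ i); rewrite mxE [col _ _ _ _]mxE mxE => /eqP.
  by rewrite eqr_oppLR => /eqP ->; rewrite mxE; elim/ord3_ind: i.
have E1 : L 1 1 * K 1 1 + L 1 2%:R * K 2%:R 1 = 1.
  have /matrixP/(_ 1 1) := LK; rewrite mxE sum3 L0 mul0r add0r => ->; by rewrite mxE.
have E2 : L 1 1 * K 1 2%:R + L 1 2%:R * K 2%:R 2%:R = 0.
  have /matrixP/(_ 1 2%:R) := LK; rewrite mxE sum3 L0 mul0r add0r => ->; by rewrite mxE.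
pose num (a : int) i : mpoly 3 C := if 0 <= a then mpolyX C (mnm1 i) ^+ `|a| else 1.
pose den (a : int) i : mpoly 3 C := if 0 <= a then 1 else mpolyX C (mnm1 i) ^+ `|a|.
have hden a i r : r != 0 -> i != 0 -> meval (boundary r) (den a i) != 0.
  move=> r0 i0; rewrite /den; case: ifP => _; first by rewrite meval1 oner_neq0.
  by rewrite rmorphXn /= mevalXU expf_neq0 // boundary_neq0.
have hnum a i r : r != 0 -> i != 0 ->
    meval (boundary r) (num a i) = boundary r i ^ a * meval (boundary r) (den a i).
  move=> r0 i0; have b0 := boundary_neq0 r0 i0; rewrite /den /num; case: a => a /=.
    by rewrite rmorphXn /= mevalXU meval1 mulr1.
  by rewrite rmorphXn /= mevalXU meval1 NegzE -exprnN mulVf // expf_neq0.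
exists (num (L 1 1) 1 * num (L 1 2%:R) 2%:R), (den (L 1 1) 1 * den (L 1 2%:R) 2%:R),
  (c 1 ^ L 1 1 * c 2%:R ^ L 1 2%:R); split.
- by rewrite mulf_neq0 // expfz_neq0 // c_torus.
- by move=> r r0; rewrite mevalM mulf_neq0 // hden.
move=> r r0; rewrite !mevalM !hnum // mulrACA; congr (_ * _).
have Eb i : i != 0 -> boundary r i = c i * (r ^ K i 1 * (- r) ^ K i 2%:R).
  by move=> i0; rewrite boundaryE chart_matrix_col (negPf i0) expr0z mul1r.
have nr0 : - r != 0 by rewrite oppr_eq0.
rewrite !Eb // !field_exprzM !exprz_exp.
transitivity (c 1 ^ L 1 1 * c 2%:R ^ L 1 2%:R * (r ^ (L 1 1 * K 1 1 + L 1 2%:R * K 2%:R 1) *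
  (- r) ^ (L 1 1 * K 1 2%:R + L 1 2%:R * K 2%:R 2%:R))).
  by rewrite !expfzDr // ![L _ _ * _]mulrC mulrACA [X in _ * X]mulrACA.
by rewrite E1 E2 expr1z expr0z mulr1.
Qed.

Lemma boundary_divisor_point r1 r2 : r1 != 0 ->
  (forall F : {poly {poly C}}, vanishes trace F ->
     ('X - r1%:P) * ('X - r2%:P) %| fiber 0 F) ->
  divisor_points X' (boundary r1).
Proof.
move=> r0 H; split; [exact: boundary0|exact: boundary_neq0|exact: boundary_neq0|].
move=> f vf; have [q [k [Eq vq]]] := pullback_boundary f.
have : root (fiber 0 q) r1.
  by rewrite -dvdp_XsubCl; apply: dvdp_trans (H q (vq vf)); apply: dvdp_mulr.
by rewrite /root Eq // mulf_eq0 expf_eq0 (negPf r0) andbF => /eqP.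
Qed.

Lemma boundary_inj r1 r2 : r1 != 0 -> r2 != 0 -> boundary r1 = boundary r2 -> r1 = r2.
Proof.
move=> h1 h2 E; have [f [g [k [k0 g0 fg]]]] := boundary_parameter.
have := fg _ h1; rewrite E (fg _ h2) => /(mulIf (g0 _ h2)) /(mulfI k0) //.
Qed.

(** The exponent k can be chosen large, hence common to finitely many functions. *)
Lemma pullback_boundary_uniform f : exists k0, forall k, (k0 <= k)%N -> exists p : {poly C},
  (forall y, y != 0 -> p.[y] = y ^+ k * meval (boundary y) f) /\
  (forall r1 r2, vanishing_ideal X' f -> (forall F : {poly {poly C}}, vanishes trace F ->
     ('X - r1%:P) * ('X - r2%:P) %| fiber 0 F) -> ('X - r1%:P) * ('X - r2%:P) %| p).
Proof.
have [q [k0 [Eq vq]]] := pullback_boundary f.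
exists k0 => k hk; exists ('X^(k - k0) * fiber 0 q); split.
  by move=> y y0; rewrite hornerM hornerXn Eq // mulrA -exprD subnK.
by move=> r1 r2 vf H; apply: dvdp_mull; apply: H; exact: vq.
Qed.

(** Suppose that the local quotient at a double point were spanned by one class b.
    Then 1 = c1 b and y = c2 b modulo the ideal, where y is the parameter of the
    divisor, so c2 - c1 y is in the ideal. Restricted to the divisor, elements
    of the ideal are divisible by (y - r)^2, so c1 = c2 = 0 and 1 would be in
    the ideal. *)
Lemma multiplicity_gt1 r : r != 0 ->
  (forall F : {poly {poly C}}, vanishes trace F ->
     ('X - r%:P) * ('X - r%:P) %| fiber 0 F) ->
  ~ intersection_multiplicity X' (boundary r) 1.
Proof.
move=> r0 H [b [hb hx]]; have [fb [gb [gb0 Eb]]] := hb 0.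
have [f [g [k [k0 g0 fg]]]] := boundary_parameter.
have l1 : local_ring (boundary r) 1.
  by exists 1, 1; rewrite meval1 oner_neq0 tofrac1 divr1.
have l2 : local_ring (boundary r) (tofrac f / tofrac g).
  by exists f, g; split=> //; exact: g0.
have [c1 [[f1 [h1 [g1 [vf1 g10 E1]]]] _]] := hx _ l1.
have [c2 [[f2 [h2 [g2 [vf2 g20 E2]]]] _]] := hx _ l2.
rewrite big_ord1 Eb in E1; rewrite big_ord1 Eb in E2.
have nz x : meval (boundary r) x != 0 -> tofrac x != 0.
  by move=> x0; rewrite tofrac_eq0; apply: contraNneq x0 => ->; rewrite meval0.
set N1 := f1 + _ in E1; set N2 := f2 + _ in E2.
set C1 := mpolyC 3 _ in E1; set C2 := mpolyC 3 _ in E2.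
have F1 : g1 * gb - C1 * g1 * fb = gb * N1.
  apply/eqP; rewrite -tofrac_eq; apply/eqP; rewrite tofracB !tofracM.
  exact: (clear_denominators1 (nz _ gb0) (nz _ g10) E1).
have F2 : f * gb * g2 - C2 * fb * g * g2 = g * gb * N2.
  apply/eqP; rewrite -tofrac_eq; apply/eqP; rewrite tofracB !tofracM.
  exact: (clear_denominators2 (nz _ (g0 _ r0)) (nz _ gb0) (nz _ g20) E2).
have [kg1 Hg1] := pullback_boundary_uniform g1; have [kg2 Hg2] := pullback_boundary_uniform g2.
have [kgb Hgb] := pullback_boundary_uniform gb; have [kfb Hfb] := pullback_boundary_uniform fb.
have [kf1 Hf1] := pullback_boundary_uniform f1; have [kf2 Hf2] := pullback_boundary_uniform f2.
have [[l3 l4 l5] [l6 l7 l8]] := leq_sum6 kg1 kg2 kgb kfb kf1 kf2.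
set M := (_ + kf2)%N in l3 l4 l5 l6 l7 l8.
have [G1 [EG1 _]] := Hg1 _ l3; have [G2 [EG2 _]] := Hg2 _ l4.
have [GB [EGB _]] := Hgb _ l5; have [FB [EFB _]] := Hfb _ l6.
have [P1 [EP1 /(_ r r vf1 H) D1]] := Hf1 _ l7; have [P2 [EP2 /(_ r r vf2 H) D2]] := Hf2 _ l8.
have eN1 y : meval (boundary y) N1 = meval (boundary y) f1.
  by rewrite /N1 mevalD mevalM mevalXU boundary0 mulr0 addr0.
have eN2 y : meval (boundary y) N2 = meval (boundary y) f2.
  by rewrite /N2 mevalD mevalM mevalXU boundary0 mulr0 addr0.
have I1 : G1 * GB - (c1 0 0)%:P * G1 * FB = GB * P1.
  apply: poly_eq_off_zero => y y0; have := congr1 (meval (boundary y)) F1.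
  rewrite mevalB !mevalM eN1 /C1 mevalC => E.
  rewrite !(hornerD, hornerN, hornerM, hornerC) EG1 // EGB // EFB // EP1 //.
  apply: (scaled_identity1 (y ^+ M)); exact: E.
have I2 : k%:P * 'X * GB * G2 - (c2 0 0)%:P * FB * G2 = GB * P2.
  apply: poly_eq_off_zero => y y0; have := congr1 (meval (boundary y)) F2.
  rewrite mevalB !mevalM eN2 /C2 mevalC fg // => E.
  rewrite !(hornerD, hornerN, hornerM, hornerC, hornerX) EG2 // EGB // EFB // EP2 //.
  apply: (scaled_identity2 (y ^+ M) (g0 _ y0)); exact: E.
pose u := ('X - r%:P) * ('X - r%:P) : {poly C}.
have rG p q : q != 0 -> (forall y, y != 0 -> p.[y] = y ^+ M * meval (boundary y) q) ->
    meval (boundary r) q != 0 -> ~~ root p r.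
  by move=> _ Ep qr; rewrite /root Ep // mulf_neq0 // expf_neq0.
have cop p : ~~ root p r -> coprimep u p.
  by move=> hp; rewrite coprimepMl !(coprimep_sym _ p) coprimep_XsubC hp.
have nzp x : meval (boundary r) x != 0 -> x != 0.
  by move=> x0; apply: contraNneq x0 => ->; rewrite meval0.
have cG1 := cop _ (rG _ _ (nzp _ g10) EG1 g10).
have cG2 := cop _ (rG _ _ (nzp _ g20) EG2 g20).
have cGB := cop _ (rG _ _ (nzp _ gb0) EGB gb0).
have D : u %| (c2 0 0)%:P - (c1 0 0 * k) *: 'X.
  rewrite -(Gauss_dvdpl _ cG1) -(Gauss_dvdpl _ cG2) -(Gauss_dvdpl _ cGB).
  have -> : ((c2 0 0)%:P - (c1 0 0 * k) *: 'X) * G1 * G2 * GB =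
      (c2 0 0)%:P * G2 * GB * P1 - (c1 0 0)%:P * G1 * GB * P2.
    transitivity ((c2 0 0)%:P * G2 * (GB * P1) - (c1 0 0)%:P * G1 * (GB * P2)); last by ring.
    rewrite -I1 -I2 -mul_polyC polyCM; ring.
  by apply: dvdp_sub; apply: dvdp_mull.
have Z : (c2 0 0)%:P - (c1 0 0 * k) *: 'X = 0.
  apply/eqP; apply: contraT => nz0; have := dvdp_leq nz0 D.
  rewrite /u size_mul ?polyXsubC_eq0 // !size_XsubC /= leqNgt ltnS.
  apply: contraNT => _; apply: leq_trans (size_polyD _ _) _.
  rewrite size_polyN geq_max (leq_trans (size_polyC_leq1 _)) //.
  by rewrite (leq_trans (size_scale_leq _ _)) // size_polyX.
have c10 : c1 0 0 = 0.
  have := congr1 (fun p : {poly C} => p`_1) Z; rewrite /= coefB coefC coefZ coefX /= mulr1 sub0r coef0.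
  by move=> /eqP; rewrite oppr_eq0 mulf_eq0 (negPf k0) orbF => /eqP.
have : root (G1 * GB) r.
  move: I1; rewrite c10 polyC0 !mul0r subr0 => ->.
  rewrite rootM; apply/orP; right; rewrite -dvdp_XsubCl.
  by apply: dvdp_trans D1; apply: dvdp_mulr.
rewrite rootM (negPf (rG _ _ (nzp _ g10) EG1 g10)).
by rewrite (negPf (rG _ _ (nzp _ gb0) EGB gb0)).
Qed.

End Weight.

(** Two distinct roots give two intersection points with the divisor, a double
    root gives one of multiplicity at least 2; both exceed the weight 1. *)
Lemma trace_weight v : (0 < n)%N -> N *m v = vec3 (-1) 0 0 -> edge_weight X v 1 ->
  forall r1 r2 : C, r1 != 0 -> r2 != 0 -> ~ (forall F : {poly {poly C}},
    vanishes trace F -> ('X - r1%:P) * ('X - r2%:P) %| fiber 0 F).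
Proof.
move=> n0 Nv [B [B_unit Bv [s [m [us hs hm hw]]]]] r1 r2 h1 h2 H.
have H' F : vanishes trace F -> ('X - r2%:P) * ('X - r1%:P) %| fiber 0 F.
  by rewrite mulrC; exact: H.
have D1 := boundary_divisor_point n0 Nv Bv h1 H.
have D2 := boundary_divisor_point n0 Nv Bv h2 H'.
set p1 := (X in divisor_points _ X) in D1; set p2 := (X in divisor_points _ X) in D2.
have s1 : p1 \in s by apply/hs.
have s2 : p2 \in s by apply/hs.
have m_gt0 p : p \in s -> (0 < m p)%N.
  by move=> ps; apply: multiplicity_gt0 (hm p ps); apply/hs.
have [p12 m1] := unit_sum us s1 s2 m_gt0 hw.
have r12 : r2 = r1 by apply: (boundary_inj n0 Nv B_unit Bv h2 h1 p12).
rewrite r12 in H; apply: (multiplicity_gt1 n0 Nv B_unit Bv h1 H).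
by have := hm p1 s1; rewrite m1.
Qed.

Theorem trace_bound v : (0 < n)%N -> zariski_closed X -> N *m v = vec3 (-1) 0 0 ->
  edge_weight X v 1 -> log_limsup X (realv R v) ->
  (forall x, log_limsup X x -> on_rays n (\sum_j (N 0 j)%:~R * x j 0)
     (\sum_j (N 1 j)%:~R * x j 0) (\sum_j (N 2%:R j)%:~R * x j 0)) ->
  (n <= 2)%N.
Proof.
move=> n0 Xc Nv wv hv hrays; apply: (@adapted_curve_bound R n trace n0).
  split.
  - exact: trace_torus.
  - by move=> S Y; exact: trace_closed.
  - move=> p0 p1 p2 /trace_asymptotic[x hx E].
    by have := hrays x hx; rewrite !E.
  - apply: trace_near_zero; exists (realv R v) => //.
    by rewrite -realvM Nv !mxE.
exact: trace_weight Nv wv.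
Qed.
End Transfer.

(** * Lines in general position *)

Section LineChart.
Variable R : realType.
Local Notation C := R[i].
Local Notation point := {ffun 'I_3 -> C}.

(** In the coordinates given by N, the curve X is the part in the torus of a line
    which meets the three coordinate planes and the plane at infinity in four
    distinct points: the inequalities say that no two of these points agree. *)
Definition line_chart (X : set point) (N : 'M[int]_3) : Prop :=
  N \in unitmx /\ exists c1 a1 c2 a2 : C,
    [/\ [&& c1 != 0, a1 != 0, c2 != 0 & a2 != 0], c1 * a2 != c2 * a1 &
     X = [set z | [/\ torus z,
        monomial_map N z 1 = c1 + a1 * monomial_map N z 0 &
        monomial_map N z 2%:R = c2 + a2 * monomial_map N z 0]]].

Lemma line_chart_mul (X : set point) (N Q : 'M[int]_3) (c1 a1 c2 a2 : C) :
  N \in unitmx -> Q \in unitmx ->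
  [&& c1 != 0, a1 != 0, c2 != 0 & a2 != 0] -> c1 * a2 != c2 * a1 ->
  (forall z, X z <-> torus z /\ let y := monomial_map Q (monomial_map N z) in
     y 1 = c1 + a1 * y 0 /\ y 2%:R = c2 + a2 * y 0) -> line_chart X (Q *m N).
Proof.
move=> hN hQ h1 h2 hX; split; first by rewrite unitmx_mul hQ.
exists c1, a1, c2, a2; split=> //; apply/seteqP; split=> z.
  by move=> /hX[zT [e1 e2]]; split; rewrite ?monomial_mapM.
by move=> [zT e1 e2]; apply/hX; rewrite -monomial_mapM.
Qed.

(** With the identity, these changes of coordinates bring each of the directions
    - e_0, - e_1, - e_2 and (1, 1, 1) to - e_0. *)
Definition swap01 : 'M[int]_3 := mat3 [:: [:: 0; 1; 0]; [:: 1; 0; 0]; [:: 0; 0; 1]].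
Definition swap02 : 'M[int]_3 := mat3 [:: [:: 0; 0; 1]; [:: 0; 1; 0]; [:: 1; 0; 0]].
Definition invert0 : 'M[int]_3 := mat3 [:: [:: -1; 0; 0]; [:: -1; 1; 0]; [:: -1; 0; 1]].

Lemma involution_unit (Q : 'M[int]_3) : Q *m Q = 1%:M -> Q \in unitmx.
Proof. by move=> /mulmx1_unit[]. Qed.

Lemma swap01_unit : swap01 \in unitmx.
Proof.
apply: involution_unit; apply/matrixP; elim/ord3_ind; elim/ord3_ind;
  by rewrite !mxE sum3 !mxE.
Qed.

Lemma swap02_unit : swap02 \in unitmx.
Proof.
apply: involution_unit; apply/matrixP; elim/ord3_ind; elim/ord3_ind;
  by rewrite !mxE sum3 !mxE.
Qed.

Lemma invert0_unit : invert0 \in unitmx.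
Proof.
apply: involution_unit; apply/matrixP; elim/ord3_ind; elim/ord3_ind;
  by rewrite !mxE sum3 !mxE.
Qed.

Lemma line_chart_swap01 X N : line_chart X N -> line_chart X (swap01 *m N).
Proof.
move=> [hN [c1 [a1 [c2 [a2 [/and4P[h1 h2 h3 h4] hd EX]]]]]].
apply: (@line_chart_mul X N swap01 (- c1 / a1) a1^-1 (c2 - a2 * c1 / a1) (a2 / a1)) => //.
- exact: swap01_unit.
- have -> : c2 - a2 * c1 / a1 = - (c1 * a2 - c2 * a1) / a1 by field.
  by apply/and4P; split; rewrite ?mulf_neq0 ?invr_eq0 ?oppr_eq0 ?subr_eq0.
- rewrite -subr_eq0; have -> : - c1 / a1 * (a2 / a1) - (c2 - a2 * c1 / a1) * a1^-1 = - c2 / a1 by field.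
  by rewrite mulf_neq0 ?invr_eq0 ?oppr_eq0.
move=> z; rewrite EX /=; move: (monomial_map N z) => m.
have [E0 [E1 E2]] : monomial_map swap01 m 0 = m 1 /\ monomial_map swap01 m 1 = m 0 /\ monomial_map swap01 m 2%:R = m 2%:R.
  by rewrite !ffunE !prod3 !mxE /= !expr0z !expr1z !mul1r !mulr1.
rewrite /= E0 E1 E2; split=> [[zT e1 e2]|[zT [e1 e2]]]; split=> //; try split.
- by rewrite e1; field.
- by rewrite e2 e1; field.
- by rewrite e1; field.
- by rewrite e2 e1; field.
Qed.

Lemma line_chart_swap02 X N : line_chart X N -> line_chart X (swap02 *m N).
Proof.
move=> [hN [c1 [a1 [c2 [a2 [/and4P[h1 h2 h3 h4] hd EX]]]]]].
apply: (@line_chart_mul X N swap02 (c1 - a1 * c2 / a2) (a1 / a2) (- c2 / a2) a2^-1) => //.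
- exact: swap02_unit.
- have -> : c1 - a1 * c2 / a2 = (c1 * a2 - c2 * a1) / a2 by field.
  by apply/and4P; split; rewrite ?mulf_neq0 ?invr_eq0 ?oppr_eq0 ?subr_eq0.
- rewrite -subr_eq0; have -> : (c1 - a1 * c2 / a2) * a2^-1 - - c2 / a2 * (a1 / a2) = c1 / a2 by field.
  by rewrite mulf_neq0 ?invr_eq0.
move=> z; rewrite EX /=; move: (monomial_map N z) => m.
have [E0 [E1 E2]] : monomial_map swap02 m 0 = m 2%:R /\ monomial_map swap02 m 1 = m 1 /\ monomial_map swap02 m 2%:R = m 0.
  by rewrite !ffunE !prod3 !mxE /= !expr0z !expr1z !mul1r !mulr1.
rewrite /= E0 E1 E2; split=> [[zT e1 e2]|[zT [e1 e2]]]; split=> //; try split.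
- by rewrite e1 e2; field.
- by rewrite e2; field.
- by rewrite e1 e2; field.
- by rewrite e2; field.
Qed.

Lemma line_chart_invert0 X N : line_chart X N -> line_chart X (invert0 *m N).
Proof.
move=> [hN [c1 [a1 [c2 [a2 [/and4P[h1 h2 h3 h4] hd EX]]]]]].
apply: (@line_chart_mul X N invert0 a1 c1 a2 c2) => //.
- exact: invert0_unit.
- by rewrite h1 h2 h3 h4.
- by rewrite eq_sym mulrC (mulrC a1).
move=> z; rewrite EX; set m := monomial_map N z.
have key : torus z -> [/\ m 0 != 0, monomial_map invert0 m 0 = (m 0)^-1, monomial_map invert0 m 1 = m 1 / m 0 &
   monomial_map invert0 m 2%:R = m 2%:R / m 0].
  move=> zT; split; first exact: torus_monomial.
  - by rewrite ffunE prod3 !mxE /= !expr0z !mulr1.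
  - by rewrite ffunE prod3 !mxE /= expr0z expr1z mulr1 mulrC.
  - by rewrite ffunE prod3 !mxE /= expr0z expr1z mulr1 mulrC.
split=> [[zT e1 e2]|[zT]]; have [m0 E0 E1 E2] := key zT; rewrite /= ?E0 ?E1 ?E2.
  by split=> //; split; rewrite ?e1 ?e2; field.
move=> [e1 e2]; split=> //.
  by rewrite -[LHS](@divfK _ (m 0)) // e1; field.
by rewrite -[LHS](@divfK _ (m 0)) // e2; field.
Qed.

Section Chart.
Variables (X : set point) (N : 'M[int]_3) (c1 a1 c2 a2 : C).
Hypothesis N_unit : N \in unitmx.
Hypothesis coef_neq0 : [&& c1 != 0, a1 != 0, c2 != 0 & a2 != 0].
Hypothesis X_eq : X = [set z | [/\ torus z,
        monomial_map N z 1 = c1 + a1 * monomial_map N z 0 &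
        monomial_map N z 2%:R = c2 + a2 * monomial_map N z 0]].

(** The line is parametrized by its coordinate of index 0. *)
Definition line_poly (i : 'I_3) : {poly C} :=
  nth 0 [:: 'X; c1%:P + a1 *: 'X; c2%:P + a2 *: 'X] i.

Definition line_point (t : C) : point := [ffun i => (line_poly i).[t]].

Definition line_bad : {poly C} := \prod_i line_poly i.

Lemma line_poly_neq0 i : line_poly i != 0.
Proof.
have [c10 a10 c20 a20] := and4P coef_neq0.
have h (c a : C) : c != 0 -> c%:P + a *: 'X != 0.
  move=> c0; apply/eqP => /(congr1 (fun p : {poly C} => p.[0])).
  by rewrite /= hornerD hornerC hornerZ hornerX mulr0 addr0 horner0; apply/eqP.
by elim/ord3_ind: i; rewrite /line_poly /= ?polyX_eq0 ?h.
Qed.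

Lemma line_bad_neq0 : line_bad != 0.
Proof. by apply/prodf_neq0 => i _; exact: line_poly_neq0. Qed.

Lemma line_badP t : line_bad.[t] != 0 <-> torus (line_point t).
Proof.
rewrite /line_bad horner_prod; split=> [h i|h].
  by rewrite ffunE; move/prodf_neq0: h => ->.
by apply/prodf_neq0 => i _; have := h i; rewrite ffunE.
Qed.

Definition line_param (t : C) : point := monomial_map (invmx N) (line_point t).

Lemma line_pointE t : [/\ line_point t 0 = t, line_point t 1 = c1 + a1 * t &
  line_point t 2%:R = c2 + a2 * t].
Proof. by rewrite !ffunE /line_poly /= hornerX !hornerD !hornerC !hornerZ hornerX. Qed.

Lemma line_paramP t : line_bad.[t] != 0 ->
  X (line_param t) /\ monomial_map N (line_param t) = line_point t.
Proof.
move=> /line_badP T; have E : monomial_map N (line_param t) = line_point t.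
  by rewrite monomial_mapKV.
split=> //; rewrite X_eq; split; rewrite ?E; first exact: torus_monomial.
- by have [-> -> _] := line_pointE t.
- by have [-> _ ->] := line_pointE t.
Qed.

Lemma line_paramK z : X z -> let t := monomial_map N z 0 in
  line_bad.[t] != 0 /\ line_param t = z.
Proof.
rewrite X_eq => -[zT e1 e2] t.
have E : line_point t = monomial_map N z.
  have [h0 h1 h2] := line_pointE t.
  by apply/ffunP; elim/ord3_ind; rewrite ?h0 ?h1 ?h2 ?e1 ?e2.
split; last by rewrite /line_param E monomial_mapK.
by apply/line_badP; rewrite E; exact: torus_monomial.
Qed.

Let evP (t : C) (p : {poly C}) : C := p.[t].
Let evPD t : {morph evP t : x y / x + y}. Proof. by move=> x y; exact: hornerD. Qed.
Let evPM t : {morph evP t : x y / x * y}. Proof. by move=> x y; exact: hornerM. Qed.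
Let evPC t c : evP t (polyC c) = c. Proof. exact: hornerC. Qed.

Lemma line_pullback (f : mpoly 3 C) : exists (F : {poly C}) k, forall t,
  line_bad.[t] != 0 -> F.[t] = line_bad.[t] ^+ k * meval (line_param t) f.
Proof.
pose D t := line_bad.[t] != 0.
suff : regular evP D line_bad (fun t => meval (line_param t) f) by [].
apply: (regular_meval _ evPD evPM evPC) => i.
suff : regular evP D line_bad (fun t => \prod_j (line_poly j).[t] ^ (invmx N) i j).
  apply: eq_regular => t _; rewrite ffunE; apply: eq_bigr => j _; by rewrite ffunE.
apply: (regular_prod evPM evPC) => j; apply: (regular_expz evPM evPC).
  exact: (regular_ev evP D line_bad (line_poly j)).
apply: (@regular_inv _ _ _ evP D line_bad _ (fun t => (line_poly j).[t])
  (\prod_(k | k != j) line_poly k)) => // t _.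
by rewrite /evP /line_bad [in RHS](bigD1 j) //= hornerM mulrC.
Qed.

(** The pullback of an equation of Y to the line is a polynomial in one variable,
    which is zero or has finitely many roots. *)
Lemma line_closed_dichotomy Y : zariski_closed Y -> X `<=` Y \/
  exists2 F : {poly C}, F != 0 &
    forall z, X z -> Y z -> F.[monomial_map N z 0] = 0.
Proof.
move=> [S ->]; have [|/existsNP[z /not_implyP[Xz nYz]]] := pselect (X `<=` [set z | torus z /\ forall f, S f -> meval z f = 0]); [by left|right].
have zT : torus z by move: Xz; rewrite X_eq => -[].
have [f [Sf fz]] : exists f, S f /\ meval z f <> 0.
  apply: contrapT => hf; apply: nYz; split=> // f Sf.
  by apply: contrapT => fz; apply: hf; exists f.
have [F [k hF]] := line_pullback f.
exists F.
  apply/eqP => F0; have [bz pz] := line_paramK Xz.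
  have := hF _ bz; rewrite F0 horner0 pz => /esym/eqP.
  by rewrite mulf_eq0 expf_eq0 (negPf bz) andbF => /eqP.
move=> y Xy [_ /(_ f Sf) fy]; have [by_ py] := line_paramK Xy.
by rewrite hF // py fy mulr0.
Qed.

Let evZ' (z : point) (f : mpoly 3 C) : C := meval z f.
Let evZD z : {morph evZ' z : x y / x + y}. Proof. by move=> x y; exact: mevalD. Qed.
Let evZM z : {morph evZ' z : x y / x * y}. Proof. by move=> x y; exact: mevalM. Qed.
Let evZC z c : evZ' z (mpolyC 3 c) = c. Proof. exact: mevalC. Qed.
Let gZ : mpoly 3 C := \prod_i mpolyX C (mnm1 i).

Lemma regular_zeros_closed f : regular evZ' (@torus R 3) gZ f ->
  zariski_closed [set z | torus z /\ f z = 0].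
Proof.
move=> [F [k h]]; exists [set F]; apply/seteqP; split=> z [zT hz]; split=> //.
  by move=> _ ->; rewrite -/(evZ' z F) h // hz mulr0.
have := h z zT; rewrite /evZ' hz // => /esym/eqP.
rewrite mulf_eq0 expf_eq0 /evZ' /gZ rmorph_prod /=.
have -> : (\prod_i meval z (mpolyX C (mnm1 i)) == 0) = false.
  by apply/negbTE/prodf_neq0 => i _; rewrite mevalXU.
by rewrite andbF => /eqP.
Qed.

Lemma chart_regular i : regular evZ' (@torus R 3) gZ (fun z => monomial_map N z i).
Proof.
suff : regular evZ' (@torus R 3) gZ (fun z => \prod_j z j ^ N i j).
  by apply: eq_regular => z _; rewrite ffunE.
apply: (regular_prod evZM evZC) => j; apply: (regular_expz evZM evZC).
  by apply: eq_regular (regular_ev evZ' _ gZ (mpolyX C (mnm1 j))) => z _; rewrite /evZ' mevalXU.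
apply: (@regular_inv _ _ _ evZ' _ gZ _ (fun z => z j) (\prod_(k | k != j) mpolyX C (mnm1 k))).
  by move=> z zT; rewrite /evZ' /gZ rmorph_prod; apply/prodf_neq0 => k _; rewrite /= mevalXU.
by move=> z zT; rewrite /evZ' /gZ [in RHS](bigD1 j) //= mevalM mevalXU mulrC.
Qed.

Lemma zariski_closedI (Y Z : set point) :
  zariski_closed Y -> zariski_closed Z -> zariski_closed (Y `&` Z).
Proof.
move=> [S ->] [T ->]; exists (S `|` T); apply/seteqP; split=> z.
  by move=> [[zT h1] [_ h2]]; split=> // f [/h1|/h2].
by move=> [zT h]; split; split=> // f hf; apply: h; [left|right].
Qed.

Lemma line_closed : zariski_closed X.
Proof.
have h i (c a : C) : zariski_closed [set z | torus z /\
    monomial_map N z i - (c + a * monomial_map N z 0) = 0].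
  apply: regular_zeros_closed.
  have r1 := chart_regular i.
  have r2 : regular evZ' (@torus R 3) gZ (fun z => - c + - a * monomial_map N z 0).
    apply: (regularD evZD evZM evZC); first exact: (regular_const _ _ evZC (- c)).
    apply: (regularM evZM); first exact: (regular_const _ _ evZC (- a)).
    exact: chart_regular.
  by apply: eq_regular (regularD evZD evZM evZC r1 r2) => z _; rewrite opprD mulNr.
have := zariski_closedI (h 1 c1 a1) (h 2%:R c2 a2).
rewrite X_eq; congr zariski_closed; apply/seteqP; split=> z.
  by move=> [[zT /eqP e1] [_ /eqP e2]]; move: e1 e2; rewrite !subr_eq0 => /eqP e1 /eqP e2.
by move=> [zT e1 e2]; split; split=> //=; rewrite ?e1 ?e2 subrr.
Qed.

(** The parameter of the line is the restriction of a Laurent monomial, which is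
    defined on the whole torus. *)
Lemma level_closed (G : {poly C}) :
  zariski_closed [set z | torus z /\ G.[monomial_map N z 0] = 0].
Proof.
apply: regular_zeros_closed.
suff : regular evZ' (@torus R 3) gZ (fun z => \sum_(i < size G) G`_i * monomial_map N z 0 ^+ i).
  by apply: eq_regular => z _; rewrite horner_coef.
apply: (regular_sum evZD evZM evZC) => i; apply: (regularM evZM).
  exact: (regular_const _ _ evZC (G`_i)).
apply: (regular_exp evZM evZC); exact: chart_regular.
Qed.

Lemma line_irreducible : irreducible_closed X.
Proof.
have b0 := line_bad_neq0.
split; first exact: line_closed.
  by have [t bt] := poly_nonzero_at b0; exists (line_param t); have [] := line_paramP bt.
move=> Y Z Yc Zc XYZ.
have [|[F F0 hF]] := line_closed_dichotomy Yc; first by left.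
have [|[G G0 hG]] := line_closed_dichotomy Zc; first by right.
have FGb : F * G * line_bad != 0 by rewrite !mulf_neq0.
have [t] := poly_nonzero_at FGb; rewrite !hornerM !mulf_eq0 !negb_or => /andP[/andP[Ft Gt] bt].
have [Xt Et] := line_paramP bt; have [E0 _ _] := line_pointE t.
case: (XYZ _ Xt) => [/(hF _ Xt)|/(hG _ Xt)]; rewrite Et E0 => /eqP E.
  by rewrite E in Ft.
by rewrite E in Gt.
Qed.

Lemma point_irreducible (p : point) : torus p -> irreducible_closed [set p].
Proof.
move=> pT; split.
- exists [set f : mpoly 3 C | exists i, f = (mpolyX C (mnm1 i) - mpolyC 3 (p i))%R].
  apply/seteqP; split=> z.
    by move=> ->; split=> // _ [i ->]; rewrite mevalB mevalXU mevalC subrr.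
  move=> [zT h]; apply/ffunP => i; apply/eqP; rewrite -subr_eq0; apply/eqP.
  have := h (mpolyX C (mnm1 i) - mpolyC 3 (p i))%R (ex_intro _ i erefl).
  by rewrite mevalB mevalXU mevalC.
- by exists p.
- by move=> Y Z _ _ /(_ p erefl) [Yp|Zp]; [left|right] => _ ->.
Qed.

(** In a chain Z < Y < X of irreducible closed sets, Y lies in the zero locus of a
    polynomial F in the parameter. Splitting off from F the factor of a point y1
    of Y outside Z covers Y by two closed sets, and each of the two cases
    contradicts the choice of y1. *)
Lemma line_irreducible_curve : irreducible_curve X.
Proof.
have b0 := line_bad_neq0.
split; first exact: line_irreducible.
- have [t bt] := poly_nonzero_at b0.
  have [Xt Et] := line_paramP bt; have [E0 _ _] := line_pointE t.
  exists [set line_param t]; split.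
    by apply: point_irreducible; exact/torus_monomial/line_badP.
  split; first by move=> z ->.
  have : line_bad * ('X - t%:P) != 0 by rewrite mulf_neq0 ?polyXsubC_eq0.
  move=> /poly_nonzero_at[t']; rewrite hornerM hornerXsubC mulf_eq0 negb_or subr_eq0 => /andP[bt' tt'].
  have [Xt' Et'] := line_paramP bt'; have [E0' _ _] := line_pointE t'.
  move=> /(_ _ Xt') E; move: tt'; rewrite -E0' -Et' E Et E0 eqxx //.
move=> [Y [Z [[Yc _ Yirr] [_ [z1 Zz1] _] [ZY nYZ] [YX nXY]]]].
have [//|[F F0 hF]] := line_closed_dichotomy Yc.
have [y1 [Yy1 nZy1]] : exists y, Y y /\ ~ Z y.
  by apply: contrapT => h; apply: nYZ => y Yy; apply: contrapT => nZ; apply: h; exists y.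
have [k [G]] := multiplicity_XsubC F (monomial_map N y1 0); rewrite F0 /= => Gy1 EF.
have Xsub z : Y z -> torus z by move=> /YX; rewrite X_eq => -[].
have cover : Y `<=` [set z | torus z /\ ('X - (monomial_map N y1 0)%:P).[monomial_map N z 0] = 0] `|`
    [set z | torus z /\ G.[monomial_map N z 0] = 0].
  move=> z Yz; have := hF _ (YX _ Yz) Yz; rewrite EF hornerM horner_exp => /eqP.
  rewrite mulf_eq0 expf_eq0 => /orP[/eqP h|/andP[_ /eqP h]]; [right|left]; split=> //; exact: Xsub.
case: (Yirr _ _ (level_closed _) (level_closed G) cover) => [h|h].
  have [_] := h z1 (ZY _ Zz1); rewrite hornerXsubC => /eqP; rewrite subr_eq0 => /eqP E.
  have [_ p1] := line_paramK (YX _ (ZY _ Zz1)); have [_ p2] := line_paramK (YX _ Yy1).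
  by apply: nZy1; rewrite -p2 -E p1.
by have [_ E] := h y1 Yy1; rewrite /root E eqxx in Gy1.
Qed.

End Chart.
End LineChart.

(** * Edge weights of a line *)

Lemma clear_denominators3 (F : fieldType) (f g c n d : F) : g != 0 -> d != 0 ->
  f / g - c = n / d -> f * d - c * g * d = g * n.
Proof.
move=> g0 d0 E; have -> : n = (f / g - c) * d by rewrite E divfK.
by field.
Qed.

Lemma solve_coefficient (F : fieldType) (a b c u w : F) : b != 0 -> u != 0 ->
  a * u - c * b * u = b * (0 + w * 0) -> c = a / b.
Proof.
move=> b0 u0; rewrite mulr0 addr0 mulr0 -mulrBl => /eqP.
by rewrite mulf_eq0 (negPf u0) orbF subr_eq0 => /eqP ->; rewrite mulfK.
Qed.

Section ChartWeight.
Variable R : realType.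
Local Notation C := R[i].
Local Notation point := {ffun 'I_3 -> C}.
Variables (X : set point) (N : 'M[int]_3) (c1 a1 c2 a2 : C).
Hypothesis N_unit : N \in unitmx.
Hypothesis coef_neq0 : [&& c1 != 0, a1 != 0, c2 != 0 & a2 != 0].
Hypothesis X_eq : X = [set z | [/\ torus z,
        monomial_map N z 1 = c1 + a1 * monomial_map N z 0 &
        monomial_map N z 2%:R = c2 + a2 * monomial_map N z 0]].

Let V := monomial_map N @` X.
Let p0 : point := line_point c1 a1 c2 a2 0.

Lemma line_imageP y : V y <-> [/\ torus y, y 1 = c1 + a1 * y 0 & y 2%:R = c2 + a2 * y 0].
Proof.
split=> [[z + <-]|[yT e1 e2]].
  by rewrite X_eq => -[zT e1 e2]; split=> //; exact: torus_monomial.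
exists (monomial_map (invmx N) y); last by rewrite monomial_mapKV.
by rewrite X_eq; split; rewrite ?monomial_mapKV //; exact: torus_monomial.
Qed.

Lemma line_ideal_polynomial f : exists F : {poly C}, forall t,
  F.[t] = meval (line_point c1 a1 c2 a2 t) f.
Proof.
pose evP (t : C) (p : {poly C}) : C := p.[t].
have evPD t : {morph evP t : x y / x + y} by move=> x y; exact: hornerD.
have evPM t : {morph evP t : x y / x * y} by move=> x y; exact: hornerM.
have evPC t c : evP t (polyC c) = c by exact: hornerC.
have [|F [k h]] := @regular_meval _ _ _ evP (@polyC _) (fun=> True) 1 3 (line_point c1 a1 c2 a2) f evPD evPM evPC.
  move=> i; apply: eq_regular (regular_ev evP _ 1 (line_poly c1 a1 c2 a2 i)) => t _.
  by rewrite /evP ffunE.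
by exists F => t; have := h t I; rewrite /evP hornerC expr1n mul1r.
Qed.

(** The pullback of f to the line is a polynomial with infinitely many zeros. *)
Lemma line_vanishing_at_boundary f : vanishing_ideal V f -> meval p0 f = 0.
Proof.
move=> vf; have [F hF] := line_ideal_polynomial f.
have b0 := line_bad_neq0 coef_neq0.
have : F * line_bad c1 a1 c2 a2 = 0.
  apply/eqP; apply: contraT => /poly_nonzero_at[t].
  rewrite hornerM mulf_eq0 negb_or => /andP[Ft bt]; move: Ft; rewrite hF vf ?eqxx //.
  have [e0 e1 e2] := line_pointE c1 a1 c2 a2 t.
  by apply/line_imageP; split; [exact/line_badP|rewrite e1 e0|rewrite e2 e0].
move=> /eqP; rewrite mulf_eq0 (negPf b0) orbF => /eqP F0.
by rewrite -hF F0 horner0.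
Qed.

Lemma p0E : [/\ p0 0 = 0, p0 1 = c1 & p0 2%:R = c2].
Proof. by have [-> -> ->] := line_pointE c1 a1 c2 a2 0; rewrite !mulr0 !addr0. Qed.

Let lin (c a : C) i : mpoly 3 C := mpolyX C (mnm1 i) - (mpolyC 3 c + mpolyC 3 a * mpolyX C (mnm1 0)).

Lemma lin_meval c a i (p : point) : meval p (lin c a i) = p i - (c + a * p 0).
Proof. by rewrite /lin mevalB mevalD mevalM !mevalC !mevalXU. Qed.

Lemma lin_vanishing1 : vanishing_ideal V (lin c1 a1 1).
Proof. by move=> y /line_imageP[_ e1 _]; rewrite lin_meval e1 subrr. Qed.

Lemma lin_vanishing2 : vanishing_ideal V (lin c2 a2 2%:R).
Proof. by move=> y /line_imageP[_ _ e2]; rewrite lin_meval e2 subrr. Qed.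

Lemma line_divisor_points p : divisor_points V p <-> p = p0.
Proof.
have [h0 h1 h2] := p0E; have [c10 _ c20 _] := and4P coef_neq0.
split=> [[e0 _ _ hp]|->]; last first.
  by split; rewrite ?h0 ?h1 ?h2 //; exact: line_vanishing_at_boundary.
apply/ffunP; elim/ord3_ind; rewrite ?h0 ?h1 ?h2 //.
  have := hp _ lin_vanishing1; rewrite lin_meval e0 mulr0 addr0 => /eqP.
  by rewrite subr_eq0 => /eqP.
have := hp _ lin_vanishing2; rewrite lin_meval e0 mulr0 addr0 => /eqP.
by rewrite subr_eq0 => /eqP.
Qed.

(** A polynomial is congruent to its value at p0 modulo the ideal of the line and
    the equation of the divisor. This holds for the coordinates, and the
    polynomials for which it holds form a ring, so the intersection is
    transversal. *)
Definition splits (h : mpoly 3 C) : Prop := exists F H : mpoly 3 C,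
  vanishing_ideal V F /\ h = mpolyC 3 (meval p0 h) + F + H * mpolyX C (mnm1 0).

Lemma splitsD g h : splits g -> splits h -> splits (g + h).
Proof.
move=> [F [H [vF E]]] [F' [H' [vF' E']]]; exists (F + F'), (H + H'); split.
  by move=> y Vy; rewrite mevalD vF // vF' // addr0.
by rewrite {1}E {1}E' mevalD mpolyCD; ring.
Qed.

Lemma splitsM g h : splits g -> splits h -> splits (g * h).
Proof.
move=> [F [H [vF E]]] [F' [H' [vF' E']]].
exists (mpolyC 3 (meval p0 g) * F' + F * h), (mpolyC 3 (meval p0 g) * H' + H * h); split.
  by move=> y Vy; rewrite mevalD !mevalM vF // vF' // mulr0 mul0r addr0.
rewrite {1}E mevalM mpolyCM.
transitivity (mpolyC 3 (meval p0 g) * h + F * h + H * h * mpolyX C (mnm1 0)); first by ring.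
rewrite {1}E'; ring.
Qed.

Lemma splitsC c : splits (mpolyC 3 c).
Proof.
exists 0, 0; split; first by move=> y _; rewrite meval0.
by rewrite mevalC mul0r !addr0.
Qed.

Lemma splits_lin c a i : vanishing_ideal V (lin c a i) -> splits (mpolyX C (mnm1 i)).
Proof.
move=> v; exists (lin c a i), (mpolyC 3 a); split=> //.
have := line_vanishing_at_boundary v; rewrite lin_meval => /eqP.
have [-> _ _] := p0E; rewrite mulr0 addr0 subr_eq0 => /eqP E.
by rewrite mevalXU E /lin; ring.
Qed.

Lemma splits_all h : splits h.
Proof.
have sX i : splits (mpolyX C (mnm1 i)).
  elim/ord3_ind: i.
  - exists 0, 1; split; first by move=> y _; rewrite meval0.
    by have [e0 _ _] := p0E; rewrite mevalXU e0 mul1r addr0 mpolyC0 add0r.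
  - exact: splits_lin lin_vanishing1.
  - exact: splits_lin lin_vanishing2.
elim/mpolyind: h => [|c m p _ _ IH]; first by rewrite -(mpolyC0 3 C); exact: splitsC.
apply: splitsD IH; rewrite -mul_mpolyC; apply: splitsM; first exact: splitsC.
rewrite mpolyXE_id; elim/big_ind: _ => [|f g|i _]; [|exact: splitsM|].
  by rewrite -(mpolyC1 3 C); exact: splitsC.
elim: (fun_of_multinom m i) => [|k IHk]; first by rewrite expr0 -(mpolyC1 3 C); exact: splitsC.
by rewrite exprS; exact: splitsM.
Qed.

Lemma line_multiplicity : intersection_multiplicity V p0 1.
Proof.
have [e0 _ _] := p0E.
exists (fun=> 1); split=> [i|x [f [g [g0 ->]]]].
  by exists 1, 1; rewrite meval1 oner_neq0 tofrac1 divr1.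
have nz q : meval p0 q != 0 -> tofrac q != 0.
  by move=> q0; rewrite tofrac_eq0; apply: contraNneq q0 => ->; rewrite meval0.
pose c := meval p0 f / meval p0 g.
exists (const_mx c); split=> [|d].
  have [F [H [vF E]]] := splits_all (f - mpolyC 3 c * g).
  exists F, H, g; split=> //; rewrite big_ord1 mxE mulr1.
  have -> : F + H * mpolyX C (mnm1 0) = f - mpolyC 3 c * g.
    rewrite {1}E mevalB mevalM mevalC /c divfK // subrr mpolyC0 add0r //.
  by rewrite tofracB tofracM mulrBl mulfK ?nz.
move=> [f1 [h1 [g1 [vf1 g10]]]]; rewrite big_ord1 mulr1 => E.
have E' : f * g1 - mpolyC 3 (d 0 0) * g * g1 = g * (f1 + h1 * mpolyX C (mnm1 0)).
  apply/eqP; rewrite -tofrac_eq; apply/eqP; rewrite tofracB !tofracM.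
  exact: (clear_denominators3 (nz _ g0) (nz _ g10) E).
have := congr1 (meval p0) E'; rewrite mevalB !mevalM mevalD mevalM mevalC mevalXU e0.
rewrite (line_vanishing_at_boundary vf1) => /(solve_coefficient g0 g10) Ed.
by apply/rowP => i; rewrite ord1 mxE Ed.
Qed.

Lemma line_edge_weight v : N *m v = - delta_mx 0 0 -> edge_weight X v 1.
Proof.
move=> Nv; exists N; split=> //; exists [:: p0], (fun=> 1%N); split=> //.
- by move=> p; rewrite inE; split=> [/eqP ->|/line_divisor_points ->]; rewrite ?eqxx //; exact/line_divisor_points.
- by move=> p; rewrite inE => /eqP ->; exact: line_multiplicity.
- by rewrite big_seq1.
Qed.

End ChartWeight.

(** * The logarithmic limit of a line *)

(** A bounded error is negligible after division by log t. *)
Lemma log_liminf_of_bounded (R : realType) (X : set {ffun 'I_3 -> R[i]}) (x : 'cV[R]_3) (c : R) :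
  (forall s : R, 0 <= s -> exists2 z, X z & forall i, `|lg (z i) - s * x i 0| <= c) ->
  log_liminf X x.
Proof.
move=> h U /nbhs_ballP[e /= e0 hU].
exists (expR (Num.max 0 (c / e))); split; first by rewrite num_real.
move=> t Tt; have t0 : 0 < t by apply: lt_trans Tt; exact: expR_gt0.
have : Num.max 0 (c / e) < ln t by rewrite -[ltLHS]expRK ltr_ln ?posrE ?expR_gt0.
rewrite gt_max => /andP[l0 lce].
have [z Xz hz] := h (ln t) (ltW l0).
exists (Logt t z); split; first by exists z.
apply: hU; split=> // i j; rewrite ord1 mxE /ball /=.
have -> : x i 0 - lg (z i) / ln t = - (lg (z i) - ln t * x i 0) / ln t by field; rewrite gt_eqF.
rewrite normrM normrN normfV (gtr0_norm l0) ltr_pdivrMr //.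
by apply: le_lt_trans (hz i) _; move: lce; rewrite ltr_pdivrMr // mulrC.
Qed.

Lemma log_liminf_limsup (R : realType) (X : set {ffun 'I_3 -> R[i]}) :
  log_liminf X `<=` log_limsup X.
Proof.
move=> x hx U /hx [M [_ hM]] T; exists (Num.max M T + 1); last by apply: hM; rewrite ltr_pwDr // le_max lexx.
by rewrite ltr_pwDr // le_max lexx orbT.
Qed.

(** The point of the line with first coordinate close to 0 has its two other
    coordinates close to c1 and c2, so that only the first logarithm is large. *)
Lemma line_chart_ray (R : realType) (X : set {ffun 'I_3 -> R[i]}) N (v : 'cV[int]_3) a :
  line_chart X N -> N *m v = - delta_mx 0 0 -> 0 <= a -> log_liminf X (a *: realv R v).
Proof.
move=> [hN [c1 [a1 [c2 [a2 [hc hd EX]]]]]] Nv a_ge0.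
have [c10 a10 c20 a20] := and4P hc.
have near (c b : R[i]) : c != 0 -> exists dl k : R, [/\ 0 < dl, 0 <= k &
    forall z, z != 0 -> nm z < dl -> c + b * z != 0 /\ `|lg (c + b * z)| <= k].
  move=> c0; have E : c%:P + b *: 'X = (c%:P + b *: 'X) * ('X - 0%:P) ^+ 0 by rewrite expr0 mulr1.
  have ev z : (c%:P + b *: 'X).[z] = c + b * z by rewrite hornerD hornerC hornerZ hornerX.
  have e0 : (c%:P + b *: 'X).[0] != 0 by rewrite ev mulr0 addr0.
  have [dl [k [dl0 k0 h]]] := lg_near_root E e0.
  exists dl, k; split=> // z z0 zd; have := h z z0; rewrite subr0 => /(_ zd).
  by rewrite mulr0n mul0r subr0 ev.
have [d1 [k1 [d10 k10 h1]]] := near c1 a1 c10.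
have [d2 [k2 [d20 k20 h2]]] := near c2 a2 c20.
pose dl := Num.min d1 d2 / 2.
have dl0 : 0 < dl by rewrite /dl divr_gt0 // lt_min d10 d20.
have [K K0 hK] := @int_matrix_bounded R _ _ (invmx N).
pose c := k1 + k2 + `|ln dl|.
have c_ge0 : 0 <= c by rewrite /c !addr_ge0.
apply: (@log_liminf_of_bounded _ _ _ (K * c)) => s s0.
(* log r = - s a up to a constant, and r is small enough for all s >= 0. *)
pose r := dl * expR (- (s * a)); have r0 : 0 < r by rewrite mulr_gt0 ?expR_gt0.
pose t : R[i] := (r)%:C%C.
have nt : nm t = r by rewrite nm_real gtr0_norm.
have t0 : t != 0 by rewrite -nm_gt0 nt.
have rdl : r <= dl.
  rewrite /r -[leRHS]mulr1 ler_wpM2l ?(ltW dl0) // -expR0 ler_expR oppr_le0 mulr_ge0 //.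
have [dl1 dl2] : dl < d1 /\ dl < d2.
  have : dl < Num.min d1 d2.
    by rewrite /dl ltr_pdivrMr // ltr_pMr ?ltr1n // lt_min d10 d20.
  by rewrite lt_min => /andP.
have [n1 b1] := h1 t t0 ltac:(by rewrite nt; exact: le_lt_trans rdl dl1).
have [n2 b2] := h2 t t0 ltac:(by rewrite nt; exact: le_lt_trans rdl dl2).
have [E0 E1 E2] := line_pointE c1 a1 c2 a2 t.
have bad : (line_bad c1 a1 c2 a2).[t] != 0.
  by apply/line_badP; elim/ord3_ind; rewrite ?E0 ?E1 ?E2.
have [Xz Ez] := line_paramP hN EX bad.
exists (line_param N c1 a1 c2 a2 t); first exact: Xz.
have zT : torus (line_param N c1 a1 c2 a2 t) by move: Xz; rewrite EX => -[].
have yT : torus (line_point c1 a1 c2 a2 t) by apply/line_badP.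
have Nvr i : realv R v i 0 = \sum_j (invmx N i j)%:~R * realv R (N *m v) j 0.
  by rewrite -realvM mulKmx.
have bnd j : `|lg (line_point c1 a1 c2 a2 t j) - s * a * realv R (N *m v) j 0| <= c.
  rewrite Nv; elim/ord3_ind: j; rewrite ?E0 ?E1 ?E2 ?nt !mxE /= ?oppr0 ?mulr0 ?subr0.
  - rewrite /r lnM ?posrE ?expR_gt0 // expRK mulrN1 opprK subrK.
    by rewrite /c lerDr addr_ge0.
  - by apply: le_trans b1 _; rewrite /c -addrA lerDl addr_ge0.
  - by apply: le_trans b2 _; rewrite /c addrAC lerDr addr_ge0.
move=> i; have := hK _ _ bnd c_ge0 i; congr (_ <= _); congr (`|_|).
rewrite -[in RHS](monomial_mapK zT hN) Ez lg_monomial // mxE Nvr 2!mulr_sumr -sumrB.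
by apply: eq_bigr => j _; ring.
Qed.

Lemma lg_combination (R : realType) (b c : R[i]) : exists k : R, forall u v w : R[i],
  u != 0 -> v != 0 -> w != 0 -> u = b * v + c * w -> lg u <= Num.max (lg v) (lg w) + k.
Proof.
exists (ln (nm b + nm c + 1)) => u v w u0 v0 w0 E.
have k0 : 0 < nm b + nm c + 1 by rewrite ltr_wpDl // addr_ge0 // nm_ge0.
pose M := Num.max (lg v) (lg w).
have le x : x != 0 -> lg x <= M -> nm x <= expR M.
  by move=> x0 h; rewrite -(@lnK _ (nm x)) ?posrE ?nm_gt0 // ler_expR.
have hv : nm v <= expR M by apply: le => //; rewrite le_max lexx.
have hw : nm w <= expR M by apply: le => //; rewrite le_max lexx orbT.
have M0 := expR_gt0 M.
have : nm u <= expR M * (nm b + nm c + 1).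
  rewrite E; apply: le_trans (nm_le_add _ _) _; rewrite !nmM !mulrDr mulr1.
  apply: ler_wpDr; first exact: ltW.
  by rewrite lerD // mulrC ler_wpM2r // nm_ge0.
move=> /ln_mono; rewrite nm_gt0 => /(_ u0); rewrite lnM ?posrE // expRK //.
Qed.

(** Inequalities up to a constant become exact in the limit. *)
Lemma max_limit (R : realType) (p q r k : R) :
  (forall e T : R, 0 < e -> exists t a b c, [/\ T < t, `|a - t * p| <= e * t,
     `|b - t * q| <= e * t, `|c - t * r| <= e * t & a <= Num.max b c + k]) ->
  p <= Num.max q r.
Proof.
move=> h; rewrite leNgt; apply/negP; rewrite gt_max => /andP[qp rp].
have aux (s e t a b : R) : e * 4 <= p - s -> 2 * k < t * e ->
    `|a - t * p| <= e * t -> `|b - t * s| <= e * t -> 0 < t -> 0 < e -> a <= b + k -> False.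
  rewrite !ler_norml => h1 h2 /andP[h3 _] /andP[_ h4] t0 e0 h5.
  have h6 : t * (e * 4) <= t * (p - s) by rewrite ler_wpM2l // ltW.
  have h7 : 0 < t * e by rewrite mulr_gt0.
  move: h2 h3 h4 h6 h7; rewrite (mulrC e t) mulrBr mulrA => h2 h3 h4 h6 h7; lra.
pose e := Num.min (p - q) (p - r) / 4.
have m0 : 0 < Num.min (p - q) (p - r) by rewrite lt_min !subr_gt0 qp.
have e0 : 0 < e by rewrite divr_gt0.
have e4 : e * 4 = Num.min (p - q) (p - r) by rewrite /e divfK // pnatr_eq0.
have [t [a [b [c [Tt ha hb hc]]]]] := h e (Num.max 0 (2 * k / e)) e0.
move: Tt; rewrite gt_max ltr_pdivrMr // => /andP[t0 te].
have hq : e * 4 <= p - q by rewrite e4 ge_min lexx.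
have hr : e * 4 <= p - r by rewrite e4 ge_min lexx orbT.
rewrite maxEle; case: ifP => _ H.
  exact: (aux r e t a c).
exact: (aux q e t a b).
Qed.

Lemma tropical_line_cases (R : realType) (r0 r1 r2 : R) :
  [/\ r1 <= Num.max 0 r0, r0 <= Num.max 0 r1 & 0 <= Num.max r0 r1] ->
  [/\ r2 <= Num.max 0 r0, r0 <= Num.max 0 r2 & 0 <= Num.max r0 r2] ->
  [/\ r2 <= Num.max 0 r1, r1 <= Num.max 0 r2 & 0 <= Num.max r1 r2] ->
  exists2 a, 0 <= a & [\/ [/\ r0 = - a, r1 = 0 & r2 = 0], [/\ r0 = 0, r1 = - a & r2 = 0],
    [/\ r0 = 0, r1 = 0 & r2 = - a] | [/\ r0 = a, r1 = a & r2 = a]].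
Proof.
rewrite !le_max => -[/orP h1 /orP h2 /orP h3] [/orP h4 /orP h5 /orP h6] [/orP h7 /orP h8 /orP h9].
have [n0|p0] := ltP r0 0.
  exists (- r0); first by rewrite oppr_ge0 ltW.
  by constructor 1; split; lra.
have [n1|p1] := ltP r1 0.
  exists (- r1); first by rewrite oppr_ge0 ltW.
  by constructor 2; split; lra.
have [n2|p2] := ltP r2 0.
  exists (- r2); first by rewrite oppr_ge0 ltW.
  by constructor 3; split; lra.
by exists r0 => //; constructor 4; split; lra.
Qed.

(** Each of the three terms of the relation g = c + a f is bounded by a multiple
    of the larger of the two others. *)
Lemma affine_limit (R : realType) (X : set {ffun 'I_3 -> R[i]}) (f g : {ffun 'I_3 -> R[i]} -> R[i])
    (c a : R[i]) (p q : R) : c != 0 -> a != 0 ->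
  (forall z, X z -> [/\ f z != 0, g z != 0 & g z = c + a * f z]) ->
  (forall e T : R, 0 < e -> exists t z, [/\ T < t, X z, `|lg (f z) - t * p| <= e * t & `|lg (g z) - t * q| <= e * t]) ->
  [/\ q <= Num.max 0 p, p <= Num.max 0 q & 0 <= Num.max p q].
Proof.
move=> c0 a0 hX h.
have lg1 : lg (1 : R[i]) = 0 by rewrite nm1 ln1.
have one (t e : R) : 0 <= e * t -> `|lg (1 : R[i]) - t * 0| <= e * t.
  by rewrite lg1 mulr0 subrr normr0.
have [k1 h1] := lg_combination c a.
have [k2 h2] := lg_combination (- c / a) a^-1.
have [k3 h3] := lg_combination (- a / c) c^-1.
have o : (1 : R[i]) != 0 := oner_neq0 _.
split.
- apply: (@max_limit _ _ _ _ k1) => e T /(h e T)[t [z [Tt /hX[f0 g0 E] H1 H2]]].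
  exists t, (lg (g z)), (lg (1 : R[i])), (lg (f z)); split=> //.
    by apply: one; exact: le_trans H1.
  have := h1 (g z) 1 (f z) g0 o f0; rewrite mulr1 => /(_ E).
  by [].
- apply: (@max_limit _ _ _ _ k2) => e T /(h e T)[t [z [Tt /hX[f0 g0 E] H1 H2]]].
  exists t, (lg (f z)), (lg (1 : R[i])), (lg (g z)); split=> //.
    by apply: one; exact: le_trans H1.
  by apply: h2 => //; rewrite E; field.
- apply: (@max_limit _ _ _ _ k3) => e T /(h e T)[t [z [Tt /hX[f0 g0 E] H1 H2]]].
  exists t, (lg (1 : R[i])), (lg (f z)), (lg (g z)); split=> //.
    by apply: one; exact: le_trans H1.
  by apply: h3 => //; rewrite E; field.
Qed.

(** The coordinates of the line satisfy pairwise an affine relation, so the limits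
    satisfy pairwise the tropical relation: the maximum of 0, y_i, y_j is
    attained twice. *)
Lemma line_chart_limsup (R : realType) (X : set {ffun 'I_3 -> R[i]}) N x :
  line_chart X N -> log_limsup X x ->
  exists a (v : 'cV[int]_3), [/\ 0 <= a,
    v \in [:: vec3 (-1) 0 0; vec3 0 (-1) 0; vec3 0 0 (-1); vec3 1 1 1] &
    x = a *: realv R (invmx N *m v)].
Proof.
move=> [hN [c1 [a1 [c2 [a2 [hc hd EX]]]]]] hx.
have [c10 a10 c20 a20] := and4P hc.
have XT : X `<=` @torus R 3 by rewrite EX => z [].
pose y i : R := \sum_j (N i j)%:~R * x j 0.
have rel i j (c a : R[i]) : c != 0 -> a != 0 ->
    (forall z, X z -> monomial_map N z j = c + a * monomial_map N z i) ->
    [/\ y j <= Num.max 0 (y i), y i <= Num.max 0 (y j) & 0 <= Num.max (y i) (y j)].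
  move=> c0 a0 h; apply: (@affine_limit R X (fun z => monomial_map N z i) (fun z => monomial_map N z j) c a) => //.
    by move=> z Xz; split; [exact/torus_monomial/XT|exact/torus_monomial/XT|exact: h].
  move=> e T e0; have [t [z [Tt Xz hz]]] := @log_limsup_monomial _ _ _ N _ XT hx e T e0.
  by exists t, z; split; rewrite ?hz.
have r01 := rel 0 1 c1 a1 c10 a10 ltac:(by rewrite EX => z []).
have r02 := rel 0 2%:R c2 a2 c20 a20 ltac:(by rewrite EX => z []).
(* Eliminating the parameter. *)
have r12 := rel 1 2%:R (c2 - a2 * c1 / a1) (a2 / a1).
have {}r12 : [/\ y 2%:R <= Num.max 0 (y 1), y 1 <= Num.max 0 (y 2%:R) & 0 <= Num.max (y 1) (y 2%:R)].
  apply: r12.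
  - have -> : c2 - a2 * c1 / a1 = - (c1 * a2 - c2 * a1) / a1 by field.
    by rewrite mulf_neq0 ?invr_eq0 ?oppr_eq0 ?subr_eq0.
  - by rewrite mulf_neq0 ?invr_eq0.
  - by move=> z; rewrite EX => -[_ -> ->]; field.
have xE (v : 'cV[int]_3) a : (forall i, y i = a * realv R v i 0) -> x = a *: realv R (invmx N *m v).
  move=> h; apply/matrixP => i j; rewrite ord1 mxE realvM mulr_sumr.
  have : \sum_k (invmx N i k)%:~R * y k = x i 0.
    under eq_bigr => k _ do rewrite /y mulr_sumr.
    rewrite exchange_big /= (bigD1 i) //= [X in _ + X]big1 ?addr0 => [|k ki].
      under eq_bigr => k _ do rewrite mulrA -intrM.
      rewrite -mulr_suml -rmorph_sum /=.
      by have := congr1 (fun A : 'M_3 => A i i) (mulVmx hN); rewrite !mxE eqxx => ->; rewrite mul1r.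
    under eq_bigr => l _ do rewrite mulrA -intrM.
    rewrite -mulr_suml -rmorph_sum /=.
    by have := congr1 (fun A : 'M_3 => A i k) (mulVmx hN); rewrite !mxE eq_sym (negPf ki) => ->; rewrite mul0r.
  by move=> <-; apply: eq_bigr => k _; rewrite h mulrCA.
have [a a0 h] := tropical_line_cases r01 r02 r12; exists a.
case: h => -[h0 h1 h2]; [exists (vec3 (-1) 0 0)|exists (vec3 0 (-1) 0)|exists (vec3 0 0 (-1))|exists (vec3 1 1 1)];
  split; rewrite ?inE ?eqxx ?orbT //; apply: xE; elim/ord3_ind;
  by rewrite ?h0 ?h1 ?h2 !mxE /= ?mulr0 ?mulr1 ?mulrN1.
Qed.

(** * Approximable curves *)

Definition line_edges : seq 'cV[int]_3 :=
  [:: vec3 (-1) 0 0; vec3 0 (-1) 0; vec3 0 0 (-1); vec3 1 1 1].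

Lemma line_chart_edge (R : realType) (X : set {ffun 'I_3 -> R[i]}) N w :
  line_chart X N -> w \in line_edges ->
  exists2 Q, line_chart X Q & Q *m (invmx N *m w) = - delta_mx 0 0.
Proof.
move=> hX; have hN := hX.1.
have NV (Q : 'M[int]_3) : Q *m N *m (invmx N *m w) = Q *m w.
  by rewrite -!mulmxA mulKVmx.
rewrite !inE => /or4P[] /eqP E; move: NV; rewrite {}E => NV.
- exists N => //; rewrite mulKVmx //.
  by apply/colP; elim/ord3_ind; rewrite !mxE.
- exists (swap01 *m N); first exact: line_chart_swap01.
  by rewrite NV; apply/colP; elim/ord3_ind; rewrite !mxE sum3 !mxE.
- exists (swap02 *m N); first exact: line_chart_swap02.
  by rewrite NV; apply/colP; elim/ord3_ind; rewrite !mxE sum3 !mxE.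
- exists (invert0 *m N); first exact: line_chart_invert0.
  by rewrite NV; apply/colP; elim/ord3_ind; rewrite !mxE sum3 !mxE.
Qed.

Lemma line_chart_tropicalizes (R : realType) (X : set {ffun 'I_3 -> R[i]}) N C :
  line_chart X N -> perm_eq C [seq (invmx N *m w, 1%N) | w <- line_edges] ->
  tropicalizes_to X C.
Proof.
move=> hX hC.
have CP e : e \in C -> exists2 w, w \in line_edges & e = (invmx N *m w, 1%N).
  by rewrite (perm_mem hC) => /mapP[w hw ->]; exists w.
have PC w : w \in line_edges -> (invmx N *m w, 1%N) \in C.
  by move=> hw; rewrite (perm_mem hC); apply/mapP; exists w.
have ray_liminf w a : w \in line_edges -> 0 <= a -> log_liminf X (a *: realv R (invmx N *m w)).
  by move=> hw a0; have [Q hQ Qw] := line_chart_edge hX hw; exact: line_chart_ray hQ Qw a0.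
have fan_liminf : fan_support C `<=` log_liminf X.
  move=> x [->|[e /CP[w hw ->] [a a0 ->]]]; last exact: ray_liminf.
  by rewrite -(scale0r (realv R (invmx N *m vec3 (-1) 0 0))); apply: ray_liminf => //; rewrite inE eqxx.
have limsup_fan : log_limsup X `<=` fan_support C.
  move=> x /(line_chart_limsup hX)[a [w [a0 hw ->]]]; right.
  by exists (invmx N *m w, 1%N); [exact: PC|exists a].
have li := @log_liminf_limsup R X.
split.
  split; apply/seteqP; split=> x hx; [exact/limsup_fan/li|exact: fan_liminf| |].
    exact: limsup_fan.
  exact/li/fan_liminf.
move=> e /CP[w hw ->] /=; have [Q [hQ [c1 [a1 [c2 [a2 [hc _ EX]]]]]] Qw] := line_chart_edge hX hw.
exact: (line_edge_weight hQ hc EX).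
Qed.

Lemma line_chart_curve (R : realType) (X : set {ffun 'I_3 -> R[i]}) N :
  line_chart X N -> algebraic_curve X.
Proof.
move=> [hN [c1 [a1 [c2 [a2 [hc hd EX]]]]]]; exists 0%N, (fun=> X); split.
  by move=> _; apply: (line_irreducible_curve hN hc EX).
by apply/seteqP; split=> [x Xx|x [i _ //]]; exists ord0.
Qed.

(** For n = 2 the line Y = - (1 + S) is the one found above: W is then
    (1 + S) (1 - S^2), which is (1 + S)^2 (1 - S). For n < 2 there are many
    lines; the values are chosen to make all the coefficients nonzero and the
    two roots distinct. *)
Lemma third_on_line (R : realType) n : (n <= 2)%N -> exists c1 a1 c2 a2 : R[i],
  [/\ [&& c1 != 0, a1 != 0, c2 != 0 & a2 != 0], c1 * a2 != c2 * a1 &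
    forall S, third n S (c1 + a1 * S) = (c1 + a1 * S) ^+ n * (c2 + a2 * S)].
Proof.
have q (k : nat) : (k.+1%:R : R[i]) != 0 by rewrite pnatr_eq0.
case: n => [|[|[|//]]] _.
- exists 2, 1, (- 3), (- 2); split.
  + by rewrite !oppr_eq0 oner_neq0 !q.
  + by rewrite -subr_eq0 (_ : 2 * - 2 - - 3 * 1 = - 1 :> R[i]) ?oppr_eq0 ?oner_neq0 //; ring.
  + by move=> S; rewrite /third /offset hornerD !hornerXn; ring.
- exists 2, 2, (- 1), (- 2^-1); split.
  + by rewrite !oppr_eq0 invr_eq0 oner_neq0 !q.
  + by rewrite -subr_eq0 (_ : 2 * - 2^-1 - - 1 * 2 = 1 :> R[i]) ?oner_neq0 //; field.
  + by move=> S; rewrite /third /offset hornerD !hornerXn; field.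
- exists (- 1), (- 1), 1, (- 1); split.
  + by rewrite !oppr_eq0 oner_neq0.
  + by rewrite -subr_eq0 (_ : -1 * - 1 - 1 * - 1 = 2 :> R[i]) ?q //; ring.
  + by move=> S; rewrite /third /offset hornerD !hornerXn; ring.
Qed.

(** The coordinates (S, Y, W / Y^n). *)
Definition shear_mx (n : nat) : 'M[int]_3 :=
  mat3 [:: [:: 1; 0; 0]; [:: 0; 1; 0]; [:: 0; - n%:Z; 1]].

Lemma shear_mx_unit n : shear_mx n \in unitmx.
Proof.
suff /mulmx1_unit[] : shear_mx n *m mat3 [:: [:: 1; 0; 0]; [:: 0; 1; 0]; [:: 0; n%:Z; 1]] = 1%:M by [].
apply/matrixP; elim/ord3_ind; elim/ord3_ind; rewrite !mxE sum3 !mxE /=; ring.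
Qed.

Lemma shear_vec3 n a b c : shear_mx n *m vec3 a b c = vec3 a b (c - n%:Z * b).
Proof. by apply/colP; elim/ord3_ind; rewrite !mxE sum3 !mxE /=; ring. Qed.

Lemma shear_monomial (R : realType) n (y : {ffun 'I_3 -> R[i]}) :
  let m := monomial_map (shear_mx n) y in
  [/\ m 0 = y 0, m 1 = y 1 & m 2%:R = (y 1 ^+ n)^-1 * y 2%:R].
Proof. by split; rewrite ffunE prod3 !mxE /= !expr0z ?expr1z ?mul1r ?mulr1 // -exprnN. Qed.

Lemma line_in_surface (R : realType) (P : set {ffun 'I_3 -> R[i]})
    (N : 'M[int]_3) (ka : {ffun 'I_3 -> R[i]}) n :
  (n <= 2)%N -> N \in unitmx -> torus ka ->
  P = [set z | torus z /\ ka 2%:R * monomial_map N z 2%:R =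
           third n (ka 0 * monomial_map N z 0) (ka 1 * monomial_map N z 1)] ->
  exists2 X, line_chart X (shear_mx n *m N) & X `<=` P.
Proof.
move=> n2 hN hk EP; have [c1 [a1 [c2 [a2 [/and4P[h1 h2 h3 h4] hd key]]]]] := third_on_line R n2.
have k0 := hk 0; have k1 := hk 1; have k2 := hk 2%:R.
pose M := shear_mx n *m N.
have [l l0 El] : exists2 l, l != 0 & l = ka 1 ^+ n / ka 2%:R.
  by exists (ka 1 ^+ n / ka 2%:R); rewrite // mulf_neq0 ?invr_eq0 ?expf_neq0.
exists [set z | [/\ torus z,
    monomial_map M z 1 = c1 / ka 1 + a1 * ka 0 / ka 1 * monomial_map M z 0 &
    monomial_map M z 2%:R = l * c2 + l * a2 * ka 0 * monomial_map M z 0]].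
  split; first by rewrite unitmx_mul hN shear_mx_unit.
  exists (c1 / ka 1), (a1 * ka 0 / ka 1), (l * c2), (l * a2 * ka 0); split=> //.
    by rewrite !mulf_eq0 !invr_eq0 !negb_or h1 h2 h3 h4 k0 k1 l0.
  rewrite -subr_eq0; have -> : c1 / ka 1 * (l * a2 * ka 0) - l * c2 * (a1 * ka 0 / ka 1) =
     l * ka 0 / ka 1 * (c1 * a2 - c2 * a1) by field.
  by rewrite !mulf_eq0 !invr_eq0 !negb_or l0 k0 k1 subr_eq0.
move=> z [zT]; rewrite EP /M monomial_mapM //.
have [-> -> ->] := shear_monomial n (monomial_map N z) => e1 e2; split=> //=.
have yT := torus_monomial N zT; move: (monomial_map N z) yT e1 e2 => y yT e1 e2.
have ky : ka 1 * y 1 = c1 + a1 * (ka 0 * y 0) by rewrite e1; field.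
rewrite ky key -ky -[y 2%:R](mulVKf (expf_neq0 n (yT 1))) e2 exprMn El; field.
exact: k2.
Qed.

Lemma fan_limsup_on_rays (R : realType) (X : set {ffun 'I_3 -> R[i]}) C n (N : 'M[int]_3) :
  log_limsup X = fan_support C ->
  (forall e, e \in C -> N *m e.1 \in [:: vec3 0 (-1) (- n%:Z); vec3 1 1 n.+1%:Z; vec3 (-1) 0 0; vec3 0 0 (-1)]) ->
  forall x, log_limsup X x -> on_rays n (\sum_j (N 0 j)%:~R * x j 0)
    (\sum_j (N 1 j)%:~R * x j 0) (\sum_j (N 2%:R j)%:~R * x j 0).
Proof.
move=> -> hN x [->|[e eC [a a0 ->]]].
  have h i : \sum_j (N i j)%:~R * (0 : 'cV[R]_3) j 0 = 0.
    by rewrite big1 // => j _; rewrite mxE mulr0.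
  by rewrite !h; exists 0; split=> //; constructor 3; split; rewrite ?oppr0.
have h i : \sum_j (N i j)%:~R * (a *: realv R e.1) j 0 = a * realv R (N *m e.1) i 0.
  by rewrite realvM mulr_sumr; apply: eq_bigr => j _; rewrite mxE mulrCA.
rewrite !h; exists a; split=> //; have := hN e eC.
rewrite !inE => /or4P[] /eqP ->; [constructor 1|constructor 2|constructor 3|constructor 4]; split;
  by rewrite !mxE /= ?mulr0 ?mulr1 ?mulrN1 ?rmorphN /= ?mulrN ?(mulrC a).
Qed.

Theorem corollary5p4 (R : realType) (P : set {ffun 'I_3 -> R[i]})
  (TropP : set 'cV[R]_3) (u : 'I_4 -> 'cV[int]_3) (d : nat)
  (C : seq ('cV[int]_3 * nat))
  (hP : uniform_plane P)
  (hTrop : log_limit P TropP)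
  (hu : uniform_plane_fan TropP u)
  (hd : (1 <= d)%N)
  (hC : fan_tropical_curve C)
  (hCP : fan_support C `<=` TropP)
  (hCd : perm_eq C [:: (u 1 + u 2 *+ d.-1, 1%N);
                       (u 1 *+ d.-1 + u 0, 1%N);
                       (u 3 *+ d + u 0 *+ d.-1, 1%N);
                       (u 2, 1%N)]) :
  approximable_in P C <-> d = 1%N \/ d = 2%N \/ d = 3%N.
Proof.
case: d hd hCd => [//|n] _ /= hCd.
have [N [ka [hN hk [NA NB NC ND] EP]]] := standard_coordinates n hP hTrop hu.
split=> [[X [Xcurve XP [[_ limsupX] weightX]]]|hn].
  have [n0|n0] := posnP n; first by left; rewrite n0.
  suff n2 : (n <= 2)%N by right; lia.
  have vC : (u 3 *+ n.+1 + u 0 *+ n, 1%N) \in C.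
    by rewrite (perm_mem hCd) !inE eqxx !orbT.
  apply: (trace_bound hN hk EP XP n0 (algebraic_curve_closed Xcurve) NC).
  - exact: weightX vC.
  - by rewrite limsupX; right; exists (u 3 *+ n.+1 + u 0 *+ n, 1%N) => //; exists 1; rewrite ?scale1r.
  - apply: (fan_limsup_on_rays limsupX) => e; rewrite (perm_mem hCd) !inE.
    by case/or4P => /eqP -> /=; rewrite ?NA ?NB ?NC ?ND eqxx ?orbT.
have n2 : (n <= 2)%N by lia.
have [X hX XP] := line_in_surface n2 hN hk EP.
exists X; split=> //; first exact: line_chart_curve hX.
apply: (line_chart_tropicalizes hX).
have hM := hX.1; apply: (perm_trans hCd).
have inv (v w : 'cV[int]_3) : shear_mx n *m (N *m v) = w -> invmx (shear_mx n *m N) *m w = v.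
  by move=> <-; rewrite mulmxA mulKmx.
rewrite /= (inv (u 3 *+ n.+1 + u 0 *+ n)) ?NC ?shear_vec3 ?mulr0 ?subr0 //.
rewrite (inv (u 1 + u 2 *+ n)) ?NA ?shear_vec3 ?mulrN1 ?subrr //.
rewrite (inv (u 2)) ?ND ?shear_vec3 ?mulr0 ?subr0 //.
rewrite (inv (u 1 *+ n + u 0)) ?NB ?shear_vec3 ?mulr1 ?intS ?addrK //.
apply/permP => p /=; lia.
Qed.
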